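(* For $i\in\{0,1\}$ and every $\sigma\in[0,\frac12)$, $\bar u^i_{\mathrm{sing}}\in H^{\frac{2+\sigma}{3}}((x_0,x_1);L^2(-1,1))\cap L^2((x_0,x_1);H^{2+\sigma}(-1,1))$.
   Context: Fix $x_0<x_1$, $\Omega=(x_0,x_1)\times(-1,1)$, coordinates $(x,z)$. Let $M(a,b,\zeta)=\sum_{n\ge0}\frac{(a)_n}{(b)_n}\frac{\zeta^n}{n!}$ be Kummer's function and $\Lambda_0(t)=9^{1/6}(1+t^2)^{-1/4}\big[\frac{\Gamma(1/3)}{\Gamma(1/6)}M(-\frac16,\frac23,-\frac{t^3}9)-\frac{t}{9^{1/3}}\frac{\Gamma(-1/3)}{\Gamma(-1/6)}M(\frac16,\frac43,-\frac{t^3}9)\big]$. For $i=0,1$ let $\chi_i\in C^\infty(\overline\Omega)$ with $\chi_i\equiv1$ near $(x_i,0)$ and $\operatorname{supp}\chi_i\subset B((x_i,0),\bar R)$, $\bar R<\min(1,x_1-x_0)/2$; $r_i=(z^2+|x-x_i|^{2/3})^{1/2}$, $t_i=(-1)^iz|x-x_i|^{-1/3}$, and $\bar u^i_{\mathrm{sing}}:=r_i^{1/2}\Lambda_0(t_i)\chi_i$. *)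

(* Defs.v *)
From HB Require Import structures.
From mathcomp Require Import all_boot all_order all_algebra.
From mathcomp Require Import all_classical all_reals all_analysis.
Set Implicit Arguments. Unset Strict Implicit. Unset Printing Implicit Defensive.
Import Order.TTheory GRing.Theory Num.Theory.
Import numFieldNormedType.Exports.
Local Open Scope classical_set_scope.
Local Open Scope ring_scope.

Section Defs.
Variable R : realType.

Definition poch (a : R) (n : nat) : R := \prod_(k < n) (a + k%:R).

Definition kummerM (a b z : R) : R :=
  limn (series (fun n : nat => poch a n / poch b n * z ^+ n / (n`!)%:R)).

Definition GammaInt (x : R) : R :=
  \int[lebesgue_measure]_(t in `]0, +oo[%classic) (t `^ (x - 1) * expR (- t)).

(* Gamma function on all non-pole reals, via Gamma(x) = Gamma(x+n)/((x)(x+1)...(x+n-1))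
   with n > |x|, so that x + n > 0. *)
Definition Gamma (x : R) : R :=
  let n := (Num.truncn `|x|).+1 in GammaInt (x + n%:R) / poch x n.

Definition Lambda0 (t : R) : R :=
  9 `^ (1/6) * (1 + t ^+ 2) `^ (- (1/4)) *
  (Gamma (1/3) / Gamma (1/6) * kummerM (- (1/6)) (2/3) (- (t ^+ 3 / 9))
   - t / 9 `^ (1/3) * (Gamma (- (1/3)) / Gamma (- (1/6)))
       * kummerM (1/6) (4/3) (- (t ^+ 3 / 9))).

Definition dir2 (b : bool) : R * R := if b then (0, 1) else (1, 0).

(* iterated partial derivatives: false = d/dx, true = d/dz *)
Fixpoint iterD (s : seq bool) (f : R * R -> R) : R * R -> R :=
  if s is b :: s' then 'D_(dir2 b) (iterD s' f) else f.

Definition Cinf2 (f : R * R -> R) : Prop :=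
  forall (s : seq bool) (p : R * R),
    derivable (iterD s f) p (dir2 false) /\ derivable (iterD s f) p (dir2 true)
    /\ {for p, continuous (iterD s f)}.

Definition dist2 (p q : R * R) : R := Num.sqrt ((p.1 - q.1) ^+ 2 + (p.2 - q.2) ^+ 2).

Definition Omega_bar (x0 x1 : R) : set (R * R) :=
  [set p | x0 <= p.1 <= x1 /\ -1 <= p.2 <= 1].

Definition Cinf_closed (x0 x1 : R) (chi : R -> R -> R) : Prop :=
  exists F : R * R -> R, Cinf2 F /\
    forall p, Omega_bar x0 x1 p -> F p = chi p.1 p.2.

Definition supp_closed (x0 x1 : R) (chi : R -> R -> R) : set (R * R) :=
  [set p | Omega_bar x0 x1 p /\
     forall e : R, 0 < e -> exists q, Omega_bar x0 x1 q /\ dist2 p q < e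
                                      /\ chi q.1 q.2 != 0].

Definition xi (x0 x1 : R) (i : bool) : R := if i then x1 else x0.

Definition u_sing (x0 x1 : R) (i : bool) (chi : R -> R -> R) (x z : R) : R :=
  let xc := xi x0 x1 i in
  let r := Num.sqrt (z ^+ 2 + `|x - xc| `^ (2/3)) in
  let t := (-1) ^+ i * z * `|x - xc| `^ (- (1/3)) in
  r `^ (1/2) * Lambda0 t * chi x z.

Definition Omega_open (x0 x1 : R) : set (R * R) := `]x0, x1[ `*` `]-1, 1[.

Definition jmeas (x0 x1 : R) (u : R -> R -> R) : Prop :=
  measurable_fun (Omega_open x0 x1) (fun p : R * R => u p.1 p.2).

Local Open Scope ereal_scope.

Definition leb := (@lebesgue_measure R).

Definition L2sq (c d : R) (f : R -> R) : \bar R :=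
  \int[leb]_(z in `]c, d[) ((f z) ^+ 2)%:E.

Definition gagliardo (c d s : R) (f : R -> R) : \bar R :=
  \int[leb]_(z in `]c, d[) \int[leb]_(w in `]c, d[)
     (((f z - f w) ^+ 2) / (`|z - w| `^ (1 + 2 * s)))%:E.

Definition test_fun (c d : R) (phi : R -> R) : Prop :=
  (forall n t, derivable (derive1n n phi) t 1) /\
  exists c' d', (c < c' /\ c' < d' /\ d' < d)%R /\
    forall t, ~ (c' <= t <= d')%R -> phi t = 0%R.

Definition weak_deriv (c d : R) (f g : R -> R) : Prop :=
  leb.-integrable `]c, d[ (EFin \o f) /\ leb.-integrable `]c, d[ (EFin \o g) /\
  forall phi, test_fun c d phi ->
    (\int[leb]_(t in `]c, d[) (f t * derive1 phi t))%R =
    (- \int[leb]_(t in `]c, d[) (g t * phi t))%R.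

(* u in H^s((x0,x1); L^2(-1,1)), for 0 < s < 1 (Sobolev-Slobodeckij definition):
   u in L^2((x0,x1);L^2(-1,1)) and
   int int ||u(x,.) - u(y,.)||^2_{L^2} / |x-y|^{1+2s} dx dy < oo *)
Definition H_s_L2 (x0 x1 s : R) (u : R -> R -> R) : Prop :=
  jmeas x0 x1 u /\
  \int[leb]_(x in `]x0, x1[) L2sq (-1)%R 1%R (u x) < +oo /\
  \int[leb]_(x in `]x0, x1[) \int[leb]_(y in `]x0, x1[)
     (L2sq (-1)%R 1%R (fun z => u x z - u y z)%R
        * ((`|x - y| `^ (1 + 2 * s))^-1)%:E) < +oo.

Definition L2_H2s (x0 x1 sigma : R) (u : R -> R -> R) : Prop :=
  exists v1 v2 : R -> R -> R,
    jmeas x0 x1 u /\ jmeas x0 x1 v1 /\ jmeas x0 x1 v2 /\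
    {ae leb, forall x, `]x0, x1[%classic x ->
        weak_deriv (-1)%R 1%R (u x) (v1 x) /\ weak_deriv (-1)%R 1%R (v1 x) (v2 x)} /\
    \int[leb]_(x in `]x0, x1[)
       (L2sq (-1)%R 1%R (u x) + L2sq (-1)%R 1%R (v1 x) + L2sq (-1)%R 1%R (v2 x)
        + (if sigma == 0%R then 0 else gagliardo (-1)%R 1%R sigma (v2 x))) < +oo.

End Defs.

(* Main.v *)
Require Import Defs.
From HB Require Import structures.
From mathcomp Require Import all_boot all_order all_algebra.
From mathcomp Require Import all_classical all_reals all_analysis.
From mathcomp Require Import measurable_realfun ring lra.
Set Implicit Arguments. Unset Strict Implicit. Unset Printing Implicit Defensive.
Import Order.TTheory GRing.Theory Num.Theory.
Import numFieldNormedType.Exports.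
Local Open Scope classical_set_scope.
Local Open Scope ring_scope.

(**
Write d = |x - x_i|, Lambda0 t = (1 + t^2)^(-1/4) g t and w = g - 2 t g'. Then
u = d^(1/6) g (+- z d^(-1/3)) chi, and Kummer's equation becomes g'' = t w / 6,
whence w'' + t^2 w' / 3 + 5 t w / 6 = 0. The crux is that w = O(|t|^(-5/2)) at both
ends. At +oo every solution decays in this way, by an energy estimate. At -oo the
generic solution grows exponentially; the recessive one is the Laplace integral
K(t) = int_0^oo v^(1/6) (v - t^3/9)^(-5/6) e^(-v) dv, and the quotients of Gamma values in
Lambda0 are exactly those for which the Wronskian of w and K vanishes at 0.

With rho = |z| + d^(1/3) this gives |d_z^k u| <= C rho^(1/2 - k) for k <= 3 and
|d_x u| <= C rho^(-5/2). Interpolating between a function and its derivative yields the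
Hoelder estimates that bound the Gagliardo integrands, and
rho^(-m) <= |z|^(-m/4) d^(-m/4) with m < 4 makes these bounds integrable.
*)

(** * Kummer's equation *)

Section KummerFunction.
Context {R : realType}.
Implicit Types (c : R^nat) (x a b : R).

(** The combination w is forced by the x-derivative: differentiating d^(1/6) g(z d^(-1/3)) in d
    gives d^(-5/6) w / 6. As g - 2 t g' annihilates |t|^(1/2), the growth of g, the decay of w is a
    cancellation; the growth bound on g alone would leave |z|^(1/2) / d, which is not controlled by
    rho^(-5/2) as d tends to 0 with z fixed.

    The condition sigma < 1/2 is the same in both directions. Under (z, d) -> (l z, l^3 d) the
    singular function without its cut-off has degree 1/2 and area scales by l^4. Order 2 + sigma in
    z and order (2 + sigma)/3 in x both lower the degree by 2 + sigma, so squares have size rho^(-(3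
    + 2 sigma)), and 3 + 2 sigma < 4 is needed for integrability. The Hoelder exponent [th] is taken
    strictly above the Sobolev order, which makes the kernel integrable at the diagonal, and below
    the value where the weight would reach the exponent 4. *)

Lemma is_cvg_pseries_le_inv_fact c x :
  (forall n, `|c n| <= (n`!%:R)^-1) -> cvgn (pseries c x).
Proof.
move=> hc; apply: normed_cvg.
apply: (@series_le_cvg _ _ (exp_coeff `|x|)).
- by move=> n; rewrite /=.
- by move=> n; apply: exp_coeff_ge0.
- move=> n /=; rewrite normrM normrX /exp_coeff /= mulrC.
  by rewrite ler_wpM2l// exprn_ge0.
- exact: is_cvg_series_exp_coeff.
Qed.

(** The class of coefficients bounded by 1/n! is stable under termwise differentiation because
    (n+1)/(n+1)! = 1/n!. One estimate thus makes a series and all its formal derivatives converge on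
    the whole line. *)
Lemma pseries_diffs_le_inv_fact c :
  (forall n, `|c n| <= (n`!%:R)^-1) ->
  forall n, `|pseries_diffs c n| <= (n`!%:R)^-1.
Proof.
move=> hc n; rewrite /pseries_diffs normrM normr_nat.
rewrite (le_trans (ler_wpM2l _ (hc _)))// factS natrM invfM mulrA divff ?mul1r//.
Qed.

Lemma is_derive_pseries_le_inv_fact c x :
  (forall n, `|c n| <= (n`!%:R)^-1) ->
  is_derive x (1 : R) (fun x => limn (pseries c x))
    (limn (pseries (pseries_diffs c) x)).
Proof.
move=> hc; apply: (@pseries_snd_diffs _ _ (`|x| + 1)).
- exact: is_cvg_pseries_le_inv_fact.
- exact/is_cvg_pseries_le_inv_fact/pseries_diffs_le_inv_fact.
- exact/is_cvg_pseries_le_inv_fact/pseries_diffs_le_inv_fact/pseries_diffs_le_inv_fact.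
- by rewrite [X in _ < X]ger0_norm ?ltrDl// addr_ge0.
Qed.

Definition kummer_coef a b n : R := poch a n / poch b n / n`!%:R.

Lemma kummerME a b x : kummerM a b x = limn (pseries (kummer_coef a b) x).
Proof.
rewrite /kummerM /pseries; congr (limn (series _)); apply/funext => n /=.
by rewrite /kummer_coef mulrAC.
Qed.

(** The condition gives |a + k| <= b + k for every natural k, so each factor of the quotient of
    Pochhammer products has modulus at most 1. Both pairs in [Lambda0], (-1/6, 2/3) and (1/6, 4/3),
    satisfy it. *)
Lemma kummer_coef_le_inv_fact a b : 0 < b -> - b <= a <= b ->
  forall n, `|kummer_coef a b n| <= (n`!%:R)^-1.
Proof.
move=> b0 /andP[ba ab] n; rewrite /kummer_coef normrM [X in _ * X]gtr0_norm ?invr_gt0 ?ltr0n ?fact_gt0//.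
rewrite ler_piMl ?invr_ge0// /poch normrM normfV -ler_pdivlMr ?invr_gt0 ?normr_gt0; last first.
  apply/prodf_neq0 => i _; have := ler0n R i; lra.
rewrite mul1r invrK !normr_prod; apply: ler_prod => i _.
rewrite normr_ge0 /=; have i0 := ler0n R i.
by rewrite [X in _ <= X]ger0_norm ?ler_norml; lra.
Qed.

Lemma kummer_coefS a b n : 0 < b ->
  (n.+1%:R * (b + n%:R)) * kummer_coef a b n.+1 = (a + n%:R) * kummer_coef a b n.
Proof.
move=> b0; rewrite /kummer_coef /poch !big_ord_recr /= factS natrM.
have h : b + n%:R != 0 :> R by have := ler0n R n; lra.
have h2 : n.+1%:R != 0 :> R by [].
have h3 : n`!%:R != 0 :> R by rewrite pnatr_eq0 -lt0n fact_gt0.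
have h4 : \prod_(i < n) (b + i%:R) != 0 :> R.
  by apply/prodf_neq0 => i _; have := ler0n R i; lra.
by field; rewrite h4 h3 h -natr1 in h2 *; lra.
Qed.

Lemma pseries_shift c x l : pseries (fun n => c n.+1) x @ \oo --> l ->
  pseries c x @ \oo --> c 0%N + x * l.
Proof.
move=> h; rewrite -(cvg_shiftS (pseries c x)).
rewrite (_ : (fun n => pseries c x n.+1) = (fun n => c 0%N + x * pseries (fun n => c n.+1) x n)); last first.
  apply/funext => n; rewrite /pseries /series /= big_nat_recl//= expr0 mulr1; congr (_ + _).
  by rewrite big_distrr /=; apply: eq_bigr => i _; rewrite exprS; ring.
by apply: cvgD; [exact: cvg_cst|exact: cvgMr].
Qed.

Definition kummerD (k : nat) a b x := limn (pseries (iter k (@pseries_diffs R) (kummer_coef a b)) x).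

(** In the difference of the two sides the coefficient of x^n is (n+1)(b+n) c_(n+1) - (a+n) c_n,
    which is zero by [kummer_coefS]; already the partial sums vanish. *)
Lemma kummer_ode a b x : 0 < b -> - b <= a <= b ->
  x * kummerD 2 a b x + (b - x) * kummerD 1 a b x = a * kummerM a b x.
Proof.
move=> b0 ab; set c := kummer_coef a b.
have hc := kummer_coef_le_inv_fact b0 ab.
have h0 : pseries c x @ \oo --> kummerM a b x.
  by rewrite kummerME; exact: is_cvg_pseries_le_inv_fact.
have h1 : pseries (pseries_diffs c) x @ \oo --> kummerD 1 a b x.
  exact/is_cvg_pseries_le_inv_fact/pseries_diffs_le_inv_fact.
have h2 : pseries (pseries_diffs (pseries_diffs c)) x @ \oo --> kummerD 2 a b x.
  exact/is_cvg_pseries_le_inv_fact/pseries_diffs_le_inv_fact/pseries_diffs_le_inv_fact.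
have h3 : pseries (fun n => n%:R * c n) x @ \oo --> x * kummerD 1 a b x.
  by rewrite -[X in _ --> X]add0r -[X in _ --> X + _](mul0r (c 0%N)); exact: (@pseries_shift (fun n => n%:R * c n)).
have h4 : pseries (fun n => n%:R * pseries_diffs c n) x @ \oo --> x * kummerD 2 a b x.
  by rewrite -[X in _ --> X]add0r -[X in _ --> X + _](mul0r (pseries_diffs c 0%N)); exact: (@pseries_shift (fun n => n%:R * pseries_diffs c n)).
have : (pseries (fun n => n%:R * pseries_diffs c n) x + b \*: pseries (pseries_diffs c) x
   - pseries (fun n => n%:R * c n) x - a \*: pseries c x) @ \oo --> x * kummerD 2 a b x + b * kummerD 1 a b x - x * kummerD 1 a b x - a * kummerM a b x.
  apply: cvgB; last exact: cvgZr.
  apply: cvgB => //; apply: cvgD => //; exact: cvgZr.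
rewrite (_ : _ - _ = cst 0); last first.
  apply/funext => n; rewrite !fctE /pseries /series /=.
  rewrite !scaler_sumr -big_split -!sumrB /=; apply: big1 => i _.
  rewrite /pseries_diffs -/c.
  have := kummer_coefS a i b0; rewrite -/c => e.
  have sc (p q : R) : p *: q = p * q by [].
  rewrite !sc; transitivity ((i.+1%:R * (b + i%:R) * c i.+1 - (a + i%:R) * c i) * x ^+ i); first by ring.
  by rewrite e subrr mul0r.
move=> /(cvg_unique (@Rhausdorff R) (cvg_cst _)) e.
lra.
Qed.

Lemma is_derive_kummerD k a b x : 0 < b -> - b <= a <= b ->
  is_derive x (1 : R) (kummerD k a b) (kummerD k.+1 a b x).
Proof.
move=> b0 ab; apply: is_derive_pseries_le_inv_fact.
by elim: k => [|k ih]; [exact: kummer_coef_le_inv_fact|exact: pseries_diffs_le_inv_fact].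
Qed.

Lemma kummerD0E a b : kummerM a b = kummerD 0 a b.
Proof. by apply/funext => x; rewrite kummerME. Qed.

Lemma kummerM0 a b : kummerM a b 0 = 1.
Proof.
apply: cvg_lim; first exact: Rhausdorff.
rewrite -(cvg_shiftS (series _)).
rewrite [X in X @ \oo](_ : _ = cst 1); first exact: cvg_cst.
apply/funext => n; rewrite /series /= big_nat_recl//= big1 ?addr0.
  by rewrite /poch !big_ord0 expr0 fact0 !divr1 mulr1.
by move=> i _; rewrite expr0n /= mulr0 mul0r.
Qed.

(** With zeta = -t^3/9, a = -1/6 and b = 2/3, the second summand is a multiple of Kummer's second
    solution zeta^(1-b) M(a-b+1, 2-b, zeta). Hence [G] is a general solution of one second-order
    equation, fixed by its value and slope at 0. *)
Lemma kummer_profile (p q : R) :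
  let G t := p * kummerM (- (1/6)) (2/3) (- (t ^+ 3 / 9))
             - t * q * kummerM (1/6) (4/3) (- (t ^+ 3 / 9)) in
  exists G1 : R -> R, [/\ forall t, is_derive t (1 : R) G (G1 t),
    forall t, is_derive t (1 : R) G1 (t / 6 * (G t - 2 * t * G1 t)),
    G 0 = p & G1 0 = - q].
Proof.
move=> G.
have hz (t : R) : is_derive t (1 : R) (fun t : R => - (t ^+ 3 / 9)) (- (t ^+ 2 / 3)).
  by apply: is_derive_eq; rewrite /GRing.scale /=; field.
have hD k a b t : 0 < b -> - b <= a <= b ->
    is_derive t (1 : R) (fun t : R => kummerD k a b (- (t ^+ 3 / 9)))
      (- (t ^+ 2 / 3) * kummerD k.+1 a b (- (t ^+ 3 / 9))).
  move=> b0 ab; have := @is_derive1_comp _ (kummerD k a b) (fun t => - (t ^+ 3 / 9)) t _ _ (is_derive_kummerD k _ b0 ab) (hz t).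
  by rewrite mulrC.
pose M k t := kummerD k (- (1/6)) (2/3) (- (t ^+ 3 / 9)) : R.
pose N k t := kummerD k (1/6) (4/3) (- (t ^+ 3 / 9)) : R.
have hM k t : is_derive t (1 : R) (M k) (- (t ^+ 2 / 3) * M k.+1 t).
  by apply: hD; lra.
have hN k t : is_derive t (1 : R) (N k) (- (t ^+ 2 / 3) * N k.+1 t).
  by apply: hD; lra.
have EG : G = fun t => p * M 0%N t - t * q * N 0%N t.
  by apply/funext => t; rewrite /G !kummerD0E.
have eM t : - (t ^+ 3 / 9) * M 2%N t + (2/3 + t ^+ 3 / 9) * M 1%N t = - (1/6) * M 0%N t.
  have := @kummer_ode (- (1/6)) (2/3) (- (t ^+ 3 / 9)).
  by rewrite kummerD0E opprK; apply; lra.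
have eN t : - (t ^+ 3 / 9) * N 2%N t + (4/3 + t ^+ 3 / 9) * N 1%N t = 1/6 * N 0%N t.
  have := @kummer_ode (1/6) (4/3) (- (t ^+ 3 / 9)).
  by rewrite kummerD0E opprK; apply; lra.
have G0 : G 0 = p by rewrite /G expr0n /= mul0r oppr0 !kummerM0; ring.
have N0 : N 0%N 0 = 1 by rewrite /N -kummerD0E expr0n /= mul0r oppr0 kummerM0.
clearbody G M N; clear hD hz.
exists (fun t => p * (- (t ^+ 2 / 3) * M 1%N t) - q * N 0%N t - t * q * (- (t ^+ 2 / 3) * N 1%N t)); split.
- move=> t; rewrite EG; apply: is_derive_eq; rewrite /GRing.scale /=; ring.
- move=> t; rewrite EG; apply: is_derive_eq; rewrite /GRing.scale /=.
  (* Up to sign, the two sides differ by p t times the Kummer equation of [M] minus q t^2 times that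
     of [N]. *)
  rewrite -[LHS]addr0 -[X in _ + X = _](_ : p * t * (- (t ^+ 3 / 9) * M 2%N t + (2/3 + t ^+ 3 / 9) * M 1%N t + (1/6) * M 0%N t) - q * t ^+ 2 * (- (t ^+ 3 / 9) * N 2%N t + (4/3 + t ^+ 3 / 9) * N 1%N t - 1/6 * N 0%N t) = 0); last first.
    by rewrite eM eN; ring.
  by field.
- by [].
- by rewrite N0; ring.
Qed.

End KummerFunction.

(** * Decay of the residual w at plus infinity *)

Section ProfileEnergy.
Context {R : realType}.

(** In terms of v = t^(5/2) w and the variable log t the equation is a damped oscillator, v'' +
    (t^3/3 - 6) v' + 35/4 v = 0. [E] is its energy 35/4 v^2 + v'^2, nonincreasing where t^3 >= 18,
    in particular for t >= 3. *)
Lemma energy_bound (w w1 : R -> R) :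
  (forall t, is_derive t (1 : R) w (w1 t)) ->
  (forall t, is_derive t (1 : R) w1 (- (5/6) * t * w t - t ^+ 2 / 3 * w1 t)) ->
  exists C : R, forall t, 3 <= t -> t ^+ 5 * w t ^+ 2 <= C /\ t ^+ 7 * w1 t ^+ 2 <= C.
Proof.
move=> hw hw1.
pose E t := t ^+ 5 * (35/4 * w t ^+ 2 + (5/2 * w t + t * w1 t) ^+ 2).
have hE t : is_derive t (1 : R) E (2 * t ^+ 4 * (6 - t ^+ 3 / 3) * (5/2 * w t + t * w1 t) ^+ 2).
  by apply: is_derive_eq; rewrite /GRing.scale /=; field.
have Ele t : 3 <= t -> E t <= E 3.
  move=> t3; have [//|] := eqVneq t 3; first by move=> ->.
  move=> tn3; have lt3 : 3 < t by rewrite lt_neqAle eq_sym tn3.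
  have [|x] := @MVT _ E (fun t => 2 * t ^+ 4 * (6 - t ^+ 3 / 3) * (5/2 * w t + t * w1 t) ^+ 2) 3 t lt3 (fun x _ => hE x).
    apply: derivable_within_continuous => x _; exact: ex_derive.
  rewrite in_itv /= => /andP[x3 xt] e; rewrite -subr_le0 e.
  apply: mulr_le0_ge0; last lra.
  apply: mulr_le0_ge0; last exact: sqr_ge0.
  apply: mulr_ge0_le0; first by apply: mulr_ge0 => //; apply: exprn_ge0; lra.
  by rewrite subr_le0; nra.
exists (4 * E 3) => t t3; have := Ele t t3.
have t5 : 0 <= t ^+ 5 by apply: exprn_ge0; lra.
rewrite (_ : t ^+ 7 * _ = t ^+ 5 * (t * w1 t) ^+ 2); last by ring.
rewrite [E t]/E; set a := w t; set b := t * w1 t => h.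
have h1 := sqr_ge0 (5/2 * a + b); have h2 := sqr_ge0 a.
have k1 : 0 <= t ^+ 5 * a ^+ 2 by apply: mulr_ge0.
have k2 : 0 <= t ^+ 5 * (5/2 * a + b) ^+ 2 by apply: mulr_ge0.
(* The difference of the two sides is (5 a + b)^2. *)
have k3 : b ^+ 2 <= 2 * (5/2 * a + b) ^+ 2 + 25 / 2 * a ^+ 2.
  by have := sqr_ge0 (5 * a + b); nra.
have k4 := ler_wpM2l t5 k3.
by split; lra.
Qed.

(** Substituting G'' = t w / 6 into the derivative of w leaves w' = - G' - t^2 w / 3, from which G'
    can later be recovered; one more derivative closes the equation in w alone. *)
Lemma profile_residual (G G1 : R -> R) :
  (forall t, is_derive t (1 : R) G (G1 t)) ->
  (forall t, is_derive t (1 : R) G1 (t / 6 * (G t - 2 * t * G1 t))) ->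
  let w t := G t - 2 * t * G1 t in
  let w1 t := - G1 t - t ^+ 2 / 3 * w t in
  (forall t, is_derive t (1 : R) w (w1 t)) /\
  (forall t, is_derive t (1 : R) w1 (- (5/6) * t * w t - t ^+ 2 / 3 * w1 t)).
Proof.
move=> hG hG1 w w1.
have hw t : is_derive t (1 : R) w (w1 t).
  by rewrite /w1 /w; apply: is_derive_eq; rewrite /GRing.scale /=; field.
have ew t : G t - 2 * t * G1 t = w t by [].
have ew1 : w1 = fun t => - G1 t - t ^+ 2 / 3 * w t by [].
clearbody w w1; split=> // t.
rewrite {1}ew1; apply: is_derive_eq; rewrite /GRing.scale /= ew ew1; by field.
Qed.

End ProfileEnergy.

(** * Integrals on the half-line *)

Section IntegrationTools.
Context {R : realType}.
Notation mu := (@lebesgue_measure R).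

Import HBNNSimple.

(** The integral of a nonnegative function is a supremum over the simple functions below it, and
    each of these can be compared with [g] almost everywhere. Measurability is asked of the majorant
    only, so iterated integrals can be bounded without discussing their inner integrals as
    functions. *)
Lemma le_integral_ae d (T : measurableType d) (m : {measure set T -> \bar R})
    (D : set T) (f g : T -> \bar R) :
  measurable D -> measurable_fun D g ->
  (forall x, D x -> 0 <= f x)%E -> (forall x, D x -> 0 <= g x)%E ->
  {ae m, forall x, D x -> f x <= g x}%E ->
  (\int[m]_(x in D) f x <= \int[m]_(x in D) g x)%E.
Proof.
move=> mD mg f0 g0 fg; rewrite (ge0_integralE _ f0).
apply: ge_ereal_sup => _ [h /= hf <-].
rewrite -integralT_nnsfun [leRHS]integral_mkcond.
apply: ae_ge0_le_integral => //.
- by move=> x _; rewrite lee_fin.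
- by apply/measurable_EFinP.
- by move=> x _; apply: erestrict_ge0.
- exact/(measurable_restrictT _ _).1.
- apply: filterS fg => x fg _; apply: (le_trans (hf x)).
  rewrite !patchE; case: ifPn => // xD; apply: fg; exact: set_mem.
Qed.

Lemma ge0_integral_affine (c e : R) (f : R -> \bar R) : 0 < c ->
  measurable_fun [set: R] f -> (forall x, 0 <= f x)%E ->
  (\int[mu]_x f x = c%:E * \int[mu]_x f (c * x + e)%R)%E.
Proof.
move=> c0 mf f0.
pose phi : R -> measurableTypeR R := fun x => c * x + e.
have mphi : measurable_fun [set: R] phi.
  by apply: measurable_funD => //; apply: measurable_funM.
have cn : 0 <= c by exact: ltW.
pose nu : {measure set (measurableTypeR R) -> \bar R} := mscale (NngNum cn)
  (measure_function_pushforward__canonical__measure_function_Measure mu mphi).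
(* By uniqueness of Lebesgue measure it suffices to compare [mu] with c times its pushforward under
   x -> c x + e on half-open intervals. *)
have E A : measurable A -> mu A = nu A.
  apply: lebesgue_measure_unique => _ [[a b] _ <-].
  rewrite /nu /= /mscale /= /pushforward.
  have -> : phi @^-1` `]a, b]%classic = `](a - e) / c, (b - e) / c]%classic.
    apply/seteqP; split => x /=; rewrite !in_itv /= ltr_pdivrMr// ler_pdivlMr// /phi; lra.
  rewrite !lebesgue_measure_itv /= !lte_fin ltr_pM2r ?invr_gt0// ltrD2r.
  case: ifPn => _; last by rewrite mule0.
  by rewrite -!EFinD -EFinM; congr EFin; field; lra.
transitivity (\int[nu]_x f x)%E.
  by apply: eq_measure_integral => A mA _; exact: E.
rewrite ge0_integral_mscale//=; congr (_ * _)%E.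
by rewrite ge0_integral_pushforward.
Qed.

Lemma is_derive_powR (p x : R) : 0 < x ->
  is_derive x (1 : R) (fun x => x `^ p) (p * x `^ (p - 1)).
Proof.
move=> x0; apply: DeriveDef; first by apply: derivable_powR; rewrite in_itv /= x0.
by rewrite -derive1E powR_derive1// in_itv /= x0.
Qed.

Lemma is_derive_continuous (f : R -> R) (x df : R) :
  is_derive x (1 : R) f df -> {for x, continuous f}.
Proof. by move=> [h _]; exact/differentiable_continuous/derivable1_diffP. Qed.

Lemma is_derive_FTC2 (f F : R -> R) (a b : R) : a < b ->
  (forall x, a <= x <= b -> is_derive x (1 : R) F (f x)) ->
  (forall x, a <= x <= b -> {for x, continuous f}) ->
  (\int[mu]_(x in `[a, b]) (f x)%:E = (F b)%:E - (F a)%:E)%E.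
Proof.
move=> ab dF cf; have abI x : a < x < b -> a <= x <= b.
  by move=> /andP[/ltW -> /ltW ->].
apply: continuous_FTC2 => //.
- by apply/continuous_in_subspaceT => x; rewrite inE /= in_itv; exact: cf.
- split.
  + by move=> x; rewrite in_itv /= => /abI /dF [].
  + by apply/cvg_at_right_filter/is_derive_continuous/dF; rewrite lexx ltW.
  + by apply/cvg_at_left_filter/is_derive_continuous/dF; rewrite lexx ltW.
- by move=> x; rewrite in_itv /= => /abI /dF [_ <-]; rewrite derive1E.
Qed.

Lemma continuous_powR (p x : R) : 0 < x -> {for x, continuous (fun x => x `^ p)}.
Proof.
by move=> x0; exact: is_derive_continuous (is_derive_powR p x0).
Qed.

Lemma integral_powR_le (a L : R) : -1 < a -> 0 < L ->
  (\int[mu]_(x in `]0%R, L]) (x `^ a)%:E <= (L `^ (a + 1) / (a + 1))%:E)%E.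
Proof.
move=> a1 L0; have a0 : 0 < a + 1 by lra.
(* The divisor starts at 2 so that every compact piece is a nondegenerate interval for the
   fundamental theorem; monotone convergence then reaches the singular end. *)
pose F (n : nat) : set R := `[L / n.+2%:R, L]%classic.
have -> : `]0, L]%classic = \bigcup_n F n.
  apply/seteqP; split => x /=.
    rewrite in_itv /= => /andP[x0 xL].
    have [n hn] : exists n : nat, L / x < n%:R.
      by exists (Num.truncn (L / x)).+1; exact: truncnS_gt.
    exists n => //; rewrite /F /= in_itv /= xL andbT.
    rewrite ler_pdivrMr// mulrC -ler_pdivrMr// ltW// (lt_trans hn)// ltr_nat.
    by rewrite ltnS leqnSn.
  move=> [n _]; rewrite /F /= !in_itv /= => /andP[h ->]; rewrite andbT.
  by apply: lt_le_trans h; rewrite divr_gt0.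
have mp (D : set R) : measurable D -> measurable_fun D (fun x : R => (x `^ a)%:E).
  move=> mD; apply/measurable_EFinP; apply: measurable_funTS; exact: measurable_powR.
have h : (\int[mu]_(x in F i) (x `^ a)%:E @[i --> \oo] --> \int[mu]_(x in \bigcup_i F i) (x `^ a)%:E)%E.
  apply: ge0_nondecreasing_set_cvg_integral.
  - move=> m n mn; apply/subsetPset => x; rewrite /F /= !in_itv /= => /andP[+ ->]; rewrite andbT.
    apply: le_trans; rewrite ler_pM2l// lef_pV2 ?posrE// ler_nat.
    by rewrite !ltnS.
  - by move=> i; exact: measurable_itv.
  - by move=> i; apply: mp; exact: measurable_itv.
  - by move=> i x _; rewrite lee_fin powR_ge0.
rewrite -(cvg_lim _ h)//; apply: lime_le; first by apply/cvg_ex; eexists; exact: h.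
apply: nearW => n; rewrite /F.
have Ln : 0 < L / n.+2%:R < L.
  by rewrite divr_gt0//= ltr_pdivrMr// ltr_pMr// ltr1n.
have [Ln0 LnL] := andP Ln.
have dF (x : R) : 0 < x -> is_derive x (1 : R) (fun x => x `^ (a + 1) / (a + 1)) (x `^ a).
  move=> x0; have := is_derive_powR (a + 1) x0; rewrite addrK => dp.
  by apply: is_derive_eq; rewrite /GRing.scale /=; field; lra.
have dF' x : L / n.+2%:R <= x <= L -> is_derive x (1 : R) (fun x => x `^ (a + 1) / (a + 1)) (x `^ a).
  by move=> /andP[lx _]; apply: dF; exact: lt_le_trans lx.
have cF x : L / n.+2%:R <= x <= L -> {for x, continuous (fun x => x `^ a)}.
  by move=> /andP[lx _]; apply: continuous_powR; exact: lt_le_trans lx.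
rewrite (is_derive_FTC2 LnL dF' cF) -EFinB lee_fin gerBl.
by apply: divr_ge0; [exact: powR_ge0|exact: ltW].
Qed.

End IntegrationTools.

(** * The Gamma integral *)

Section GammaIntegral.
Context {R : realType}.
Notation mu := (@lebesgue_measure R).

Lemma cvgr_expRM (k : R) : 0 < k -> expR (- (k * x)) @[x --> +oo] --> (0 : R).
Proof.
move=> k0; apply: (@cvg_comp _ _ _ (fun x : R => k * x) (fun x => expR (- x)) _ +oo).
  by apply: gt0_cvgMry => //; exact: cvg_id.
exact: cvgr_expR.
Qed.

Lemma integrable_Gamma (a : R) : -1 < a <= 1 ->
  mu.-integrable `]0, +oo[ (EFin \o (fun v => v `^ a * expR (- v))).
Proof.
move=> /andP[a1 a2].
have mg (D : set R) : measurable D -> measurable_fun D (fun v : R => v `^ a * expR (- v)).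
  move=> mD; apply: measurable_funTS; apply: measurable_funM; first exact: measurable_powR.
  by apply: measurableT_comp => //; exact: measurable_funN.
apply/integrableP; split; first by apply/measurable_EFinP; apply: mg.
under eq_integral => x _ do rewrite /= ger0_norm ?mulr_ge0 ?powR_ge0 ?expR_ge0//.
have -> : `]0, +oo[%classic = `]0, 1]%classic `|` `]1, +oo[%classic :> set R.
  apply/seteqP; split => x /=; rewrite !in_itv /= ?andbT.
    by move=> x0; case: (leP x 1) => h; [left|right]; rewrite ?x0.
  by case => [/andP[]//|]; apply: lt_trans.
rewrite ge0_integral_setU//=; last 3 first.
- by apply/measurable_EFinP; apply: mg; apply: measurableU.
- by move=> x _; rewrite lee_fin mulr_ge0 ?powR_ge0 ?expR_ge0.
- by apply/disj_setPS => x /= []; rewrite !in_itv /= andbT => /andP[_ h1] h2; move: (lt_le_trans h2 h1); rewrite ltxx.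
apply: lte_add_pinfty.
  apply: (le_lt_trans _ (ltry (1 `^ (a + 1) / (a + 1)))).
  apply: le_trans (integral_powR_le a1 ltr01).
  apply: ge0_le_integral => //.
  - by move=> x _; rewrite lee_fin mulr_ge0 ?powR_ge0 ?expR_ge0.
  - by apply/measurable_EFinP; apply: mg.
  - by apply/measurable_EFinP; apply: measurable_funTS; exact: measurable_powR.
  - move=> x /=; rewrite in_itv /= => /andP[x0 _]; rewrite lee_fin ler_piMr ?powR_ge0//.
    by rewrite expR_le1 oppr_le0 ltW.
(* For x >= 1, x^a <= x since a <= 1, and x e^(-x) <= 2 e^(-x/2) since e^(x/2) >= 1 + x/2. *)
pose h (x : R) := 2 * expR (- (1/2 * x)).
apply: (@le_lt_trans _ _ (\int[mu]_(x in `]1%R, +oo[) (h x)%:E)%E).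
  apply: ge0_le_integral => //.
  - by move=> x _; rewrite lee_fin mulr_ge0 ?powR_ge0 ?expR_ge0.
  - by apply/measurable_EFinP; apply: mg.
  - apply/measurable_EFinP; apply: measurable_funTS; apply: measurable_funM => //.
    by apply: measurableT_comp => //; apply: measurable_funN; apply: measurable_funM.
  - move=> x /=; rewrite in_itv /= andbT => x1; rewrite lee_fin /h.
    have x1' : 1 <= x by exact: ltW.
    apply: (@le_trans _ _ (x * expR (- x))).
      rewrite ler_wpM2r ?expR_ge0// -[leRHS]powRr1; last lra.
      by apply: ler_powR.
    have -> : - x = - (1/2 * x) + - (1/2 * x) by lra.
    rewrite expRD mulrA ler_wpM2r ?expR_ge0//.
    rewrite expRN ler_pdivrMr ?expR_gt0//; have := expR_ge1Dx (1/2 * x); lra.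
have dF x : is_derive x (1 : R) (fun x => - 4 * expR (- (1/2 * x))) (h x).
  by rewrite /h; apply: is_derive_eq; rewrite /GRing.scale /=; field.
have ch : continuous h.
  move=> x; apply: (@is_derive_continuous _ _ _ (- expR (- (1/2 * x)))).
  by rewrite /h; apply: is_derive_eq; rewrite /GRing.scale /=; field.
rewrite integral_itv_obnd_cbnd; last first.
  by apply/measurable_EFinP; apply: measurable_funTS; exact: continuous_measurable_fun.
rewrite (@ge0_continuous_FTC2y _ h (fun x => - 4 * expR (- (1/2 * x))) 1 0).
- by rewrite -EFinB ltry.
- by move=> x _; rewrite mulr_ge0 ?expR_ge0.
- exact: continuous_subspaceT.
- rewrite -[X in _ --> X](mulr0 (- 4)); apply: cvgMr; apply: cvgr_expRM; lra.
- by move=> x _; case: (dF x).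
- by apply: cvg_at_right_filter; exact: is_derive_continuous (dF 1).
- by move=> x _; rewrite derive1E; case: (dF x).
Qed.

(** The fundamental theorem on [1/(n+2), n+2] turns the truncated integrals into boundary terms, and
    |f| dominates the truncations. Both integrations by parts on the half-line, in [gam_rec] and
    [Kb_ode], take this form. *)
Lemma integral_derive_eq0 (F f : R -> R) :
  (forall x : R, 0 < x -> is_derive x (1 : R) F (f x)) ->
  (forall x : R, 0 < x -> {for x, continuous f}) ->
  mu.-integrable `]0, +oo[ (EFin \o f) ->
  F n.+2%:R @[n --> \oo] --> 0 -> F n.+2%:R^-1 @[n --> \oo] --> 0 ->
  \int[mu]_(x in `]0, +oo[) f x = 0.
Proof.
move=> dF cf fi F1 F0.
pose A (n : nat) : set R := `[n.+2%:R^-1, n.+2%:R]%classic.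
have mf : measurable_fun (`]0, +oo[ : set R) (EFin \o f) by case/integrableP: fi.
have mA n : measurable (A n) by exact: measurable_itv.
have n0 (n : nat) : 0 < n.+2%:R^-1 :> R by rewrite invr_gt0.
have A0 n : A n `<=` `]0, +oo[.
  move=> x; rewrite /A /= !in_itv /= andbT => /andP[h _]; exact: lt_le_trans h.
have h : (\int[mu]_(x in `]0%R, +oo[) ((EFin \o f) \_ (A n)) x)%E @[n --> \oo] --> (\int[mu]_(x in `]0%R, +oo[) (EFin \o f) x)%E.
  apply: (@dominated_cvg _ _ _ mu _ _ _ _ (fun x => `|(EFin \o f) x|%E)) => //.
  - move=> n; apply/measurable_restrict => //; first exact: mA.
    by apply: measurable_funS mf => //; apply: subIsetl.
  - move=> x; rewrite /= in_itv /= andbT => x0.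
    apply: cvg_near_cst.
    exists (Num.truncn x + Num.truncn x^-1)%N => // n /= hn.
    rewrite patchE mem_set// /A /= in_itv /=; apply/andP; split.
      rewrite invf_ple ?posrE//; apply: (le_trans (ltW (truncnS_gt _))).
      by rewrite ler_nat !ltnS (leq_trans (leq_addl _ _) (leq_trans hn _)).
    apply: (le_trans (ltW (truncnS_gt _))).
    by rewrite ler_nat !ltnS (leq_trans (leq_addr _ _) (leq_trans hn _)).
  - exact: integrable_abse.
  - move=> n x _; rewrite patchE; case: ifPn => // _; rewrite abse0; exact: abse_ge0.
have e n : (\int[mu]_(x in `]0%R, +oo[) ((EFin \o f) \_ (A n)) x)%E = (F n.+2%:R - F n.+2%:R^-1)%:E.
  rewrite -integral_mkcondr setIidr//.
  have lt : n.+2%:R^-1 < n.+2%:R :> R.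
    by apply: (@lt_trans _ _ 1); rewrite ?invf_lt1 ?ltr1n.
  by rewrite EFinB; apply: (is_derive_FTC2 lt) => x /andP[hx _]; [apply: dF|apply: cf]; exact: lt_le_trans hx.
have : (F n.+2%:R - F n.+2%:R^-1)%:E @[n --> \oo] --> (0 - 0 : R)%:E.
  by apply/cvg_EFin; [exact: nearW|exact: cvgB].
under eq_fun do rewrite -e.
move=> /(cvg_unique (@ereal_hausdorff R) h) /=; rewrite /Rintegral => ->.
by rewrite subr0.
Qed.

Lemma integrable_scale (D : set (measurableTypeR R)) (k : R) (f : R -> R) : measurable D ->
  mu.-integrable D (EFin \o f) -> mu.-integrable D (EFin \o (fun v => k * f v)).
Proof. by move=> mD fi; have := integrableZl mD k fi; rewrite /comp; exact: eq_integrable. Qed.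

Lemma integrable_sub (D : set (measurableTypeR R)) (f g : R -> R) : measurable D ->
  mu.-integrable D (EFin \o f) -> mu.-integrable D (EFin \o g) ->
  mu.-integrable D (EFin \o (fun v => f v - g v)).
Proof. by move=> mD fi gi; have := integrableB mD fi gi; rewrite /comp; exact: eq_integrable. Qed.

(* This is Gamma (a + 1). *)
Definition gam (a : R) : R := \int[mu]_(v in `]0, +oo[) (v `^ a * expR (- v)).

Lemma GammaIntE (x : R) : GammaInt x = gam (x - 1).
Proof. by []. Qed.

(** The constant is 3!, from e^v >= v^3 / 3!. *)
Lemma powR_expRN_le (a v : R) : a <= 2 -> 1 <= v -> v `^ a * expR (- v) <= 6 / v.
Proof.
move=> a2 v1; have v0 : 0 < v by lra.
apply: (@le_trans _ _ (v ^+ 2 * expR (- v))).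
  rewrite ler_wpM2r ?expR_ge0// -powR_mulrn; last lra.
  exact: ler_powR.
rewrite expRN ler_pdivrMr ?expR_gt0// mulrAC ler_pdivlMr//.
have := @expR_ge1Dxn R v 2 (ltW v0); rewrite (_ : 3`!%:R = 6)//.
by nra.
Qed.

Lemma cvg_powR_expRN_pinfty (a : R) : a <= 2 ->
  n.+2%:R `^ a * expR (- n.+2%:R) @[n --> \oo] --> (0 : R).
Proof.
move=> a2.
have h : 6 * (@harmonic R) n.+1 @[n --> \oo] --> (0 : R).
  rewrite -(mulr0 6); apply: cvgMr; rewrite (cvg_shiftS (@harmonic R)); exact: cvg_harmonic.
apply: (@squeeze_cvgr _ _ _ _ (cst 0) (fun n => 6 * (@harmonic R) n.+1)) => //; last exact: cvg_cst.
apply: nearW => n; rewrite /= mulr_ge0 ?powR_ge0 ?expR_ge0//=.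
by apply: powR_expRN_le => //; rewrite ler1n.
Qed.

Lemma cvg_inv_nat_at_right : (n.+2%:R^-1 : R) @[n --> \oo] --> 0^'+.
Proof.
have h : (@harmonic R) n.+1 @[n --> \oo] --> (0 : R).
  by rewrite (cvg_shiftS (@harmonic R)); exact: cvg_harmonic.
move=> P [e /= e0 hP]; move/cvgrPdist_lt : h => /(_ e e0).
by apply: filterS => n hn; apply: hP => //=; rewrite invr_gt0.
Qed.

Lemma cvg_powR_inv_nat (a : R) : 0 < a -> n.+2%:R^-1 `^ a @[n --> \oo] --> (0 : R).
Proof.
move=> a0; apply: (@cvg_comp _ _ _ (fun n : nat => n.+2%:R^-1 : R) (fun x : R => x `^ a)); first exact: cvg_inv_nat_at_right.
exact: powR_cvg0.
Qed.

(** The function v^a e^(-v) vanishes at both ends of the half-line, so its derivative has integral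
    0. *)
Lemma gam_rec (a : R) : 0 < a <= 1 -> gam a = a * gam (a - 1).
Proof.
move=> /andP[a0 a1]; rewrite /gam -RintegralZl//; last by apply: integrable_Gamma; lra.
have i1 : mu.-integrable `]0, +oo[ (EFin \o (fun v => a * (v `^ (a - 1) * expR (- v)))).
  by apply: integrable_scale => //; apply: integrable_Gamma; lra.
have i2 : mu.-integrable `]0, +oo[ (EFin \o (fun v => v `^ a * expR (- v))).
  by apply: integrable_Gamma; lra.
apply/eqP; rewrite eq_sym -subr_eq0 -RintegralB//; apply/eqP.
have dE (x : R) : is_derive x (1 : R) (fun v => expR (- v)) (- expR (- x)).
  by apply: is_derive_eq; rewrite /GRing.scale /=; ring.
apply: (@integral_derive_eq0 (fun v => v `^ a * expR (- v))).
- move=> x x0; have dp := is_derive_powR a x0.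
  by apply: is_derive_eq; rewrite /GRing.scale /=; ring.
- move=> x x0; apply: continuousB; last first.
    by apply: continuousM; [exact: continuous_powR|exact: is_derive_continuous (dE x)].
  apply: continuousM; first exact: cst_continuous.
  by apply: continuousM; [exact: continuous_powR|exact: is_derive_continuous (dE x)].
- exact: integrable_sub.
- apply: cvg_powR_expRN_pinfty; lra.
- apply: (@squeeze_cvgr _ _ _ _ (cst 0) (fun n => n.+2%:R^-1 `^ a)); first apply: nearW => n.
  + by rewrite mulr_ge0 ?powR_ge0 ?expR_ge0//= ler_piMr ?powR_ge0// expR_le1 oppr_le0.
  + exact: cvg_cst.
  + exact: cvg_powR_inv_nat.
Qed.

End GammaIntegral.

(** * Scaling on the half-line and the Beta integral *)

Section BetaIntegral.
Context {R : realType}.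
Notation mu := (@lebesgue_measure R).
Local Notation I := (`]0%R, +oo[%classic : set R).

Lemma measurable_fun_powR d (T : measurableType d) (D : set T) (f : T -> R) (p : R) :
  measurable_fun D f -> measurable_fun D (fun x => f x `^ p).
Proof. by move=> mf; exact: (measurableT_comp (measurable_powR p) mf). Qed.

Lemma measurable_fun_expR d (T : measurableType d) (D : set T) (f : T -> R) :
  measurable_fun D f -> measurable_fun D (fun x => expR (f x)).
Proof. by move=> mf; exact: (measurableT_comp (@measurable_expR R) mf). Qed.

Lemma ge0_integral_scale (c : R) (g : R -> R) : 0 < c ->
  measurable_fun [set: R] g -> (forall x, 0 < x -> 0 <= g x) ->
  (\int[mu]_(x in I) (g x)%:E = c%:E * \int[mu]_(x in I) (g (c * x)%R)%:E)%E.
Proof.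
move=> c0 mg g0; rewrite integral_mkcond [in RHS]integral_mkcond.
rewrite (@ge0_integral_affine _ c 0)//.
- congr (_ * _)%E; apply: eq_integral => x _; rewrite addr0 !patchE.
  congr (if _ then _ else _); apply/idP/idP => /set_mem /=; rewrite in_itv /= andbT => h;
  by apply/mem_set; rewrite /= in_itv /= andbT; move: h; rewrite pmulr_rgt0.
- by apply/(measurable_restrictT _ _).1 => //; apply/measurable_EFinP; exact: measurable_funTS.
- move=> x; apply: erestrict_ge0 => y /=; rewrite in_itv /= andbT lee_fin; exact: g0.
Qed.

Lemma integral_powR_expR_scale (a c : R) : 0 < c ->
  (\int[mu]_(s in I) (s `^ a * expR (- (c * s)))%:E =
   (c `^ (- (a + 1)))%:E * \int[mu]_(s in I) (s `^ a * expR (- s))%:E)%E.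
Proof.
move=> c0; rewrite (@ge0_integral_scale c (fun s => s `^ a * expR (- s))) //; last 2 first.
- apply: measurable_funM; first exact: measurable_powR.
  by apply: measurable_fun_expR; exact: measurable_funN.
- by move=> x _; rewrite mulr_ge0 ?powR_ge0 ?expR_ge0.
rewrite muleA -EFinM -[X in (_ * X)%:E](powRr1 (ltW c0)) -powRD; last by rewrite (gt_eqF c0) implybT.
rewrite -ge0_integralZl//=; last 3 first.
- apply/measurable_EFinP; apply: measurable_funTS; apply: measurable_funM.
    by apply: measurable_fun_powR; exact: measurable_funM.
  by apply: measurable_fun_expR; apply: measurable_funN; exact: measurable_funM.
- by move=> x _; rewrite lee_fin mulr_ge0 ?powR_ge0 ?expR_ge0.
- by rewrite lee_fin powR_ge0.
apply: eq_integral => x; rewrite inE /= in_itv /= andbT => x0.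
rewrite -EFinM; congr EFin; rewrite powRM ?ltW// !mulrA -powRD; last by rewrite (gt_eqF c0) implybT.
by rewrite (_ : - (a + 1) + 1 + a = 0) ?powRr0 ?mul1r//; ring.
Qed.

Lemma gamE (a : R) : -1 < a <= 1 ->
  (\int[mu]_(s in I) (s `^ a * expR (- s))%:E = (gam a)%:E)%E.
Proof.
move=> ha; rewrite /gam /Rintegral fineK//.
by apply: integrable_fin_num => //; exact: integrable_Gamma.
Qed.

Lemma gam_gt0 (a : R) : -1 < a <= 1 -> 0 < gam a.
Proof.
move=> ha; rewrite -lte_fin -gamE//.
have h : (\int[mu]_(x in `[1%R, 2%R]) (1/2 * expR (- 2))%:E <= \int[mu]_(s in I) (s `^ a * expR (- s))%:E)%E.
  apply: (@le_trans _ _ (\int[mu]_(s in `[1%R, 2%R]) (s `^ a * expR (- s))%:E)%E).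
    apply: ge0_le_integral => //.
    - apply/measurable_EFinP; apply: measurable_funTS; apply: measurable_funM; first exact: measurable_powR.
      by apply: measurable_fun_expR; exact: measurable_funN.
    - move=> s /=; rewrite in_itv /= => /andP[s1 s2]; rewrite lee_fin ler_pM ?expR_ge0//; last by rewrite ler_expR; lra.
      apply: (@le_trans _ _ (s `^ (-1))); last by apply: ler_powR; lra.
      rewrite powR_inv1; last lra.
      by rewrite div1r lef_pV2 ?posrE; lra.
  apply: ge0_subset_integral => //=.
  - apply/measurable_EFinP; apply: measurable_funTS; apply: measurable_funM; first exact: measurable_powR.
    by apply: measurable_fun_expR; exact: measurable_funN.
  - by move=> s _; rewrite lee_fin mulr_ge0 ?powR_ge0 ?expR_ge0.
  - by move=> s /=; rewrite !in_itv /= andbT => /andP[s1 _]; exact: lt_le_trans s1.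
apply: lt_le_trans h; rewrite integral_cst//= lebesgue_measure_itv/= lte_fin ltr1n /=.
by rewrite -EFinB -EFinM lte_fin !mulr_gt0 ?expR_gt0//; lra.
Qed.

(** Euler's B(x, y) = Gamma(x) Gamma(y) / Gamma(x + y), on the half-line: the double integral of
    s^(x+y-1) q^(y-1) e^(-s(1+q)) is evaluated in both orders. The upper bounds on x and x + y keep
    all arguments where [gamE] holds. *)
Lemma beta_gam (x y : R) : 0 < x <= 1 -> 0 < y -> x + y <= 2 ->
  ((gam (x + y - 1))%:E * \int[mu]_(q in I) (q `^ (y - 1) * (1 + q) `^ (- (x + y)))%:E
   = (gam (x - 1) * gam (y - 1))%:E)%E.
Proof.
move=> hx y0 xy; have mI : measurable (I : set (measurableTypeR R)) by exact: measurable_itv.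
(* The indicator carries the restriction to the half-line, because Tonelli's theorem is applied on
   the whole plane. *)
pose pw a (s : R) := (s `^ a * (\1_I s)%R) : R.
have mpw a : measurable_fun [set: measurableTypeR R] (pw a).
  by apply: measurable_funM; [exact: measurable_powR|exact: measurable_indic].
have pw0 a s : 0 <= pw a s by rewrite mulr_ge0 ?powR_ge0.
pose f (p : measurableTypeR R * measurableTypeR R) : \bar R := (pw (x + y - 1) p.1 * pw (y - 1) p.2 * expR (- (p.1 * (1 + p.2))))%:E.
have f0 p : (0 <= f p)%E by rewrite lee_fin; apply: mulr_ge0; [exact: mulr_ge0|exact: expR_ge0].
have mf : measurable_fun setT f.
  apply/measurable_EFinP; apply: measurable_funM; first apply: measurable_funM.
  - exact: (measurableT_comp (mpw _) measurable_fst).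
  - exact: (measurableT_comp (mpw _) measurable_snd).
  - apply: measurable_fun_expR; apply: measurable_funN; apply: measurable_funM => //.
    by apply: measurable_funD.
have pwE a (g : R -> R) : (\int[mu]_s (pw a s * g s)%:E = \int[mu]_(s in I) (s `^ a * g s)%:E)%E.
  rewrite [RHS]integral_mkcond; apply: eq_integral => s _; rewrite /pw patchE indicE.
  by case: (s \in I); rewrite ?mulr1// mulr0 mul0r.
have := @fubini_tonelli _ _ _ _ R mu mu f mf f0.
have -> : (\int[mu]_s \int[mu]_q f (s, q) = (gam (x - 1) * gam (y - 1))%:E)%E.
  rewrite EFinM.
  transitivity (\int[mu]_s ((pw (x - 1) s * expR (- s))%:E * (gam (y - 1))%:E))%E.
    apply: eq_integral => s _.
    have [s0|s0] := ltP 0 s; last first.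
      rewrite /pw indicE memNset ?mulr0 ?mul0r ?mul0e; last by rewrite /= in_itv /= andbT; apply/negP; rewrite -leNgt.
      by rewrite integral0_eq// => q _; rewrite /f /pw /= indicE memNset ?mulr0 ?mul0r// /= in_itv /= andbT; apply/negP; rewrite -leNgt.
    transitivity (\int[mu]_q ((pw (x + y - 1) s * expR (- s))%:E * (pw (y - 1) q * expR (- (s * q)))%:E))%E.
      apply: eq_integral => q _; rewrite /f /= -EFinM; congr EFin.
      by rewrite (_ : - (s * (1 + q)) = - s + - (s * q)) ?expRD; ring.
    rewrite ge0_integralZl//=; last 3 first.
    - apply/measurable_EFinP; apply: measurable_funM => //.
      by apply: measurable_fun_expR; apply: measurable_funN; apply: measurable_funM.
    - by move=> q _; rewrite lee_fin; apply: mulr_ge0 => //; exact: expR_ge0.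
    - by rewrite lee_fin; apply: mulr_ge0 => //; exact: expR_ge0.
    rewrite pwE integral_powR_expR_scale// gamE; last lra.
    rewrite muleA -!EFinM; congr (_ * _)%:E.
    rewrite /pw indicE mem_set ?mulr1; last by rewrite /= in_itv /= s0.
    rewrite mulrAC -powRD; last by rewrite (gt_eqF s0) implybT.
    by congr (_ `^ _ * _); ring.
  rewrite ge0_integralZr//=; last 3 first.
  - apply/measurable_EFinP; apply: measurable_funM => //.
    by apply: measurable_fun_expR; apply: measurable_funN.
  - by move=> s _; rewrite lee_fin; apply: mulr_ge0 => //; exact: expR_ge0.
  - by rewrite lee_fin ltW// gam_gt0//; lra.
  by rewrite pwE gamE; last lra.
move=> ->; rewrite -ge0_integralZl//=; last 3 first.
- apply/measurable_EFinP; apply: measurable_funTS; apply: measurable_funM; apply: measurable_fun_powR => //.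
  by apply: measurable_funD.
- by move=> q _; rewrite lee_fin mulr_ge0 ?powR_ge0.
- by rewrite lee_fin ltW// gam_gt0//; lra.
rewrite [LHS]integral_mkcond; apply: eq_integral => q _.
rewrite patchE; case: ifPn => [/set_mem /=|]; last first.
  move=> qI; rewrite integral0_eq// => s _; rewrite /f /pw /= [X in _ * (_ * X) * _]indicE (negbTE qI).
  by rewrite !mulr0 mul0r.
rewrite in_itv /= andbT => q0.
transitivity (\int[mu]_s ((q `^ (y - 1))%:E * (pw (x + y - 1) s * expR (- ((1 + q) * s)))%:E))%E; last first.
  apply: eq_integral => s _; rewrite /f /= -EFinM {3}/pw indicE mem_set ?mulr1; last by rewrite /= in_itv /= q0.
  by congr EFin; rewrite (mulrC s); ring.
rewrite ge0_integralZl//=; last 3 first.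
- apply/measurable_EFinP; apply: measurable_funM => //.
  by apply: measurable_fun_expR; apply: measurable_funN; apply: measurable_funM.
- by move=> s _; rewrite lee_fin; apply: mulr_ge0 => //; exact: expR_ge0.
- by rewrite lee_fin powR_ge0.
rewrite pwE integral_powR_expR_scale ?gamE; [|lra|lra].
rewrite -!EFinM; congr EFin; rewrite subrK; ring.
Qed.

End BetaIntegral.

(** * The recessive solution at minus infinity *)

Section RecessiveSolution.
Context {R : realType}.
Notation mu := (@lebesgue_measure R).
Local Notation I := (`]0%R, +oo[%classic : set R).

Lemma ler_powRN (x y b : R) : 0 < x -> x <= y -> 0 <= b -> y `^ (- b) <= x `^ (- b).
Proof.
move=> x0 xy b0; have y0 : 0 < y by lra.
rewrite !powRN lef_pV2 ?posrE ?powR_gt0//; apply: ge0_ler_powR => //; rewrite nnegrE; lra.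
Qed.

(** The integral for b = 5/6 is Gamma(7/6) times Tricomi's U(5/6, 2/3, z). The exponent [b] is kept
    free because each derivative in z raises it by 1. *)
Definition Kint (b z : R) (v : R) : R := v `^ (1/6) * (v + z) `^ (- b) * expR (- v).

Definition Kb (b z : R) : R := \int[mu]_(v in I) Kint b z v.

Lemma measurable_Kint b z (D : set (measurableTypeR R)) : measurable_fun D (Kint b z).
Proof.
apply: measurable_funTS; apply: measurable_funM; last by apply: measurable_fun_expR; exact: measurable_funN.
apply: measurable_funM; apply: measurable_fun_powR => //.
by apply: measurable_funD.
Qed.

Lemma Kint_ge0 b z v : 0 <= Kint b z v.
Proof. by rewrite /Kint !mulr_ge0 ?powR_ge0 ?expR_ge0. Qed.

Lemma Kint_le (b z v : R) : 0 < z -> 0 <= b -> 0 < v ->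
  Kint b z v <= z `^ (- b) * (v `^ (1/6) * expR (- v)).
Proof.
move=> z0 b0 v0; rewrite /Kint mulrA ler_wpM2r ?expR_ge0// mulrC ler_wpM2r ?powR_ge0//.
by apply: ler_powRN => //; lra.
Qed.

Lemma integrable_Kint (b z : R) : 0 < z -> 0 <= b -> mu.-integrable I (EFin \o Kint b z).
Proof.
move=> z0 b0.
apply: (@le_integrable _ _ _ mu I _ _ (EFin \o (fun v => z `^ (- b) * (v `^ (1/6) * expR (- v))))).
- exact: measurable_itv.
- by apply/measurable_EFinP; exact: measurable_Kint.
- move=> v /=; rewrite in_itv /= andbT => v0; rewrite lee_fin !ger0_norm ?Kint_ge0 ?Kint_le//.
  by rewrite !mulr_ge0 ?powR_ge0 ?expR_ge0.
- by apply: integrable_scale => //; apply: integrable_Gamma; lra.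
Qed.

Lemma Kb_ge0 b z : 0 <= Kb b z.
Proof. by apply: Rintegral_ge0 => v _; exact: Kint_ge0. Qed.

(** This is the algebraic decay of the recessive solution: z = t^3/9 and b = 5/6 give the order
    t^(-5/2). *)
Lemma Kb_le (b z : R) : 0 < z -> 0 <= b -> Kb b z <= z `^ (- b) * gam (1/6).
Proof.
move=> z0 b0; rewrite /gam -RintegralZl//; last by apply: integrable_Gamma; lra.
apply: le_Rintegral => //; first exact: integrable_Kint.
- by apply: integrable_scale => //; apply: integrable_Gamma; lra.
- by move=> v /=; rewrite in_itv /= andbT => v0; exact: Kint_le.
Qed.

Lemma is_derive_Kint (b z v : R) : 0 < z -> 0 < v ->
  is_derive z (1 : R) (Kint b ^~ v) (- b * Kint (b + 1) z v).
Proof.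
move=> z0 v0; have vz : 0 < v + z by lra.
have dp := is_derive_powR (- b) vz.
have ds : is_derive z (1 : R) (fun z : R => v + z) 1.
  have -> : (fun z : R => v + z) = shift v by apply/funext => x /=; rewrite addrC.
  exact: is_derive_shift.
have := @is_derive1_comp _ (fun x => x `^ (- b)) (fun z => v + z) z _ _ dp ds; rewrite /comp => dc.
rewrite /Kint; apply: is_derive_eq; rewrite /GRing.scale /= (_ : - b - 1 = - (b + 1)); [ring|by ring].
Qed.

Lemma is_derive_Kb (b z : R) : 0 < z -> 0 <= b ->
  is_derive z (1 : R) (Kb b) (- b * Kb (b + 1) z).
Proof.
move=> z0 b0.
(* Majorant of the z-derivative on ]z/2, 2z[, from [Kint_le] and the monotonicity of negative
   powers. *)
pose G (v : R) := b * ((z / 2) `^ (- (b + 1)) * (v `^ (1/6) * expR (- v))).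
have G0 v : 0 <= G v.
  by rewrite /G !mulr_ge0 ?powR_ge0 ?expR_ge0.
have Iz : `](z / 2), (2 * z)[%classic z by rewrite /= in_itv /=; apply/andP; split; lra.
have hx x : `](z / 2), (2 * z)[%classic x -> z / 2 < x by rewrite /= in_itv /= => /andP[].
have intf x : `](z / 2), (2 * z)[%classic x -> mu.-integrable I (EFin \o Kint b x).
  by move=> /hx h; apply: integrable_Kint => //; lra.
have dK x y : `](z / 2), (2 * z)[%classic x -> I y -> is_derive x (1 : R) (Kint b ^~ y) (- b * Kint (b + 1) x y).
  by move=> /hx h /=; rewrite in_itv /= andbT => y0; apply: is_derive_Kint => //; lra.
have derf x y : `](z / 2), (2 * z)[%classic x -> I y -> derivable (Kint b ^~ y) x 1.
  by move=> h1 h2; case: (dK x y h1 h2).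
have intG : mu.-integrable I (EFin \o G).
  apply: integrable_scale; first exact: measurable_itv.
  by apply: integrable_scale => //; apply: integrable_Gamma; lra.
have Gub x y : `](z / 2), (2 * z)[%classic x -> I y -> `|partial1of2 (Kint b) x y| <= G y.
  move=> h1 h2; rewrite partial1of2E; have [_ ->] := dK x y h1 h2.
  rewrite normrM normrN !ger0_norm ?Kint_ge0//.
  move: h2; rewrite /= in_itv /= andbT => y0; rewrite /G ler_wpM2l//.
  apply: (le_trans (Kint_le _ _ _)) => //; [have := hx x h1; lra|lra|].
  rewrite ler_wpM2r ?mulr_ge0 ?powR_ge0 ?expR_ge0//.
  by apply: ler_powRN; have := hx x h1; lra.
have mI : measurable (I : set (measurableTypeR R)) by exact: measurable_itv.
apply: DeriveDef.
  exact: (derivable_under_integral mI Iz intf derf G0 intG Gub).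
rewrite -derive1E (differentiation_under_integral mI Iz intf derf G0 intG Gub).
rewrite /Kb -RintegralZl//; last by apply: integrable_Kint; lra.
by apply: eq_Rintegral => v /set_mem h; rewrite partial1of2E; have [_ ->] := dK z v Iz h.
Qed.

(* Integrate d/dv [v^(7/6) (v + z)^(-11/6) e^(-v)] over the half-line. *)
Lemma Kb_ode (z : R) : 0 < z ->
  11/6 * z * Kb (17/6) z + (z - 2/3) * Kb (11/6) z - Kb (5/6) z = 0.
Proof.
move=> z0; have i b : 0 <= b -> mu.-integrable I (EFin \o Kint b z) by move=> ?; exact: integrable_Kint.
have [i1 i2 i3] : [/\ mu.-integrable I (EFin \o Kint (17/6) z), mu.-integrable I (EFin \o Kint (11/6) z) & mu.-integrable I (EFin \o Kint (5/6) z)].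
  by split; apply: i; lra.
(* This is the derivative of v^(7/6) (v + z)^(-11/6) e^(-v), once v^(7/6) is written as v^(1/6) ((v
   + z) - z). *)
pose f v := 11/6 * z * Kint (17/6) z v - (2/3 - z) * Kint (11/6) z v - Kint (5/6) z v.
have fi : mu.-integrable I (EFin \o f).
  apply: integrable_sub => //; apply: integrable_sub => //; exact: integrable_scale.
transitivity (\int[mu]_(v in I) f v).
  rewrite /f RintegralB//; last by apply: integrable_sub => //; exact: integrable_scale.
  rewrite RintegralB//; [|exact: integrable_scale|exact: integrable_scale].
  rewrite (RintegralZl _ _ i1)// (RintegralZl _ _ i2)// -/(Kb (17/6) z) -/(Kb (11/6) z) -/(Kb (5/6) z).
  by move: (Kb (17/6) z) (Kb (11/6) z) (Kb (5/6) z) => A B C; ring.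
have dE (x : R) : is_derive x (1 : R) (fun v => expR (- v)) (- expR (- x)).
  by apply: is_derive_eq; rewrite /GRing.scale /=; ring.
have dK p b (x : R) : 0 < x -> is_derive x (1 : R) (fun v => v `^ p * (v + z) `^ (- b) * expR (- v))
    (p * x `^ (p - 1) * (x + z) `^ (- b) * expR (- x) - b * x `^ p * (x + z) `^ (- (b + 1)) * expR (- x)
     - x `^ p * (x + z) `^ (- b) * expR (- x)).
  move=> x0; have xz : 0 < x + z by lra.
  have dp := is_derive_powR p x0.
  have dq := is_derive_powR (- b) xz.
  have ds : is_derive x (1 : R) (fun x : R => x + z) 1 by exact: is_derive_shift.
  have := @is_derive1_comp _ (fun x => x `^ (- b)) (fun x => x + z) x _ _ dq ds; rewrite /comp => dc.
  apply: is_derive_eq; rewrite /GRing.scale /= (_ : - b - 1 = - (b + 1)); [ring|by ring].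
apply: (@integral_derive_eq0 _ (fun v => v `^ (7/6) * (v + z) `^ (- (11/6)) * expR (- v))) => //.
- move=> x x0; have := dK (7/6) (11/6) x x0.
  have xz : 0 < x + z by lra.
  have nz : (x == 0) = false by apply/negbTE; lra.
  have nz2 : (x + z == 0) = false by apply/negbTE; lra.
  rewrite (_ : 7/6 - 1 = 1/6); last by field.
  have -> : x `^ (7/6) = x `^ (1/6) * x.
    rewrite -[X in _ = _ * X](@powRr1 _ x) -?powRD ?nz ?implybT//; last lra.
    by congr (_ `^ _); field.
  rewrite (_ : 11/6 + 1 = 17/6); last by field.
  have e1 : (x + z) `^ (- (11/6)) = (x + z) `^ (- (17/6)) * (x + z).
    rewrite -[X in _ = _ * X](@powRr1 _ (x + z)) -?powRD ?nz2 ?implybT//; last lra.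
    by congr (_ `^ _); field.
  have e2 : (x + z) `^ (- (5/6)) = (x + z) `^ (- (17/6)) * (x + z) * (x + z).
    rewrite -e1 -[X in _ = _ * X](@powRr1 _ (x + z)) -?powRD ?nz2 ?implybT//; last lra.
    by congr (_ `^ _); field.
  move=> h; apply: (is_derive_eq h); rewrite /f /Kint e2 e1; by field.
- move=> x x0; apply: continuousB; first apply: continuousB.
  + by apply: continuousM; [exact: cst_continuous|exact: is_derive_continuous (dK (1/6) (17/6) x x0)].
  + by apply: continuousM; [exact: cst_continuous|exact: is_derive_continuous (dK (1/6) (11/6) x x0)].
  + exact: is_derive_continuous (dK (1/6) (5/6) x x0).
- have h : z `^ (- (11/6)) * (n.+2%:R `^ (7/6) * expR (- n.+2%:R)) @[n --> \oo] --> (0 : R).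
    by rewrite -(mulr0 (z `^ (- (11/6)))); apply: cvgMr; apply: cvg_powR_expRN_pinfty; lra.
  apply: (@squeeze_cvgr _ _ _ _ (cst 0) _ _ _ _ _ h); last exact: cvg_cst.
  apply: nearW => n; rewrite /= !mulr_ge0 ?powR_ge0 ?expR_ge0//= mulrA ler_wpM2r ?expR_ge0//.
  rewrite mulrC ler_wpM2r ?powR_ge0//; apply: ler_powRN => //.
  by rewrite lerDr.
- have h : z `^ (- (11/6)) * (n.+2%:R^-1 `^ (7/6)) @[n --> \oo] --> (0 : R).
    by rewrite -(mulr0 (z `^ (- (11/6)))); apply: cvgMr; apply: cvg_powR_inv_nat; lra.
  apply: (@squeeze_cvgr _ _ _ _ (cst 0) _ _ _ _ _ h); last exact: cvg_cst.
  apply: nearW => n; rewrite /= !mulr_ge0 ?powR_ge0 ?expR_ge0//=.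
  rewrite -[leRHS]mulr1 ler_pM ?mulr_ge0 ?powR_ge0 ?expR_ge0 ?expR_le1 ?oppr_le0//.
  rewrite mulrC ler_wpM2r ?powR_ge0//; apply: ler_powRN => //.
  by rewrite lerDr.
Qed.

End RecessiveSolution.

(** * Limits of the recessive solution at 0 and the Wronskian argument *)

Section Wronskian.
Context {R : realType}.
Notation mu := (@lebesgue_measure R).
Local Notation I := (`]0%R, +oo[%classic : set R).

Lemma Kb_gt0 (b z : R) : 0 < z -> 0 <= b -> 0 < Kb b z.
Proof.
move=> z0 b0; rewrite -lte_fin /Kb /Rintegral fineK; last first.
  by apply: integrable_fin_num => //; exact: integrable_Kint.
pose m := (2 + z) `^ (- b) * expR (- 2).
have h : (\int[mu]_(x in `[1%R, 2%R]) m%:E <= \int[mu]_(s in I) (Kint b z s)%:E)%E.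
  apply: (@le_trans _ _ (\int[mu]_(s in `[1%R, 2%R]) (Kint b z s)%:E)%E).
    apply: ge0_le_integral => //.
    - by move=> s _; rewrite lee_fin mulr_ge0 ?powR_ge0 ?expR_ge0.
    - by apply/measurable_EFinP; exact: measurable_Kint.
    - move=> s /=; rewrite in_itv /= => /andP[s1 s2]; rewrite lee_fin /Kint /m.
      rewrite ler_pM ?powR_ge0 ?expR_ge0//; last by rewrite ler_expR; lra.
      rewrite -[leLHS]mul1r ler_pM ?powR_ge0//; last by apply: ler_powRN; lra.
      by rewrite -[leLHS](powRr0 s) ler_powR//; lra.
  apply: ge0_subset_integral => //=.
  - by apply/measurable_EFinP; exact: measurable_Kint.
  - by move=> s _; rewrite lee_fin Kint_ge0.
  - by move=> s /=; rewrite !in_itv /= andbT => /andP[s1 _]; exact: lt_le_trans s1.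
apply: lt_le_trans h; rewrite integral_cst//= lebesgue_measure_itv/= lte_fin ltr1n /=.
rewrite -EFinB -EFinM lte_fin; apply: mulr_gt0; last lra.
by rewrite mulr_gt0 ?expR_gt0// powR_gt0; lra.
Qed.

(** At z = 0 the integrand becomes v^(1/6 - 5/6) e^(-v), which is still integrable and dominates the
    case z > 0. The limit is Gamma(1/3). *)
Lemma cvg_Kb56 (z : nat -> R) : (forall n, 0 < z n) -> z @ \oo --> (0 : R) ->
  Kb (5/6) (z n) @[n --> \oo] --> gam (- (2/3)).
Proof.
move=> z0 zc.
have hg : mu.-integrable I (EFin \o (fun v => v `^ (- (2/3)) * expR (- v))).
  by apply: integrable_Gamma; lra.
have h : ((\int[mu]_(v in I) (Kint (5/6) (z n) v)%:E)%E @[n --> \oo] -->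
    (\int[mu]_(v in I) (v `^ (- (2/3)) * expR (- v))%:E)%E).
  have vE (v : R) : 0 < v -> v `^ (- (2/3)) = v `^ (1/6) * v `^ (- (5/6)).
    move=> v0; rewrite -powRD ?(gt_eqF v0) ?implybT//; congr (_ `^ _); by field.
  apply: (@dominated_cvg _ _ _ mu I _ _ _ (EFin \o (fun v => v `^ (- (2/3)) * expR (- v)))).
  - exact: measurable_itv.
  - by move=> n; apply/measurable_EFinP; exact: measurable_Kint.
  - move=> v /=; rewrite in_itv /= andbT => v0; apply/cvg_EFin; first exact: nearW.
    rewrite /= /Kint vE//; apply: cvgMl; apply: cvgMr.
    apply: (@continuous_cvg _ _ _ _ _ (fun n => v + z n) (fun x : R => x `^ (- (5/6)))).
      exact: continuous_powR.
    have : v + z n @[n --> \oo] --> v + 0 by apply: cvgD => //; exact: cvg_cst.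
    by rewrite addr0.
  - by [].
  - exact: hg.
  - move=> n v /=; rewrite in_itv /= andbT => v0; rewrite lee_fin ger0_norm ?Kint_ge0//.
    rewrite vE// /Kint ler_wpM2r ?expR_ge0// ler_wpM2l ?powR_ge0//.
    by apply: ler_powRN => //; have := z0 n; lra.
have := h; rewrite gamE; last lra.
by move=> /fine_cvg.
Qed.

(** At z = 0 the integrand would behave like v^(-5/3), so the integral blows up like z^(-2/3). The
    substitution v = z q extracts this factor and leaves q^(1/6) (1 + q)^(-11/6) e^(-z q), whose
    integral tends to B(2/3, 7/6). *)
Lemma cvg_Kb116 (z : nat -> R) : (forall n, 0 < z n) -> z @ \oo --> (0 : R) ->
  z n `^ (2/3) * Kb (11/6) (z n) @[n --> \oo] --> gam (- (1/3)) * gam (1/6) / gam (5/6).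
Proof.
move=> z0 zc; pose g (q : R) := q `^ (1/6) * (1 + q) `^ (- (11/6)).
have g0 q : 0 <= g q by rewrite mulr_ge0 ?powR_ge0.
have mg : measurable_fun [set: R] g.
  by apply: measurable_funM; apply: measurable_fun_powR => //; apply: measurable_funD.
have gp : 0 < gam (5/6 : R) by apply: gam_gt0; lra.
have Ig : (\int[mu]_(q in I) (g q)%:E = (gam (- (1/3)) * gam (1/6) / gam (5/6))%:E)%E.
  have := @beta_gam R (2/3) (7/6).
  rewrite (_ : 2/3 + 7/6 - 1 = 5/6); last by field.
  rewrite (_ : 7/6 - 1 = 1/6); last by field.
  rewrite (_ : 2/3 - 1 = - (1/3)); last by field.
  rewrite (_ : 2/3 + 7/6 = 11/6); last by field.
  move=> /(_ _ _ _) h.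
  have {}h := h ltac:(lra) ltac:(lra) ltac:(lra).
  transitivity ((gam (5/6))^-1%:E * ((gam (5/6))%:E * \int[mu]_(q in I) (g q)%:E))%E.
    by rewrite muleA -EFinM mulVf ?mul1e// gt_eqF.
  by rewrite h -EFinM; congr EFin; rewrite mulrC.
have gi : mu.-integrable I (EFin \o g).
  apply/integrableP; split; first by apply/measurable_EFinP; exact: measurable_funTS.
  under eq_integral do rewrite /= ger0_norm//.
  by rewrite Ig ltry.
have e n : ((z n `^ (2/3) * Kb (11/6) (z n))%:E = \int[mu]_(q in I) (g q * expR (- (z n * q)))%:E)%E.
  have zn := z0 n; rewrite EFinM /Kb /Rintegral fineK; last first.
    by apply: integrable_fin_num => //; apply: integrable_Kint => //; lra.
  rewrite (ge0_integral_scale zn); last 2 first.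
  - exact: measurable_Kint.
  - by move=> x _; exact: Kint_ge0.
  rewrite muleA -EFinM -ge0_integralZl//=; last 3 first.
  - apply/measurable_EFinP; apply: measurable_funTS.
    apply: (@measurableT_comp _ _ _ _ _ _ (Kint (11/6) (z n))); first exact: measurable_Kint.
    exact: measurable_funM.
  - by move=> x _; rewrite lee_fin Kint_ge0.
  - by rewrite lee_fin mulr_ge0 ?powR_ge0 ?ltW.
  apply: eq_integral => q; rewrite inE /= in_itv /= andbT => q0.
  rewrite -EFinM; congr EFin; rewrite /Kint /g.
  have -> : z n * q + z n = z n * (1 + q) by ring.
  rewrite !powRM ?ltW//; last lra.
  have nz : (z n == 0) = false by rewrite gt_eqF.
  have {2}-> : z n = z n `^ 1 by rewrite powRr1// ltW.
  have : z n `^ (2/3) * z n `^ 1 * z n `^ (1/6) * z n `^ (- (11/6)) = 1.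
    rewrite -!powRD ?nz ?implybT// (_ : 2/3 + 1 + 1/6 - 11/6 = 0) ?powRr0//; by field.
  move: (z n `^ (2/3)) (z n `^ 1) (z n `^ (1/6)) (z n `^ (- (11/6))) (q `^ (1/6)) ((1 + q) `^ (- (11/6))) (expR _) => A B C D E F G h.
  transitivity ((A * B * C * D) * (E * F * G)); first by ring.
  by rewrite h mul1r.
suff : (\int[mu]_(q in I) (g q * expR (- (z n * q)))%:E @[n --> \oo] --> \int[mu]_(q in I) (g q)%:E)%E.
  by rewrite Ig; under eq_fun do rewrite -e; move=> /fine_cvg.
apply: (@dominated_cvg _ _ _ mu I _ _ _ (EFin \o g)).
- exact: measurable_itv.
- move=> n; apply/measurable_EFinP; apply: measurable_funTS; apply: measurable_funM => //.
  by apply: measurable_fun_expR; apply: measurable_funN; exact: measurable_funM.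
- move=> q _; apply/cvg_EFin; first exact: nearW.
  rewrite /= -[X in _ --> X]mulr1; apply: cvgMr.
  rewrite -[X in _ --> X]expR0.
  apply: (@continuous_cvg _ _ _ _ _ (fun n => - (z n * q)) (@expR R)); first exact: continuous_expR.
  have : - (z n * q) @[n --> \oo] --> - (0 * q) by apply: cvgN; exact: cvgMl.
  by rewrite mul0r oppr0.
- by [].
- exact: gi.
- move=> n q /=; rewrite in_itv /= andbT => q0; rewrite lee_fin ger0_norm ?mulr_ge0 ?powR_ge0 ?expR_ge0//.
  by rewrite ler_piMr// expR_le1 oppr_le0 mulr_ge0 ?ltW.
Qed.

Lemma is_derive_eq0_cst (f : R -> R) : (forall x : R, 0 < x -> is_derive x (1 : R) f 0) ->
  forall x y : R, 0 < x -> 0 < y -> f x = f y.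
Proof.
move=> df; have h (x y : R) : 0 < x -> x < y -> f x = f y.
  move=> x0 xy; have [z zxy||c _] := @MVT _ f (cst 0) x y xy.
  - by apply: df; move: zxy; rewrite in_itv /= => /andP[+ _]; exact: lt_trans.
  - apply: derivable_within_continuous => z; rewrite in_itv /= => /andP[xz _].
    by have [] := df z (lt_le_trans x0 xz).
  - by rewrite mul0r => /eqP; rewrite subr_eq0 => /eqP ->.
by move=> x y x0 y0; have [xy|yx|->//] := ltgtP x y; [exact: h|rewrite (h y x)].
Qed.

(* The third hypothesis says that the Wronskian of w(-t) and Kb (5/6) (t^3/9) vanishes at t = 0. *)
Lemma recessive_bound (w w1 : R -> R) :
  (forall t : R, is_derive t (1 : R) w (w1 t)) ->
  (forall t : R, is_derive t (1 : R) w1 (- (5/6) * t * w t - t ^+ 2 / 3 * w1 t)) ->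
  gam (- (2/3)) * w1 0 = 5/18 * 9 `^ (2/3) * (gam (- (1/3)) * gam (1/6) / gam (5/6)) * w 0 ->
  exists C : R, forall t : R, 0 < t -> t ^+ 5 * w (- t) ^+ 2 <= C /\ t ^+ 7 * w1 (- t) ^+ 2 <= C.
Proof.
move=> hw hw1.
have q5 : 0 <= 5/6 :> R by lra.
have q11 : 0 <= 11/6 :> R by lra.
have g0 : 0 < gam (1/6 : R) by apply: gam_gt0; lra.
move=> h0; pose Z (t : R) := t ^+ 3 / 9.
have Z0 (t : R) : 0 < t -> 0 < Z t by move=> t0; rewrite /Z divr_gt0// exprn_gt0.
have hZ (t : R) : is_derive t (1 : R) Z (t ^+ 2 / 3).
  by rewrite /Z; apply: is_derive_eq; rewrite /GRing.scale /=; field.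
pose K0 t := Kb (5/6) (Z t); pose K1 t := Kb (11/6) (Z t); pose K2 t := Kb (17/6) (Z t).
have hK0 (t : R) : 0 < t -> is_derive t (1 : R) K0 (- (5/18) * t ^+ 2 * K1 t).
  move=> t0; have h : is_derive (Z t) (1 : R) (Kb (5/6)) (- (5/6) * Kb (11/6) (Z t)).
    rewrite (_ : 11/6 = 5/6 + 1); last by field.
    by apply: is_derive_Kb; [exact: Z0|].
  have := @is_derive1_comp _ _ _ _ _ _ h (hZ t); rewrite /comp => h'.
  by apply: (is_derive_eq h'); rewrite /K1; move: (Kb _ _) => A; field.
have hK1 (t : R) : 0 < t -> is_derive t (1 : R) K1 (- (11/18) * t ^+ 2 * K2 t).
  move=> t0; have h : is_derive (Z t) (1 : R) (Kb (11/6)) (- (11/6) * Kb (17/6) (Z t)).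
    rewrite (_ : 17/6 = 11/6 + 1); last by field.
    by apply: is_derive_Kb; [exact: Z0|].
  have := @is_derive1_comp _ _ _ _ _ _ h (hZ t); rewrite /comp => h'.
  by apply: (is_derive_eq h'); rewrite /K2; move: (Kb _ _) => A; field.
have eK (t : R) : 0 < t -> K0 t = 11/6 * Z t * K2 t + (Z t - 2/3) * K1 t.
  by move=> t0; apply/eqP; rewrite eq_sym -subr_eq0; apply/eqP; exact: Kb_ode (Z0 t t0).
have K0p (t : R) : 0 < t -> 0 < K0 t by move=> t0; apply: Kb_gt0; [exact: Z0|].
have K0le (t : R) : 0 < t -> K0 t <= Z t `^ (- (5/6)) * gam (1/6) by move=> t0; apply: Kb_le; [exact: Z0|].
have K1le (t : R) : 0 < t -> K1 t <= Z t `^ (- (11/6)) * gam (1/6) by move=> t0; apply: Kb_le; [exact: Z0|].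
have K1ge (t : R) : 0 <= K1 t by exact: Kb_ge0.
(* [K1] blows up at 0, so limits at 0 are taken along this positive sequence. *)
pose tn (n : nat) : R := n.+2%:R^-1.
have tn0 n : 0 < tn n by rewrite invr_gt0.
have tnc : tn @ \oo --> (0 : R) by rewrite (cvg_shiftS (@harmonic R)); exact: cvg_harmonic.
have Zc : Z (tn n) @[n --> \oo] --> (0 : R).
  have : Z (tn n) @[n --> \oo] --> Z 0.
    by apply: (@continuous_cvg _ _ _ _ _ tn Z) => //; exact: is_derive_continuous (hZ 0).
  by have -> : Z 0 = 0 by rewrite /Z expr0n /= mul0r.
have K0c : K0 (tn n) @[n --> \oo] --> gam (- (2/3)).
  by apply: cvg_Kb56 => // n; exact: Z0.
(* Since t^2 = (9 Z t)^(2/3), the limit from [cvg_Kb116] acquires the factor 9^(2/3). *)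
have K1c : tn n ^+ 2 * K1 (tn n) @[n --> \oo] --> 9 `^ (2/3) * (gam (- (1/3)) * gam (1/6) / gam (5/6)).
  have := @cvg_Kb116 (fun n => Z (tn n)) (fun n => Z0 _ (tn0 n)) Zc.
  move=> /(cvgMr (a := 9 `^ (2/3))) /=.
  under eq_fun => n.
    rewrite mulrA -powRM//; last by rewrite ltW// Z0.
    rewrite (_ : 9 * Z (tn n) = tn n ^+ 3); last by rewrite /Z mulrC divfK.
    rewrite -powR_mulrn; last by rewrite ltW.
    rewrite -powRrM (_ : 3%:R * (2/3) = 2%:R); last by field.
    rewrite powR_mulrn; last by rewrite ltW.
    over.
  by [].
clearbody K0 K1 K2; move: h0 K0c K1c.
move: (9 `^ (2/3)) (gam (- (1/3)) * gam (1/6) / gam (5/6)) (gam (- (2/3))) => c9 bt g3 h0 K0c K1c.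
(* Wronskian of [K0] and t -> w (- t). Both solve y'' = t^2/3 y' + 5/6 t y, so by Abel's identity
   the factor e^(-t^3/9) makes it constant. *)
pose W t := expR (- Z t) * (K0 t * w1 (- t) - 5/18 * t ^+ 2 * K1 t * w (- t)).
have dN (t : R) : is_derive t (1 : R) (fun t : R => - t) (- 1) by exact: is_deriveNid.
have hwN (t : R) : is_derive t (1 : R) (fun t => w (- t)) (- w1 (- t)).
  have := @is_derive1_comp _ _ _ _ _ _ (hw (- t)) (dN t); rewrite /comp => h'.
  by apply: (is_derive_eq h'); rewrite mulrN1.
have hw1N (t : R) : is_derive t (1 : R) (fun t => w1 (- t)) (- (5/6 * t * w (- t) - t ^+ 2 / 3 * w1 (- t))).
  have := @is_derive1_comp _ _ _ _ _ _ (hw1 (- t)) (dN t); rewrite /comp => h'.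
  by apply: (is_derive_eq h'); field.
have hE (t : R) : is_derive t (1 : R) (fun t => expR (- Z t)) (- (t ^+ 2 / 3) * expR (- Z t)).
  by apply: is_derive_eq; rewrite /GRing.scale /=; ring.
have hW (t : R) : 0 < t -> is_derive t (1 : R) W 0.
  move=> t0; have d0 := hK0 t t0; have d1 := hK1 t t0.
  rewrite /W; apply: is_derive_eq; rewrite /GRing.scale /= (eK t t0) /Z.
  by move: (expR _) (w _) (w1 _) (K1 t) (K2 t) => A B C D E; field.
(* The constant is the limit of [W] at 0, and [h0] says that this limit is 0. *)
have W0 (t : R) : 0 < t -> W t = 0.
  move=> t0; have Wc : W (tn n) @[n --> \oo] --> (0 : R).
    have c1 : expR (- Z (tn n)) @[n --> \oo] --> (1 : R).
      rewrite -[X in _ --> X]expR0.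
      apply: (@continuous_cvg _ _ _ _ _ (fun n => - Z (tn n)) (@expR R)); first exact: continuous_expR.
      by rewrite -[X in _ --> X]oppr0; exact: cvgN.
    have c2 : w (- tn n) @[n --> \oo] --> w 0.
      rewrite -[X in _ --> w X]oppr0.
      by apply: (@continuous_cvg _ _ _ _ _ tn (fun t => w (- t))) => //; exact: is_derive_continuous (hwN 0).
    have c3 : w1 (- tn n) @[n --> \oo] --> w1 0.
      rewrite -[X in _ --> w1 X]oppr0.
      by apply: (@continuous_cvg _ _ _ _ _ tn (fun t => w1 (- t))) => //; exact: is_derive_continuous (hw1N 0).
    have -> : (0 : R) = 1 * (g3 * w1 0 - 5/18 * (c9 * bt) * w 0).
      by rewrite h0; ring.
    rewrite /W; apply: cvgM => //; apply: cvgB; first exact: cvgM.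
    by apply: cvgM => //; under eq_fun do rewrite -mulrA; exact: cvgMr.
  have : W (tn n) @[n --> \oo] --> W t.
    rewrite (_ : (fun n => W (tn n)) = cst (W t)); first exact: cvg_cst.
    by apply/funext => n; apply: (is_derive_eq0_cst hW).
  by move=> /(cvg_unique (@Rhausdorff R) Wc).
have rel (t : R) : 0 < t -> K0 t * w1 (- t) = 5/18 * t ^+ 2 * K1 t * w (- t).
  move=> t0; have := W0 t t0; rewrite /W => /eqP.
  by rewrite mulf_eq0 gt_eqF ?expR_gt0//= subr_eq0 => /eqP.
(* A zero Wronskian makes w (- t) / K0 t constant; the ratio is read off at t = 1. *)
clear h0 W0 W hW; pose c := w (- 1) / K0 1.
have wc (t : R) : 0 < t -> w (- t) = c * K0 t.
  move=> t0; pose q t := w (- t) / K0 t.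
  suff -> : c = q t by rewrite /q divfK// gt_eqF// K0p.
  apply: (@is_derive_eq0_cst q) => // s s0.
  have k0 := K0p s s0; have kn : K0 s != 0 by rewrite gt_eqF.
  have d0 := hK0 s s0; have dV := is_deriveV kn d0.
  rewrite /q; apply: is_derive_eq; rewrite /GRing.scale /=.
  have := rel s s0; move: (w (- s)) (w1 (- s)) (K1 s) => A B C e.
  transitivity ((5/18 * s ^+ 2 * C * A - K0 s * B) / (K0 s) ^+ 2); last by rewrite e subrr mul0r.
  by field.
(* One constant serves both bounds: t^5 Z^(-5/3) = 9^(5/3) for w, and t^11 Z^(-11/3) = 9^(11/3) for
   w', where the factor t^2 in the derivative of [K0] turns t^7 into t^11. *)
clearbody c; exists (c ^+ 2 * gam (1/6) ^+ 2 * (9 `^ (5/3) + 9 `^ (11/3))) => t t0.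
have Zt := Z0 t t0; have t9 : t = (9 * Z t) `^ (1/3).
  rewrite (_ : 9 * Z t = t ^+ 3); last by rewrite /Z mulrC divfK.
  rewrite -powR_mulrn ?ltW// -powRrM (_ : 3%:R * (1/3) = 1) ?powRr1 ?ltW//; by field.
have pe (p : R) (n : nat) : n%:R = 6 * p -> t ^+ n * (Z t `^ (- p)) ^+ 2 = 9 `^ (2 * p).
  move=> np; rewrite -powR_mulrn ?ltW// {1}t9 -powRrM -[X in _ * X]powR_mulrn ?powR_ge0// -powRrM.
  rewrite powRM ?ltW// -mulrA -powRD ?(gt_eqF Zt) ?implybT//.
  have a1 : 1/3 * n%:R = 2 * p by rewrite np; field.
  have a2 : 2 * p + - p * 2 = 0 by ring.
  by rewrite a1 a2 powRr0 mulr1.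
have e5 : t ^+ 5 * (Z t `^ (- (5/6))) ^+ 2 = 9 `^ (5/3).
  by rewrite pe; [congr (_ `^ _); field|field].
have e11 : t ^+ 11 * (Z t `^ (- (11/6))) ^+ 2 = 9 `^ (11/3).
  by rewrite pe; [congr (_ `^ _); field|field].
have p5 : 0 < 9 `^ (5/3) :> R by exact: powR_gt0.
have p11 : 0 < 9 `^ (11/3) :> R by exact: powR_gt0.
have cg0 : 0 <= c ^+ 2 * gam (1/6) ^+ 2 by rewrite mulr_ge0 ?sqr_ge0.
have t5 : 0 <= t ^+ 5 by rewrite exprn_ge0 ?ltW.
have t11 : 0 <= t ^+ 11 by rewrite exprn_ge0 ?ltW.
have sq (a b : R) : 0 <= a -> a <= b -> a ^+ 2 <= b ^+ 2 by move=> a0 ab; nra.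
split.
- rewrite wc// exprMn.
  have h := ler_wpM2l t5 (sq _ _ (ltW (K0p t t0)) (K0le t t0)).
  have h2 := ler_wpM2l (sqr_ge0 c) h.
  apply: (@le_trans _ _ (c ^+ 2 * (t ^+ 5 * K0 t ^+ 2))); first by rewrite mulrCA.
  apply: (le_trans h2); rewrite exprMn (mulrA (t ^+ 5)) e5.
  have := mulr_ge0 cg0 (ltW p11); lra.
- have ew1 : w1 (- t) = 5/18 * c * (t ^+ 2 * K1 t).
    have kn : K0 t != 0 by rewrite gt_eqF// K0p.
    by apply: (mulfI kn); rewrite rel// wc//; ring.
  have h := ler_wpM2l t11 (sq _ _ (K1ge t) (K1le t t0)).
  have h2 := ler_wpM2l (sqr_ge0 c) h.
  have k : 0 <= c ^+ 2 * (t ^+ 11 * K1 t ^+ 2).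
    by apply: mulr_ge0; [exact: sqr_ge0|apply: mulr_ge0 => //; exact: sqr_ge0].
  apply: (@le_trans _ _ (c ^+ 2 * (t ^+ 11 * K1 t ^+ 2))).
    rewrite ew1 (_ : t ^+ 7 * _ = (5/18) ^+ 2 * (c ^+ 2 * (t ^+ 11 * K1 t ^+ 2))); last by ring.
    by lra.
  apply: (le_trans h2); rewrite exprMn (mulrA (t ^+ 11)) e11.
  have := mulr_ge0 cg0 (ltW p5); lra.
Qed.

End Wronskian.

(** * Two-sided bounds on the profile *)

Section ProfileBounds.
Context {R : realType}.

(** For |x| < 1 the truncation is 0, so the definition of [Gamma] shifts exactly once. This covers
    the four arguments in [Lambda0]. *)
Lemma Gamma_small (x : R) : `|x| < 1 -> Gamma x = gam x / x.
Proof.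
move=> x1; rewrite /Gamma.
have -> : Num.truncn `|x| = 0%N by apply/eqP; rewrite truncn_eq ?normr_ge0// normr_ge0 x1.
by rewrite /poch big_ord_recl big_ord0 mulr1 /= addr0 GammaIntE addrK.
Qed.

(** Up to the common factor 9^(1/6), [profile_p] and [- profile_q] are the value and slope of the
    profile at 0. In terms of the residual, w(0) = [profile_p] and w'(0) = [profile_q]. *)
Definition profile_p : R := Gamma (1/3) / Gamma (1/6).
Definition profile_q : R := (9 `^ (1/3))^-1 * (Gamma (- (1/3)) / Gamma (- (1/6))).

(** This is the third hypothesis of [recessive_bound]. The functional equation reduces both sides to
    [gam] at -2/3, -1/3 and -1/6, with [gam (1/6)] cancelling, and 9^(2/3) = 9 / 9^(1/3) matches the
    powers of 9. *)
Lemma profile_connection :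
  gam (- (2/3)) * profile_q =
  5/18 * 9 `^ (2/3) * (gam (- (1/3)) * gam (1/6) / gam (5/6)) * profile_p.
Proof.
rewrite /profile_p /profile_q !Gamma_small ?ltr_norml; [|lra..].
rewrite (@gam_rec R (1/3)) ?(@gam_rec R (5/6)); [|lra..].
rewrite (_ : 1/3 - 1 = - (2/3) :> R); last by field.
rewrite (_ : 5/6 - 1 = - (1/6) :> R); last by field.
have e : 9 `^ (2/3) = 9 * (9 `^ (1/3))^-1 :> R.
  rewrite -powRN -[X in _ = X * _](@powRr1 R 9)// -powRD ?implybT//; last by rewrite pnatr_eq0 implybT.
  by congr (_ `^ _); field.
have h9 : 9 `^ (1/3) != 0 :> R by rewrite gt_eqF// powR_gt0.
have h1 : gam (1/6) != 0 :> R by rewrite gt_eqF// gam_gt0//; lra.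
have h2 : gam (- (1/6)) != 0 :> R by rewrite gt_eqF// gam_gt0//; lra.
rewrite e; move: (9 `^ (1/3)) (gam (1/6)) (gam (- (1/6))) (gam (- (2/3))) (gam (- (1/3))) h9 h1 h2 => a b c d f h9 h1 h2.
by field; rewrite h9 h1 h2.
Qed.

Lemma continuous_bounded_segment (f : R -> R) (a b : R) : continuous f ->
  exists C : R, 0 <= C /\ forall x, a <= x <= b -> `|f x| <= C.
Proof.
move=> cf; have [ab|ba] := leP a b; last first.
  by exists 0; split=> // x /andP[ax xb]; have := le_trans ax xb; rewrite leNgt ba.
have cn : {within `[a, b], continuous (fun x => `|f x|)}.
  by apply: continuous_subspaceT => x; apply: continuous_comp; [exact: cf|exact: norm_continuous].
have [c _ hc] := EVT_max ab cn.
exists `|f c|; split; first exact: normr_ge0.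
by move=> x xab; apply: hc; rewrite in_itv.
Qed.

Lemma weighted_sqr_bound (n : nat) (w : R -> R) (C : R) : continuous w ->
  (forall t, 3 <= t -> t ^+ n * w t ^+ 2 <= C) ->
  (forall t, 3 <= t -> t ^+ n * w (- t) ^+ 2 <= C) ->
  exists D : R, 0 <= D /\ forall t, `|w t| <= D * (1 + `|t|) `^ (- (n%:R / 2)).
Proof.
move=> cw h1 h2.
have [C1 [C10 hC1]] := continuous_bounded_segment (-3) 3 cw.
have C0 : 0 <= C.
  by apply: le_trans (h1 3 _) => //; rewrite mulr_ge0 ?sqr_ge0 ?exprn_ge0.
(* The first term serves |t| >= 3, where 1 + |t| <= 2 |t|; the second serves |t| < 3, where 1 + |t|
   <= 4. *)
pose E := 2 ^+ n * C + 4 ^+ n * C1 ^+ 2.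
have E0 : 0 <= E by rewrite addr_ge0 ?mulr_ge0 ?sqr_ge0 ?exprn_ge0.
have hE t : (1 + `|t|) ^+ n * w t ^+ 2 <= E.
  have [t3|t3] := leP 3 `|t|.
    have ht : `|t| ^+ n * w t ^+ 2 <= C.
      have [t0|t0] := leP 0 t; first by rewrite ger0_norm// h1//; move: t3; rewrite ger0_norm.
      by rewrite ltr0_norm// -{2}(opprK t) h2//; move: t3; rewrite ltr0_norm.
    apply: (@le_trans _ _ (2 ^+ n * (`|t| ^+ n * w t ^+ 2))).
      rewrite mulrA -exprMn ler_wpM2r ?sqr_ge0// lerXn2r ?nnegrE//; lra.
    rewrite (le_trans (ler_wpM2l _ ht)) ?exprn_ge0// lerDl mulr_ge0 ?sqr_ge0 ?exprn_ge0//.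
  have wt : `|w t| <= C1 by apply: hC1; rewrite -ler_norml ltW.
  apply: (@le_trans _ _ (4 ^+ n * C1 ^+ 2)); last by rewrite lerDr mulr_ge0 ?exprn_ge0.
  rewrite ler_pM ?sqr_ge0 ?exprn_ge0//.
    by rewrite lerXn2r ?nnegrE//; lra.
  by rewrite -[leLHS]real_normK ?num_real// lerXn2r ?nnegrE.
exists (Num.sqrt E); split; first exact: sqrtr_ge0.
move=> t; have s0 : 0 < 1 + `|t| by have := normr_ge0 t; lra.
rewrite -(@ler_pXn2r _ 2) ?nnegrE ?mulr_ge0 ?sqrtr_ge0 ?powR_ge0//.
rewrite real_normK ?num_real// exprMn sqr_sqrtr// -[X in _ * X]powR_mulrn ?powR_ge0// -powRrM.
have -> : - (n%:R / 2) * 2 = - n%:R :> R by field.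
clearbody E; rewrite powR_invn; last exact: ltW.
by rewrite ler_pdivlMr ?exprn_gt0// mulrC.
Qed.

(** The pattern is that of |t|^(1/2): each derivative gains one power. The last bound gains three
    powers over that of g at once, because the combination annihilates |t|^(1/2). *)
Definition profile_bounds (g g1 g2 g3 : R -> R) (C : R) : Prop :=
  0 <= C /\
  (forall t : R, is_derive t (1 : R) g (g1 t)) /\
  (forall t : R, is_derive t (1 : R) g1 (g2 t)) /\
  (forall t : R, is_derive t (1 : R) g2 (g3 t)) /\
  (forall t : R, {for t, continuous g3}) /\
  forall t, [/\ `|g t| <= C * (1 + `|t|) `^ (1/2),
    `|g1 t| <= C * (1 + `|t|) `^ (- (1/2)),
    `|g2 t| <= C * (1 + `|t|) `^ (- (3/2)),
    `|g3 t| <= C * (1 + `|t|) `^ (- (5/2)) &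
    `|g t - 2 * t * g1 t| <= C * (1 + `|t|) `^ (- (5/2))].

Lemma Lambda0_profile : exists (g g1 g2 g3 : R -> R) (C : R),
  profile_bounds g g1 g2 g3 C /\
  forall t, Lambda0 t = (1 + t ^+ 2) `^ (- (1/4)) * g t.
Proof.
have := kummer_profile profile_p profile_q.
set G := (X in let G := X in _) => /= -[G1 [hG hG1 G0 G10]].
have LG t : Lambda0 t = 9 `^ (1/6) * (1 + t ^+ 2) `^ (- (1/4)) * G t.
  rewrite /Lambda0 /G /profile_p /profile_q; congr (_ * (_ - _)).
  by rewrite !mulrA.
pose w t := G t - 2 * t * G1 t; pose w1 t := - G1 t - t ^+ 2 / 3 * w t.
have [hw hw1] : (forall t : R, is_derive t (1 : R) w (w1 t)) /\
    (forall t : R, is_derive t (1 : R) w1 (- (5/6) * t * w t - t ^+ 2 / 3 * w1 t)).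
  exact: profile_residual hG hG1.
have w0 : w 0 = profile_p by rewrite /w G0 mulr0 mul0r subr0.
have ew t : G t - 2 * t * G1 t = w t by [].
(* The bounds on the profile follow algebraically from those on w and w': first G' is recovered,
   then G. *)
have eG1 t : G1 t = - w1 t - t ^+ 2 / 3 * w t by rewrite /w1; ring.
have eG t : G t = w t + 2 * t * G1 t by rewrite /w; ring.
have w10 : w1 0 = profile_q by rewrite /w1 G10 expr0n /= !mul0r subr0 opprK.
clearbody w w1 G.
have [C1 hC1] := energy_bound hw hw1.
have := profile_connection; rewrite -w0 -w10 => /(recessive_bound hw hw1) [C2 hC2].
have t0 t : 3 <= t -> 0 < t :> R by lra.
pose C := Num.max C1 C2.
have [D1 [D10 hD1]] : exists D : R, 0 <= D /\ forall t, `|w t| <= D * (1 + `|t|) `^ (- (5%:R / 2)).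
  apply: (@weighted_sqr_bound 5 w C).
  - by move=> t; exact: is_derive_continuous (hw t).
  - by move=> t t3; rewrite le_max (hC1 t t3).1.
  - by move=> t t3; rewrite le_max (hC2 t (t0 _ t3)).1 orbT.
have [D2 [D20 hD2]] : exists D : R, 0 <= D /\ forall t, `|w1 t| <= D * (1 + `|t|) `^ (- (7%:R / 2)).
  apply: (@weighted_sqr_bound 7 w1 C).
  - by move=> t; exact: is_derive_continuous (hw1 t).
  - by move=> t t3; rewrite le_max (hC1 t t3).2.
  - by move=> t t3; rewrite le_max (hC2 t (t0 _ t3)).2 orbT.
clear hC1 hC2 w0 w10 G0 G10 t0.
pose k : R := 9 `^ (1/6); have k0 : 0 < k by exact: powR_gt0.
rewrite -/k in LG; clearbody k.
(* The factor 9^(1/6) is absorbed into the profile; the second and third derivatives are t w / 6 and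
   (w + t w') / 6. *)
exists (fun t => k * G t), (fun t => k * G1 t), (fun t => k * (t / 6 * w t)), (fun t => k * ((w t + t * w1 t) / 6)), (k * (3 * (D1 + D2))).
split; last by move=> t; rewrite LG; ring.
split; first by apply: mulr_ge0; [exact: ltW|lra].
split; first by move=> t; apply: is_derive_eq; rewrite /GRing.scale /=; ring.
split; first by move=> t; apply: is_derive_eq; rewrite /GRing.scale /= ew; ring.
split; first by move=> t; apply: is_derive_eq; rewrite /GRing.scale /=; field.
split.
  move=> t; apply: (@is_derive_continuous _ _ _ (k * ((w1 t + (w1 t + t * (- (5/6) * t * w t - t ^+ 2 / 3 * w1 t))) / 6))).
  by apply: is_derive_eq; rewrite /GRing.scale /=; ring.
move=> t; set s := 1 + `|t|; have s1 : 1 <= s by rewrite lerDl.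
(* Every weight becomes a natural power of [s] times s^(-7/2), which reduces the estimates to
   arithmetic in these products. *)
pose a := s `^ (- (7/2)); have a0 : 0 < a by rewrite powR_gt0//; lra.
have sn : (s == 0) = false by apply/negbTE; rewrite gt_eqF//; lra.
have pe (p : R) (n : nat) : p = n%:R - 7/2 -> s `^ p = s ^+ n * a.
  by move=> ->; rewrite powRD ?sn ?implybT// powR_mulrn//; lra.
have := hD1 t; have := hD2 t; rewrite -/s (pe (- (5/2)) 1%N); last lra.
rewrite -/a (pe (- (3/2)) 2%N); last lra.
rewrite (pe (- (1/2)) 3%N); last lra.
rewrite (pe (1/2) 4%N); last lra.
rewrite expr1 => h2 h1.
have ts : `|t| <= s by rewrite /s; lra.
have T0 := normr_ge0 t.
clearbody a s; clear pe sn; move: (normr_ge0 (w t)) (normr_ge0 (w1 t)) => n0 n1.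
have s0 : 0 <= s by lra.
have mono (m n : nat) : (m <= n)%N -> s ^+ m * a <= s ^+ n * a.
  by move=> mn; apply: ler_wpM2r; [exact: ltW|exact: ler_weXn2l].
have pos n : 0 <= s ^+ n * a by apply: mulr_ge0; [exact: exprn_ge0|exact: ltW].
have b1 : `|G1 t| <= (D1 + D2) * (s ^+ 3 * a).
  rewrite eG1; apply: (le_trans (ler_normB _ _)); rewrite normrN normrM normrM normfV normrX (ger0_norm (_ : 0 <= 3))//.
  have q : `|t| ^+ 2 * `|w t| <= s ^+ 2 * (D1 * (s * a)).
    by rewrite ler_pM ?sqr_ge0// lerXn2r ?nnegrE//; lra.
  have q1 := ler_wpM2l D20 (mono 0%N 3%N isT); rewrite expr0 mul1r in q1.
  have q2 := mulr_ge0 D10 (pos 3%N).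
  lra.
have kk (x y : R) : `|x| <= 3 * (D1 + D2) * y -> `|k * x| <= k * (3 * (D1 + D2)) * y.
  by move=> h; rewrite normrM (gtr0_norm k0) -(mulrA k); apply: ler_wpM2l => //; exact: ltW.
have n2 : `|2| = 2 :> R by rewrite ger0_norm.
have n6 : `|6^-1| = 6^-1 :> R by rewrite ger0_norm.
have [p1 p2 p3 p4] := And4 (pos 1%N) (pos 2%N) (pos 3%N) (pos 4%N); rewrite expr1 in p1.
split.
- apply: kk; rewrite eG.
  have := ler_normD (w t) (2 * t * G1 t); rewrite !normrM n2.
  have q : `|t| * `|G1 t| <= s * ((D1 + D2) * (s ^+ 3 * a)) by rewrite ler_pM.
  have := ler_wpM2l D10 (mono 1%N 4%N isT); have := mulr_ge0 D20 p4.
  by rewrite expr1; lra.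
- apply: kk; have := mulr_ge0 D20 p3; have := mulr_ge0 D10 p3; lra.
- apply: kk; rewrite !normrM n6.
  have q : `|t| * `|w t| <= s * (D1 * (s * a)) by rewrite ler_pM.
  have := mulr_ge0 D20 p2; have := mulr_ge0 D10 p2; lra.
- apply: kk; rewrite normrM n6.
  have := ler_normD (w t) (t * w1 t); rewrite normrM.
  have q : `|t| * `|w1 t| <= s * (D2 * a) by rewrite ler_pM.
  have := mulr_ge0 D20 p1; have := mulr_ge0 D10 p1; lra.
- rewrite (_ : k * G t - _ = k * w t); last by rewrite -ew; ring.
  apply: kk; have := mulr_ge0 D20 p1; have := mulr_ge0 D10 p1; lra.
Qed.

End ProfileBounds.

(** * Integrals of powers *)

Section MeasureTools.
Context {R : realType}.
Notation mu := (@lebesgue_measure R).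

(** Measurability refers to the product sigma-algebra, so the open set is written as the countable
    union of the boxes with rational centre and half-width 1/(n+1) that it contains. *)
Lemma open_measurable2 (O : set (R * R)) : open O -> measurable O.
Proof.
move=> oO.
pose itv (q : rat) (n : nat) : set R := `]ratr q - n.+1%:R^-1, ratr q + n.+1%:R^-1[%classic.
pose box (k : rat * rat * nat) : set (R * R) := itv k.1.1 k.2 `*` itv k.1.2 k.2.
pose G (k : rat * rat * nat) : set (R * R) := if `[< box k `<=` O >] then box k else set0.
have -> : O = \bigcup_k G k.
  apply/seteqP; split => p; last first.
    by move=> [k _]; rewrite /G; case: asboolP => // h; exact: h.
  move=> Op; have := oO p Op; rewrite -nbhs_ballE => -[e /= e0 he].
  have [n hn] : exists n : nat, 2 / e < n.+1%:R.
    by exists (Num.truncn (2 / e)); exact: truncnS_gt.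
  pose d : R := n.+1%:R^-1; have d0 : 0 < d by rewrite invr_gt0.
  have de : 2 * d < e.
    by rewrite /d ltr_pdivrMr// mulrC -ltr_pdivrMr.
  have approx (x : R) : exists q : rat, x - d < ratr q < x + d.
    by have [q] := @rat_in_itvoo R (x - d) (x + d) ltac:(lra); rewrite in_itv /= => ?; exists q.
  have [q1 /andP[a1 b1]] := approx p.1; have [q2 /andP[a2 b2]] := approx p.2.
  exists (q1, q2, n) => //; rewrite /G; case: asboolP => [_|].
    by split; rewrite /itv /= in_itv /= -/d; apply/andP; split; lra.
  case=> -[x y] [/=]; rewrite /itv /= !in_itv /= -/d => /andP[x1 x2] /andP[y1 y2].
  apply: he; split; rewrite /ball /= ltr_norml; apply/andP; split; lra.
apply: countable_bigcupT_measurable; first exact: countableP.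
move=> k; rewrite /G; case: asboolP => // _.
by apply: measurableX; exact: measurable_itv.
Qed.

Lemma continuous_measurable_fun2 (F : R * R -> R) (D : set (R * R)) :
  measurable D -> continuous F -> measurable_fun D F.
Proof.
move=> mD /continuousP cF.
apply: (measurable_funS measurableT) => //.
apply: (measurability _ (RGenOpens.measurableE R)).
move=> _ [_ [a [b ->] <-]]; rewrite setTI; apply: open_measurable2.
exact/cF/interval_open.
Qed.

Lemma measurable_fun_abs d (T : measurableType d) (D : set T) (f : T -> R) :
  measurable_fun D f -> measurable_fun D (fun x => `|f x|).
Proof.
move=> mf; have h : measurable_fun [set: R] (fun x : R => `|x|).
  by apply: continuous_measurable_fun; exact: norm_continuous.
exact: (measurableT_comp h mf).
Qed.

(** A translation moves the singularity to 0, and a reflection identifies the two halves. *)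
Lemma integral_abs_powR_le (q L c : R) : 0 <= q < 1 -> 0 < L ->
  (\int[mu]_(v in `](c - L)%R, (c + L)%R[) (`|v - c| `^ (- q))%:E
    <= (2 * (L `^ (1 - q) / (1 - q)))%:E)%E.
Proof.
move=> /andP[q0 q1] L0.
pose h (v : R) : \bar R := ((fun v : R => (`|v| `^ (- q))%:E) \_ (`](- L), L[%classic)) v.
have mp : measurable_fun [set: R] (fun v : R => (`|v| `^ (- q))%:E).
  by apply/measurable_EFinP; apply: measurable_fun_powR; exact: measurable_fun_abs.
have mh : measurable_fun [set: R] h.
  by apply/(measurable_restrictT _ _).1 => //; apply: measurable_funTS.
have h0 v : (0 <= h v)%E by apply: erestrict_ge0 => ? _; rewrite lee_fin powR_ge0.
have -> : (\int[mu]_(v in `](c - L)%R, (c + L)%R[) (`|v - c| `^ (- q))%:E = \int[mu]_v h v)%E.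
  rewrite integral_mkcond [LHS](@ge0_integral_affine _ 1 c)//.
  - rewrite mul1e; apply: eq_integral => v _; rewrite mul1r /h !patchE.
    rewrite addrK; congr (if _ then _ else _); apply/idP/idP => /set_mem /=; rewrite in_itv /= => /andP[? ?];
    by apply/mem_set; rewrite /= in_itv /=; apply/andP; split; lra.
  - apply/(measurable_restrictT _ _).1 => //; apply/measurable_EFinP; apply: measurable_funTS.
    apply: measurable_fun_powR; apply: measurable_fun_abs.
    by apply: measurable_funB.
  - by move=> v; apply: erestrict_ge0 => ? _; rewrite lee_fin powR_ge0.
have P : (\int[mu]_(x in `]0%R, L]) (`|x| `^ (- q))%:E <= (L `^ (1 - q) / (1 - q))%:E)%E.
  rewrite -(addrC (- q)); apply: le_trans (@integral_powR_le _ (- q) L _ L0); last lra.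
  apply: ge0_le_integral => //.
  - exact: measurable_funTS.
  - by apply/measurable_EFinP; apply: measurable_funTS; exact: measurable_powR.
  - by move=> x /=; rewrite in_itv /= => /andP[x0 _]; rewrite ger0_norm// ltW.
have hN v : h (- v) = h v.
  rewrite /h !patchE normrN; congr (if _ then _ else _).
  by apply/idP/idP => /set_mem /=; rewrite in_itv /= => /andP[? ?]; apply/mem_set; rewrite /= in_itv /=; apply/andP; split; lra.
have E : [set: R] = `]-oo, 0%R]%classic `|` `]0%R, +oo[%classic.
  by apply/seteqP; split => x //= _; rewrite !in_itv /= andbT; case: (leP x 0); [left|right].
rewrite E ge0_integral_setU//=; last 2 first.
- exact: measurable_funTS.
- by apply/disj_setPS => x /= []; rewrite !in_itv /= andbT => h1 h2; move: (lt_le_trans h2 h1); rewrite ltxx.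
have -> : (\int[mu]_(x in `]-oo, 0%R]) h x = \int[mu]_(x in `]0%R, +oo[) h x)%E.
  under eq_integral do rewrite -hN.
  rewrite -ge0_integration_by_substitution0//.
  by rewrite integral_itv_obnd_cbnd//; exact: measurable_funTS.
have -> : (2 * (L `^ (1 - q) / (1 - q)))%:E = ((L `^ (1 - q) / (1 - q))%:E + (L `^ (1 - q) / (1 - q))%:E)%E.
  by rewrite -EFinD; congr EFin; ring.
suff Q : (\int[mu]_(x in `]0%R, +oo[) h x <= (L `^ (1 - q) / (1 - q))%:E)%E by exact: leeD.
apply: le_trans P; rewrite integral_mkcond [leRHS]integral_mkcond.
apply: ge0_le_integral => //.
- by move=> x _; apply: erestrict_ge0.
- by apply/(measurable_restrictT _ _).1 => //; apply: measurable_funTS.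
- by apply/(measurable_restrictT _ _).1 => //; apply: measurable_funTS.
- move=> x _; rewrite !patchE; case: ifPn => [/set_mem /=|_]; last by case: ifPn => // _; rewrite lee_fin powR_ge0.
  rewrite in_itv /= andbT => x0; rewrite /h patchE; case: ifPn => [/set_mem /=|_]; last by case: ifPn => // _; rewrite lee_fin powR_ge0.
  by rewrite in_itv /= => /andP[_ xL]; rewrite mem_set//= in_itv /= x0 ltW.
Qed.

End MeasureTools.

(** * Singular power weights on an interval *)

Section PowerIntegrals.
Context {R : realType}.
Notation mu := (@lebesgue_measure R).

(** By convention 0 raised to a negative power is 0, so bounds by singular powers may fail at the
    singular point itself, which is discarded as a null set. *)
Lemma ae_neq (c : R) (P : R -> Prop) : (forall x, x != c -> P x) -> {ae mu, forall x, P x}.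
Proof.
move=> h; exists [set c]; split.
- exact: measurable_set1.
- exact: lebesgue_measure_set1.
- by move=> x /= hx; apply: contrapT => /eqP xc; apply: hx; exact: h.
Qed.

Lemma ae_neq2 (c e : R) (P : R -> Prop) :
  (forall x, x != c -> x != e -> P x) -> {ae mu, forall x, P x}.
Proof.
move=> h; exists ([set c] `|` [set e]); split.
- by apply: measurableU; exact: measurable_set1.
- rewrite measureU0; [exact: lebesgue_measure_set1|exact: measurable_set1|exact: measurable_set1|exact: lebesgue_measure_set1].
- move=> x /= hx; apply: contrapT => xce; apply: hx; apply: h; apply/eqP => xE; apply: xce; [left|right]; exact: xE.
Qed.

(** Twice the integral of v^(-q) over ]0, b - a[. It bounds the integral of |v - c|^(-q) over ]a, b[
    uniformly in the centre c of [a, b]. *)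
Definition pow_cst (a b q : R) : R := 2 * ((b - a) `^ (1 - q) / (1 - q)).

Lemma pow_cst_ge0 (a b q : R) : q < 1 -> 0 <= pow_cst a b q.
Proof. by move=> q1; rewrite mulr_ge0// divr_ge0 ?powR_ge0//; lra. Qed.

Lemma measurable_abs_powR (c q : R) (D : set (measurableTypeR R)) :
  measurable_fun D (fun v : R => `|v - c| `^ (- q)).
Proof.
by apply: measurable_funTS; apply: measurable_fun_powR; apply: measurable_fun_abs; apply: measurable_funB.
Qed.

Lemma integral_abs_powR_itv_le (a b c q : R) : a < b -> a <= c <= b -> 0 <= q < 1 ->
  (\int[mu]_(v in `]a, b[) (`|v - c| `^ (- q))%:E <= (pow_cst a b q)%:E)%E.
Proof.
move=> ab /andP[ac cb] hq; have L0 : 0 < b - a by lra.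
apply: le_trans (@integral_abs_powR_le _ q (b - a) c hq L0).
apply: ge0_subset_integral => //=.
- by apply/measurable_EFinP; exact: measurable_abs_powR.
- by move=> v /=; rewrite !in_itv /= => /andP[? ?]; apply/andP; split; lra.
Qed.

Lemma integral_two_powR_le (a b c1 c2 q1 q2 k1 k2 : R) : a < b ->
  a <= c1 <= b -> a <= c2 <= b -> 0 <= q1 < 1 -> 0 <= q2 < 1 -> 0 <= k1 -> 0 <= k2 ->
  (\int[mu]_(v in `]a, b[) (k1 * `|v - c1| `^ (- q1) + k2 * `|v - c2| `^ (- q2))%:E
    <= (k1 * pow_cst a b q1 + k2 * pow_cst a b q2)%:E)%E.
Proof.
move=> ab h1 h2 hq1 hq2 k10 k20.
under eq_integral do rewrite EFinD !EFinM.
rewrite ge0_integralD//=; last 4 first.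
- by move=> v _; rewrite -EFinM lee_fin mulr_ge0 ?powR_ge0.
- by apply: emeasurable_funM => //; apply/measurable_EFinP; exact: measurable_abs_powR.
- by move=> v _; rewrite -EFinM lee_fin mulr_ge0 ?powR_ge0.
- by apply: emeasurable_funM => //; apply/measurable_EFinP; exact: measurable_abs_powR.
rewrite !ge0_integralZl//=; last 2 first.
- by apply/measurable_EFinP; exact: measurable_abs_powR.
- by apply/measurable_EFinP; exact: measurable_abs_powR.
by rewrite EFinD !EFinM; apply: leeD; apply: lee_wpmul2l => //; exact: integral_abs_powR_itv_le.
Qed.

Lemma L2sq_le (f : R -> R) (A q : R) : 0 <= q < 1 -> 0 <= A ->
  (forall z, -1 < z < 1 -> z != 0 -> f z ^+ 2 <= A * `|z| `^ (- q)) ->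
  (L2sq (-1) 1 f <= (A * pow_cst (-1) 1 q)%:E)%E.
Proof.
move=> hq A0 hf; rewrite /L2sq /leb.
have := @integral_two_powR_le (-1) 1 0 0 q q A 0.
rewrite mul0r addr0 => h; apply: le_trans (h _ _ _ _ _ _ _); [|lra|lra|lra|by []|by []|by []|by []].
apply: le_integral_ae => //.
- apply/measurable_EFinP; apply: measurable_funD; apply: measurable_funM => //; exact: measurable_abs_powR.
- by move=> z _; rewrite lee_fin sqr_ge0.
- by move=> z _; rewrite lee_fin addr_ge0 ?mulr_ge0 ?powR_ge0.
- apply: (@ae_neq 0) => z z0; rewrite /= in_itv /= => zI.
  by rewrite lee_fin mul0r addr0 subr0; exact: hf.
Qed.

(* In each summand of the right-hand side only one factor is singular in y at fixed x, so
   iterated integrals can be bounded without exchanging the order of integration. *)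
Lemma powR_split (x y al be : R) : 0 < `|x| -> 0 < `|y| -> 0 < `|x - y| ->
  0 <= al <= 1 -> 0 <= be <= 1 ->
  `|y| `^ (- al) * `|x - y| `^ (- be) <=
  2 * (`|x| `^ (- al) * `|x - y| `^ (- be)) + 2 * (`|x| `^ (- be) * `|y| `^ (- al)).
Proof.
move=> x0 y0 xy0 /andP[al0 al1] /andP[be0 be1].
have tri : `|x| <= `|y| + `|x - y| by rewrite -{1}(subrK y x) addrC; exact: ler_normD.
have half (g u : R) : 0 <= g <= 1 -> `|x| / 2 <= u -> u `^ (- g) <= 2 * `|x| `^ (- g).
  move=> /andP[g0 g1] hu; apply: (@le_trans _ _ ((`|x| / 2) `^ (- g))).
    by apply: ler_powRN => //; lra.
  rewrite powRM ?invr_ge0// mulrC ler_wpM2r ?powR_ge0//.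
  rewrite -[X in _ <= X](powRr1 (_ : 0 <= 2))// -powR_inv1// -powRrM mulN1r opprK.
  by apply: ler_powR; lra.
have p1 := powR_ge0 `|x| (- al); have p2 := powR_ge0 `|x - y| (- be).
have p3 := powR_ge0 `|x| (- be); have p4 := powR_ge0 `|y| (- al).
(* By the triangle inequality |y| or |x - y| is at least |x| / 2, and [half] replaces that factor by
   a power of |x|. *)
have [h|h] := leP (`|x| / 2) `|y|.
  have := ler_wpM2r p2 (half al `|y| _ h); rewrite al0 al1 => /(_ isT).
  have := mulr_ge0 p3 p4; lra.
have h' : `|x| / 2 <= `|x - y| by lra.
have := ler_wpM2l p4 (half be `|x - y| _ h'); rewrite be0 be1 => /(_ isT).
have := mulr_ge0 p1 p2; lra.
Qed.

(** By [powR_split] the weighted kernel is at most 3 |x-c|^(-al) |x-y|^(-be) + 2 |x-c|^(-be)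
    |y-c|^(-al). Integrating in y, then in x, gives 3 + 2 = 5 times the product of the two
    constants. *)
Lemma double_integral_le (a b c al be C : R) (f : R -> R -> \bar R) : a < b -> a <= c <= b ->
  0 <= al < 1 -> 0 <= be < 1 -> 0 <= C ->
  (forall x y, a < x < b -> a < y < b -> (0 <= f x y)%E) ->
  (forall x y, a < x < b -> a < y < b -> x != c -> y != c -> x != y ->
     (f x y <= (C * ((`|x - c| `^ (- al) + `|y - c| `^ (- al)) * `|x - y| `^ (- be)))%:E)%E) ->
  (\int[mu]_(x in `]a, b[) \int[mu]_(y in `]a, b[) f x y
   <= (C * (5 * pow_cst a b al * pow_cst a b be))%:E)%E.
Proof.
move=> ab hc hal hbe C0 f0 hf.
set A := pow_cst a b al; set B := pow_cst a b be.
have A0 : 0 <= A by apply: pow_cst_ge0; lra.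
have B0 : 0 <= B by apply: pow_cst_ge0; lra.
have -> : C * (5 * A * B) = (C * (3 * B)) * A + (C * (2 * A)) * B by ring.
have k1 : 0 <= C * (3 * B) by apply: mulr_ge0 => //; exact: mulr_ge0.
have k2 : 0 <= C * (2 * A) by apply: mulr_ge0 => //; exact: mulr_ge0.
apply: le_trans (@integral_two_powR_le a b c c al be _ _ ab hc hc hal hbe k1 k2).
apply: le_integral_ae => //.
- by apply/measurable_EFinP; apply: measurable_funD; apply: measurable_funM => //; exact: measurable_abs_powR.
- move=> x /=; rewrite in_itv /= => xI; apply: integral_ge0 => y /=; rewrite in_itv /= => yI; exact: f0.
- by move=> x _; rewrite lee_fin; apply: addr_ge0; apply: mulr_ge0 => //; exact: powR_ge0.
apply: (@ae_neq c) => x xc; rewrite /= in_itv /= => xI.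
have xI' : a <= x <= b by case/andP: xI => /ltW -> /ltW ->.
set p := `|x - c| `^ (- al); set q := `|x - c| `^ (- be).
have p0 : 0 <= p by exact: powR_ge0.
have q0 : 0 <= q by exact: powR_ge0.
have -> : C * (3 * B) * p + C * (2 * A) * q = (C * 3 * p) * B + (C * 2 * q) * A by ring.
have l1 : 0 <= C * 3 * p by apply: mulr_ge0 => //; exact: mulr_ge0.
have l2 : 0 <= C * 2 * q by apply: mulr_ge0 => //; exact: mulr_ge0.
apply: le_trans (@integral_two_powR_le a b x c be al _ _ ab xI' hc hbe hal l1 l2).
apply: le_integral_ae => //.
- by apply/measurable_EFinP; apply: measurable_funD; apply: measurable_funM => //; exact: measurable_abs_powR.
- by move=> y /=; rewrite in_itv /= => yI; exact: f0.
- by move=> y _; rewrite lee_fin; apply: addr_ge0; apply: mulr_ge0 => //; exact: powR_ge0.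
apply: (@ae_neq2 c x).
move=> y yc yx; rewrite /= in_itv /= => yI.
have xy : x != y by rewrite eq_sym.
apply: (le_trans (hf x y xI yI xc yc xy)); rewrite lee_fin.
have e : x - y = (x - c) - (y - c) by ring.
have := @powR_split (x - c) (y - c) al be; rewrite -e !normr_gt0 !subr_eq0 => /(_ xc yc xy).
case/andP: hal => al0 al1; case/andP: hbe => be0 be1.
rewrite al0 be0 (ltW al1) (ltW be1) => /(_ isT isT) h.
rewrite (distrC y x) -/p; rewrite -/p -/q in h.
move: (`|y - c| `^ (- al)) (`|x - y| `^ (- be)) h => u v h.
have := ler_wpM2l C0 h; lra.
Qed.

End PowerIntegrals.

(** * Hoelder estimates *)

Section HoelderEstimates.
Context {R : realType}.

(** Comparable with the radius sqrt(z^2 + d^(2/3)) of [u_sing], and simpler to compare with each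
    variable separately. *)
Definition rho (d z : R) : R := `|z| + d `^ (1/3).

Lemma rho_gt0 (d z : R) : 0 < d -> 0 < rho d z.
Proof. by move=> d0; rewrite /rho ltr_wpDl// powR_gt0. Qed.

Lemma ler_rho (d e z : R) : 0 < d -> d <= e -> rho d z <= rho e z.
Proof. by move=> d0 de; rewrite lerD2l ge0_ler_powR ?nnegrE//; lra. Qed.

Lemma cbrtK (d : R) : 0 <= d -> (d `^ (1/3)) ^+ 3 = d.
Proof. by move=> d0; rewrite -powR_mulrn ?powR_ge0// -powRrM div1r mulVf// powRr1. Qed.

(** The exponent is shared as m/4 against rho >= |z| and 3m/4 against rho >= d^(1/3); this choice
    equalises the powers of |z| and d. *)
Lemma rho_powRN_le (d z m : R) : 0 < d -> z != 0 -> 0 <= m ->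
  rho d z `^ (- m) <= `|z| `^ (- (m / 4)) * d `^ (- (m / 4)).
Proof.
move=> d0 z0 m0; have r0 := rho_gt0 z d0; have zp : 0 < `|z| by rewrite normr_gt0.
have c0 : 0 < d `^ (1/3) by exact: powR_gt0.
have -> : - m = - (m / 4) + - (3 * (m / 4)) by field.
rewrite powRD ?(gt_eqF r0) ?implybT//; apply: ler_pM; rewrite ?powR_ge0//.
  by apply: ler_powRN => //; [rewrite /rho lerDl ltW|lra].
apply: (@le_trans _ _ ((d `^ (1/3)) `^ (- (3 * (m / 4))))).
  by apply: ler_powRN => //; [rewrite /rho lerDr|lra].
by rewrite -powRrM le_eqVlt; apply/orP; left; apply/eqP; congr (_ `^ _); field.
Qed.

Lemma powR_half (p : R) : 2^-1 `^ (- p) = 2 `^ p.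
Proof. by rewrite -powR_inv1// -powRrM mulN1r opprK. Qed.

Lemma MVT_le (f df : R -> R) (a b B : R) :
  (forall x : R, Num.min a b <= x <= Num.max a b -> is_derive x (1 : R) f (df x) /\ `|df x| <= B) ->
  `|f a - f b| <= `|a - b| * B.
Proof.
wlog ab : a b / a <= b.
  move=> h; case/orP: (le_total a b) => [/h//|ba] hx.
  by rewrite distrC (distrC a); apply: h => // x; rewrite minC maxC; exact: hx.
rewrite (min_idPl ab) (max_idPr ab) => h.
have [c||c] := @MVT_segment _ f df a b ab.
- by rewrite in_itv /= => /andP[/ltW ac /ltW cb]; have [] := h c; rewrite ?ac.
- by apply: derivable_within_continuous => c; rewrite in_itv /= => /h [[]].
rewrite in_itv /= => /h [_ hc] e.
by rewrite distrC e normrM mulrC (distrC a) ler_wpM2l.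
Qed.

Lemma powR_le_split (h r th p : R) : 0 < h -> h <= r -> th <= 1 -> h * r `^ p <= h `^ th * r `^ (p + 1 - th).
Proof.
move=> h0 hr th1; have r0 : 0 < r by lra.
rewrite -[X in X * _ <= _](powRr1 (ltW h0)) (_ : 1 = th + (1 - th)); last by ring.
rewrite powRD ?(gt_eqF h0) ?implybT// (_ : p + _ - th = (1 - th) + p); last by ring.
rewrite [X in _ <= _ * X]powRD ?(gt_eqF r0) ?implybT// !mulrA ler_wpM2r ?powR_ge0// ler_wpM2l ?powR_ge0//.
by apply: ge0_ler_powR; rewrite ?nnegrE; lra.
Qed.

(* Interpolation between the size of [f] and the size of its derivative, at the scale [r]. *)
Lemma hoelder_z (f df : R -> R) (e C th : R) : 0 < e -> 0 <= C -> 0 <= th <= 1 ->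
  (forall z : R, is_derive z (1 : R) f (df z)) ->
  (forall z : R, -1 <= z <= 1 -> `|f z| <= C * (`|z| + e) `^ (- (3/2)) /\
     `|df z| <= C * (`|z| + e) `^ (- (5/2))) ->
  forall z w : R, -1 <= z <= 1 -> -1 <= w <= 1 -> z != w ->
  `|f z - f w| <= 8 * C * (`|z - w| `^ th *
     ((`|z| + e) `^ (- (3/2 + th)) + (`|w| + e) `^ (- (3/2 + th)))).
Proof.
move=> e0 C0 /andP[th0 th1] df_ hb.
have r0 (z : R) : 0 < `|z| + e by rewrite ltr_wpDl.
have close (z w : R) : -1 <= z <= 1 -> -1 <= w <= 1 -> z != w -> `|z - w| <= (`|z| + e) / 2 ->
    `|f z - f w| <= 8 * C * (`|z - w| `^ th * (`|z| + e) `^ (- (3/2 + th))).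
  move=> zI wI zw h; pose r : R := `|z| + e; rewrite -/r in h *; have rp : 0 < r by exact: r0.
  have h0 : 0 < `|z - w| by rewrite normr_gt0 subr_eq0.
  apply: (@le_trans _ _ (`|z - w| * (8 * C * r `^ (- (5/2))))).
    apply: (@MVT_le f df) => x /andP[x1 x2]; split=> //.
    have xI : -1 <= x <= 1 by move: x1 x2; rewrite /Num.min /Num.max; case: ifP => _ ? ?; apply/andP; split; lra.
    have xz : `|z - x| <= `|z - w|.
      by move: x1 x2; rewrite /Num.min /Num.max; case: ifP => ? ? ?; [rewrite ler0_norm; [rewrite ler0_norm|]|rewrite ger0_norm; [rewrite ger0_norm|]]; lra.
    (* Along the segment the scale stays above r / 2, which costs 2^(5/2) <= 8 in the bound on the
       derivative. *)
    have xr : r / 2 <= `|x| + e.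
      have : `|z| <= `|x| + `|z - x| by rewrite -{1}(subrK x z) addrC; exact: ler_normD.
      rewrite /r in h *; lra.
    apply: (le_trans (hb x xI).2); rewrite (mulrC 8) -(mulrA C) ler_wpM2l//.
    apply: (@le_trans _ _ ((r / 2) `^ (- (5/2)))); first by apply: ler_powRN => //; lra.
    rewrite powRM ?invr_ge0//; last lra.
    rewrite mulrC ler_wpM2r ?powR_ge0// powR_half.
    apply: (@le_trans _ _ (2 `^ 3%:R)); first by apply: ler_powR; lra.
    by rewrite powR_mulrn//; lra.
  have hr : `|z - w| <= r by lra.
  have := @powR_le_split `|z - w| r th (- (5/2)) h0 hr th1.
  rewrite (_ : - (5/2) + 1 - th = - (3/2 + th)); last by field.
  move=> k; have k8 : 0 <= 8 * C by lra.
  have := ler_wpM2l k8 k; lra.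
move=> z w zI wI zw.
have h0 : 0 < `|z - w| by rewrite normr_gt0 subr_eq0.
have P (z' : R) := powR_ge0 (`|z'| + e) (- (3/2 + th)); have Q := powR_ge0 `|z - w| th.
have C8 : 0 <= 8 * C by lra.
have [h|h] := leP `|z - w| ((`|z| + e) / 2).
  apply: (le_trans (close z w zI wI zw h)); rewrite ler_wpM2l// ler_wpM2l// lerDl//.
have [h'|h'] := leP `|z - w| ((`|w| + e) / 2).
  rewrite distrC; rewrite distrC in h'; rewrite eq_sym in zw.
  apply: (le_trans (close w z wI zI zw h')); rewrite (distrC w) ler_wpM2l// ler_wpM2l// lerDr//.
(* Once |z - w| exceeds half of both scales, size alone suffices: r^(-3/2) = r^th r^(-(3/2 + th))
   with r < 2 |z - w|. *)
have far (z' : R) : (`|z'| + e) / 2 < `|z - w| -> (`|z'| + e) `^ (- (3/2)) <= 2 * (`|z - w| `^ th * (`|z'| + e) `^ (- (3/2 + th))).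
  move=> k; have rp := r0 z'.
  have -> : - (3/2) = th + - (3/2 + th) by ring.
  rewrite powRD ?(gt_eqF rp) ?implybT// mulrA ler_wpM2r ?powR_ge0//.
  apply: (@le_trans _ _ ((2 * `|z - w|) `^ th)).
    by apply: ge0_ler_powR => //; rewrite ?nnegrE; lra.
  rewrite powRM// ler_wpM2r ?powR_ge0// -[leRHS](powRr1 (_ : 0 <= 2))//.
  by apply: ler_powR; lra.
apply: (le_trans (ler_normB _ _)).
have a1 := (hb z zI).1; have a2 := (hb w wI).1.
have b1 := ler_wpM2l C0 (far z h); have b2 := ler_wpM2l C0 (far w h').
have c1 := mulr_ge0 C0 (mulr_ge0 Q (P z)); have c2 := mulr_ge0 C0 (mulr_ge0 Q (P w)).
lra.
Qed.

(** The same interpolation in d, at the scale rho^3 because rho contains d^(1/3). Only [rho a z]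
    appears since rho increases with d. The bound th >= 1/6 makes 3 th - 1/2 nonnegative, which is
    used when |a - b| > rho^3. *)
Lemma hoelder_d (f df : R -> R) (z C th a b : R) : 0 <= C -> 1/6 <= th <= 1 ->
  0 < a -> a < b ->
  (forall x : R, a <= x <= b -> is_derive x (1 : R) f (df x)) ->
  (forall x : R, a <= x <= b -> `|f x| <= C * rho x z `^ (1/2) /\
     `|df x| <= C * rho x z `^ (- (5/2))) ->
  `|f a - f b| <= 4 * C * (`|a - b| `^ th * rho a z `^ (- (3 * th - 1/2))).
Proof.
move=> C0 /andP[th0 th1] a0 ab dfx hb.
have p52 : 0 <= 5/2 :> R by lra.
have rp := rho_gt0 z a0; have [r rE] : exists r, r = rho a z by exists (rho a z).
rewrite -rE in rp *.
have r3 (p : R) : (r ^+ 3) `^ p = r `^ (3 * p) by rewrite -(powR_mulrn 3 (ltW rp)) -powRrM.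
have h0 : 0 < `|a - b| by rewrite normr_gt0 subr_eq0 lt_eqF.
have hE : `|a - b| = b - a by rewrite ler0_norm; lra.
have [h|h] := leP `|a - b| (r ^+ 3).
  apply: (@le_trans _ _ (`|a - b| * (C * r `^ (- (5/2))))).
    apply: (@MVT_le f df); rewrite (min_idPl (ltW ab)) (max_idPr (ltW ab)) => x xI; split; first exact: dfx.
    have rx : r <= rho x z by rewrite rE; apply: ler_rho => //; case/andP: xI.
    by apply: (le_trans (hb x xI).2); apply: ler_wpM2l => //; exact: ler_powRN rp rx p52.
  have := @powR_le_split `|a - b| (r ^+ 3) th (- (5/6)) h0 h th1.
  rewrite !r3 (_ : 3 * (- (5/6)) = - (5/2)); last by field.
  rewrite (_ : 3 * (- (5/6) + 1 - th) = - (3 * th - 1/2)); last by field.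
  move=> k; have := ler_wpM2l C0 k; have := mulr_ge0 C0 (mulr_ge0 (powR_ge0 `|a - b| th) (powR_ge0 r (- (3 * th - 1/2)))); lra.
set k := `|a - b| `^ (1/3); have k0 : 0 < k by exact: powR_gt0.
have k3 : k ^+ 3 = `|a - b| by apply: cbrtK; exact: ltW.
clearbody k; have kn := ltW k0; have rn := ltW rp.
have rk : r <= k by rewrite -(@ler_pXn2r _ 3) ?nnegrE// k3; exact: ltW.
(* The cube root is subadditive, so rho b z <= rho a z + k, and rho a z <= k in this case. *)
have rb : rho b z <= 2 * k.
  have c0 : 0 <= a `^ (1/3) by exact: powR_ge0.
  have : b `^ (1/3) <= a `^ (1/3) + k.
    have b0 : 0 <= b by lra.
    rewrite -(@ler_pXn2r _ 3) ?nnegrE ?powR_ge0 ?addr_ge0// cbrtK//.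
    have := cbrtK (ltW a0); move: (a `^ (1/3)) c0 => u c0 u3.
    have : 0 <= u * k * (u + k) by rewrite !mulr_ge0 ?addr_ge0.
    rewrite hE in k3; rewrite (_ : (u + k) ^+ 3 = u ^+ 3 + k ^+ 3 + 3 * (u * k * (u + k))); last by ring.
    by rewrite u3 k3; lra.
  by rewrite rE /rho in rk; rewrite /rho; lra.
have two (x : R) : a <= x <= b -> `|f x| <= C * (2 * k `^ (1/2)).
  move=> xI; apply: (le_trans (hb x xI).1); rewrite ler_wpM2l//.
  have x0 : 0 < x by lra.
  apply: (@le_trans _ _ ((2 * k) `^ (1/2))).
    apply: ge0_ler_powR; rewrite ?nnegrE ?(ltW (rho_gt0 _ _))//; first lra.
    by apply: le_trans rb; apply: ler_rho => //; case/andP: xI.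
  rewrite powRM// ler_wpM2r ?powR_ge0// -[leRHS](powRr1 (_ : 0 <= 2))//.
  by apply: ler_powR; lra.
apply: (le_trans (ler_normB _ _)).
have t1 : `|f a| <= C * (2 * k `^ (1/2)) by apply: two; lra.
have t2 : `|f b| <= C * (2 * k `^ (1/2)) by apply: two; lra.
suff : k `^ (1/2) <= `|a - b| `^ th * r `^ (- (3 * th - 1/2)) by move=> q; have := ler_wpM2l C0 q; lra.
rewrite -k3 -(powR_mulrn 3 kn) -powRrM.
rewrite (_ : 1/2 = 3%:R * th + - (3 * th - 1/2)); last by ring.
rewrite powRD ?(gt_eqF k0) ?implybT// ler_wpM2l ?powR_ge0//.
by rewrite subKr; apply: ler_powRN => //; lra.
Qed.

End HoelderEstimates.

(** * The singular function and its derivatives *)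

Section SingularFunction.
Context {R : realType}.

Lemma Cinf2_continuous (F : R * R -> R) (s : seq bool) : Cinf2 F -> continuous (Defs.iterD s F).
Proof. by move=> hF p; have [_ []] := hF s p. Qed.

(** [Cinf2] speaks of directional derivatives in the plane; the difference quotient of a slice is
    the same function of the increment. *)
Lemma is_derive_slice_z (F : R * R -> R) (s : seq bool) (x z : R) : Cinf2 F ->
  is_derive z (1 : R) (fun z => Defs.iterD s F (x, z)) (Defs.iterD (true :: s) F (x, z)).
Proof.
move=> hF; have [_ [h _]] := hF s (x, z).
have E : (fun h : R => h^-1 *: (((fun z => Defs.iterD s F (x, z)) \o shift z) (h *: (1 : R)) - Defs.iterD s F (x, z))) =
    (fun h : R => h^-1 *: ((Defs.iterD s F \o shift (x, z)) (h *: dir2 R true) - Defs.iterD s F (x, z))).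
  apply/funext => t /=; congr (_ *: (Defs.iterD s F _ - _)).
  by congr pair; rewrite /= scaler0 add0r.
apply: DeriveDef; first by rewrite /derivable E; exact: h.
by rewrite /derive E.
Qed.

Lemma is_derive_slice_x (F : R * R -> R) (s : seq bool) (x z : R) : Cinf2 F ->
  is_derive x (1 : R) (fun x => Defs.iterD s F (x, z)) (Defs.iterD (false :: s) F (x, z)).
Proof.
move=> hF; have [h _] := hF s (x, z).
have E : (fun h : R => h^-1 *: (((fun x => Defs.iterD s F (x, z)) \o shift x) (h *: (1 : R)) - Defs.iterD s F (x, z))) =
    (fun h : R => h^-1 *: ((Defs.iterD s F \o shift (x, z)) (h *: dir2 R false) - Defs.iterD s F (x, z))).
  apply/funext => t /=; congr (_ *: (Defs.iterD s F _ - _)).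
  by congr pair; rewrite /= scaler0 add0r.
apply: DeriveDef; first by rewrite /derivable E; exact: h.
by rewrite /derive E.
Qed.

Lemma continuous_bounded_rect (F : R * R -> R) (x0 x1 : R) : continuous F ->
  exists B : R, 0 <= B /\ forall p, Omega_bar x0 x1 p -> `|F p| <= B.
Proof.
move=> cF.
have cK : compact (`[x0, x1]%classic `*` `[(-1 : R), 1]%classic).
  by apply: compact_setX; exact: segment_compact.
have : bounded_set (F @` (`[x0, x1]%classic `*` `[(-1 : R), 1]%classic)).
  by apply: compact_bounded; apply: continuous_compact => //; exact: continuous_subspaceT.
move=> [M [_ hM]]; exists (`|M| + 1); split; first by rewrite addr_ge0.
move=> p [h1 h2]; apply: (hM (`|M| + 1)); first by rewrite (le_lt_trans (ler_norm _))// ltrDl.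
by exists p => //; split; rewrite /= in_itv.
Qed.

(** Homogeneous of degree 3 e under (d, z) -> (l^3 d, l z): a derivative in z lowers e by 1/3, a
    derivative in d lowers it by 1. *)
Definition Uf (e : R) (g : R -> R) (d z : R) : R := d `^ e * g (z * d `^ (- (1/3))).

Lemma is_derive_Uf_z (e : R) (g g1 : R -> R) (d z : R) : 0 < d ->
  (forall t : R, is_derive t (1 : R) g (g1 t)) ->
  is_derive z (1 : R) (Uf e g d) (Uf (e - 1/3) g1 d z).
Proof.
move=> d0 hg.
have hl : is_derive z (1 : R) (fun z => z * d `^ (- (1/3))) (d `^ (- (1/3))).
  by apply: is_derive_eq; rewrite /GRing.scale /=; ring.
have := @is_derive1_comp _ g (fun z => z * d `^ (- (1/3))) z _ _ (hg _) hl; rewrite /comp => hc.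
rewrite /Uf; apply: is_derive_eq; rewrite /GRing.scale /= powRD ?(gt_eqF d0) ?implybT//; ring.
Qed.

Lemma is_derive_Uf_d (g g1 : R -> R) (d z : R) : 0 < d ->
  (forall t : R, is_derive t (1 : R) g (g1 t)) ->
  is_derive d (1 : R) (fun d => Uf (1/6) g d z)
    (Uf (- (5/6)) (fun t => (g t - 2 * t * g1 t) / 6) d z).
Proof.
move=> d0 hg; have nd : (d == 0) = false by rewrite gt_eqF.
have dp := is_derive_powR (- (1/3)) d0; have dq := is_derive_powR (1/6) d0.
have hl : is_derive d (1 : R) (fun d => z * d `^ (- (1/3))) (z * (- (1/3) * d `^ (- (1/3) - 1))).
  by apply: is_derive_eq; rewrite /GRing.scale /=; ring.
have := @is_derive1_comp _ g (fun d => z * d `^ (- (1/3))) d _ _ (hg _) hl; rewrite /comp => hc.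
rewrite /Uf; apply: is_derive_eq; rewrite /GRing.scale /=.
have e1 : d `^ (1/6 - 1) = d `^ (- (5/6)) by congr (_ `^ _); field.
have e2 : d `^ (1/6) * d `^ (- (1/3) - 1) = d `^ (- (5/6)) * d `^ (- (1/3)).
  by rewrite -!powRD ?nd ?implybT//; congr (_ `^ _); field.
rewrite e1; move: e2.
move: (d `^ (1/6)) (d `^ (- (1/3) - 1)) (d `^ (- (5/6))) (d `^ (- (1/3))) => A B C D e2.
move: (g1 _) (g _) => X Y.
transitivity (C * (1/6) * Y - 1/3 * z * X * (A * B)); first by ring.
by rewrite e2; field.
Qed.

(** For t = z d^(-1/3) one has 1 + |t| = rho d^(-1/3), so growth of the profile translates into
    homogeneity in rho. *)
Lemma Uf_le (e p C : R) (g : R -> R) (d z : R) : 0 < d -> p = 3 * e ->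
  (forall t, `|g t| <= C * (1 + `|t|) `^ p) -> `|Uf e g d z| <= C * rho d z `^ p.
Proof.
move=> d0 pe hg; rewrite /Uf normrM ger0_norm ?powR_ge0//.
have dp : 0 < d `^ (1/3) by exact: powR_gt0.
set t := z * _; have tE : 1 + `|t| = rho d z * d `^ (- (1/3)).
  rewrite /t /rho normrM [in LHS](ger0_norm (powR_ge0 _ _)) mulrDl powRN mulfV ?gt_eqF// addrC//.
have -> : rho d z `^ p = d `^ e * (1 + `|t|) `^ p.
  rewrite tE powRM ?powR_ge0 ?(ltW (rho_gt0 _ _))// mulrCA -powRrM -powRD ?(gt_eqF d0) ?implybT//.
  by rewrite pe (_ : e + _ = 0) ?powRr0 ?mulr1//; field.
by rewrite mulrCA ler_wpM2l ?powR_ge0.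
Qed.

(** These are the Leibniz expansions of the successive z-derivatives of a product with [F], which is
    to be the smooth extension of the cut-off to the plane. *)
Definition Vf0 (g : R -> R) (F : R * R -> R) (xc x z : R) : R :=
  Uf (1/6) g `|x - xc| z * F (x, z).
Definition Vf1 (g g1 : R -> R) (F : R * R -> R) (xc x z : R) : R :=
  Uf (- (1/6)) g1 `|x - xc| z * F (x, z) + Uf (1/6) g `|x - xc| z * Defs.iterD [:: true] F (x, z).
Definition Vf2 (g g1 g2 : R -> R) (F : R * R -> R) (xc x z : R) : R :=
  Uf (- (1/2)) g2 `|x - xc| z * F (x, z) + 2 * (Uf (- (1/6)) g1 `|x - xc| z * Defs.iterD [:: true] F (x, z))
  + Uf (1/6) g `|x - xc| z * Defs.iterD [:: true; true] F (x, z).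
Definition Vf3 (g g1 g2 g3 : R -> R) (F : R * R -> R) (xc x z : R) : R :=
  Uf (- (5/6)) g3 `|x - xc| z * F (x, z) + 3 * (Uf (- (1/2)) g2 `|x - xc| z * Defs.iterD [:: true] F (x, z))
  + 3 * (Uf (- (1/6)) g1 `|x - xc| z * Defs.iterD [:: true; true] F (x, z))
  + Uf (1/6) g `|x - xc| z * Defs.iterD [:: true; true; true] F (x, z).

Lemma is_derive_Vf (g g1 g2 g3 : R -> R) (C : R) (F : R * R -> R) (xc x z : R) :
  profile_bounds g g1 g2 g3 C -> Cinf2 F -> x != xc ->
  [/\ is_derive z (1 : R) (Vf0 g F xc x) (Vf1 g g1 F xc x z),
    is_derive z (1 : R) (Vf1 g g1 F xc x) (Vf2 g g1 g2 F xc x z) &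
    is_derive z (1 : R) (Vf2 g g1 g2 F xc x) (Vf3 g g1 g2 g3 F xc x z)].
Proof.
move=> [C0 [hg [hg1 [hg2 _]]]] hF xxc.
have d0 : 0 < `|x - xc| by rewrite normr_gt0 subr_eq0.
have u0 : is_derive z (1 : R) (Uf (1/6) g `|x - xc|) (Uf (- (1/6)) g1 `|x - xc| z).
  rewrite (_ : - (1/6) = 1/6 - 1/3); [exact: is_derive_Uf_z|by field].
have u1 : is_derive z (1 : R) (Uf (- (1/6)) g1 `|x - xc|) (Uf (- (1/2)) g2 `|x - xc| z).
  rewrite (_ : - (1/2) = - (1/6) - 1/3); [exact: is_derive_Uf_z|by field].
have u2 : is_derive z (1 : R) (Uf (- (1/2)) g2 `|x - xc|) (Uf (- (5/6)) g3 `|x - xc| z).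
  rewrite (_ : - (5/6) = - (1/2) - 1/3); [exact: is_derive_Uf_z|by field].
have f0 := is_derive_slice_z [::] x z hF; have f1 := is_derive_slice_z [:: true] x z hF.
have f2 := is_derive_slice_z [:: true; true] x z hF.
rewrite /Vf0 /Vf1 /Vf2 /Vf3.
move: (Uf (1/6) g `|x - xc|) (Uf (- (1/6)) g1 `|x - xc|) (Uf (- (1/2)) g2 `|x - xc|) (Uf (- (5/6)) g3 `|x - xc| z) u0 u1 u2 => U0 U1 U2 U3 u0 u1 u2.
move: f0 f1 f2; rewrite [Defs.iterD [::] F]/=.
move: (Defs.iterD [:: true] F) (Defs.iterD [:: true; true] F) (Defs.iterD [:: true; true; true] F) => F1 F2 F3 f0 f1 f2.
by split; apply: is_derive_eq; rewrite /GRing.scale /=; ring.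
Qed.

Lemma Vf_bounds (g g1 g2 g3 : R -> R) (C : R) (F : R * R -> R) (x0 x1 xc : R) :
  profile_bounds g g1 g2 g3 C -> Cinf2 F -> x0 < x1 -> xc = x0 \/ xc = x1 ->
  exists K : R, 0 <= K /\
  (forall x z : R, x0 < x < x1 -> -1 <= z <= 1 ->
    [/\ `|Vf0 g F xc x z| <= K * rho `|x - xc| z `^ (1/2),
      `|Vf1 g g1 F xc x z| <= K * rho `|x - xc| z `^ (- (1/2)),
      `|Vf2 g g1 g2 F xc x z| <= K * rho `|x - xc| z `^ (- (3/2)) &
      `|Vf3 g g1 g2 g3 F xc x z| <= K * rho `|x - xc| z `^ (- (5/2))]) /\
  (forall x z : R, x0 < x < x1 -> -1 <= z <= 1 ->
    `|Uf (- (5/6)) (fun t => (g t - 2 * t * g1 t) / 6) `|x - xc| z * F (x, z)|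
     + `|Uf (1/6) g `|x - xc| z * Defs.iterD [:: false] F (x, z)| <= K * rho `|x - xc| z `^ (- (5/2))).
Proof.
move=> [C0 [hg [hg1 [hg2 [_ hb]]]]] hF x01 hxc.
have [B0 [B00 hB0]] := continuous_bounded_rect x0 x1 (Cinf2_continuous (s := [::]) hF).
have [B1 [B10 hB1]] := continuous_bounded_rect x0 x1 (Cinf2_continuous (s := [:: true]) hF).
have [B2 [B20 hB2]] := continuous_bounded_rect x0 x1 (Cinf2_continuous (s := [:: true; true]) hF).
have [B3 [B30 hB3]] := continuous_bounded_rect x0 x1 (Cinf2_continuous (s := [:: true; true; true]) hF).
have [B4 [B40 hB4]] := continuous_bounded_rect x0 x1 (Cinf2_continuous (s := [:: false]) hF).
pose B := B0 + B1 + B2 + B3 + B4; pose P : R := 1 + (x1 - x0) `^ (1/3).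
have P1 : 1 <= P by rewrite lerDl powR_ge0.
have B_ge0 : 0 <= B by rewrite /B; lra.
(* [C] bounds the profile and [B] the derivatives of [F]. The Leibniz sum of order k is at most (1 +
   rho)^k times its most singular term, and 1 + rho <= 2 P with (2 P)^3 = 8 P^3. *)
exists (C * B * (8 * P ^+ 3)); split.
  by apply: mulr_ge0; [exact: mulr_ge0|apply: mulr_ge0 => //; apply: exprn_ge0; lra].
have BE : [/\ B0 <= B, B1 <= B, B2 <= B, B3 <= B & B4 <= B] by rewrite /B; split; lra.
have main (x z : R) : x0 < x < x1 -> -1 <= z <= 1 -> exists r a : R, [/\ 0 < a, 0 < r & r <= P] /\
    [/\ rho `|x - xc| z `^ (1/2) = r ^+ 3 * a, rho `|x - xc| z `^ (- (1/2)) = r ^+ 2 * a,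
      rho `|x - xc| z `^ (- (3/2)) = r * a & rho `|x - xc| z `^ (- (5/2)) = a] /\
    [/\ `|Uf (1/6) g `|x - xc| z| <= C * (r ^+ 3 * a),
     `|Uf (- (1/6)) g1 `|x - xc| z| <= C * (r ^+ 2 * a),
     `|Uf (- (1/2)) g2 `|x - xc| z| <= C * (r * a),
     `|Uf (- (5/6)) g3 `|x - xc| z| <= C * a &
     `|Uf (- (5/6)) (fun t => (g t - 2 * t * g1 t) / 6) `|x - xc| z| <= C * a] /\
    [/\ `|F (x, z)| <= B, `|Defs.iterD [:: true] F (x, z)| <= B,
      `|Defs.iterD [:: true; true] F (x, z)| <= B, `|Defs.iterD [:: true; true; true] F (x, z)| <= B
     & `|Defs.iterD [:: false] F (x, z)| <= B].
  move=> xI zI; have d0 : 0 < `|x - xc|.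
    by rewrite normr_gt0 subr_eq0; case: hxc => ->; apply/eqP => e; move: xI; rewrite e ltxx ?andbF.
  have dL : `|x - xc| <= x1 - x0.
    by case/andP: xI => ? ?; case: hxc => ->; [rewrite ger0_norm|rewrite ler0_norm]; lra.
  have r0 := rho_gt0 z d0; have rn : (rho `|x - xc| z == 0) = false by rewrite gt_eqF.
  have pe (p : R) (n : nat) : p = n%:R - 5/2 -> rho `|x - xc| z `^ p = rho `|x - xc| z ^+ n * rho `|x - xc| z `^ (- (5/2)).
    by move=> ->; rewrite powRD ?rn ?implybT// powR_mulrn// ltW.
  have e3 := pe (1/2) 3%N ltac:(lra); have e2 := pe (- (1/2)) 2%N ltac:(lra).
  have e1 := pe (- (3/2)) 1%N ltac:(lra); rewrite expr1 in e1.
  exists (rho `|x - xc| z), (rho `|x - xc| z `^ (- (5/2))); split.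
    split=> //; first exact: powR_gt0.
    rewrite /rho /P; apply: lerD; first by rewrite ler_norml.
    by apply: ge0_ler_powR; rewrite ?nnegrE//; lra.
  split=> //; split.
    split.
    - by rewrite -e3; apply: Uf_le => //; [field|move=> t; have [] := hb t].
    - by rewrite -e2; apply: Uf_le => //; [field|move=> t; have [] := hb t].
    - by rewrite -e1; apply: Uf_le => //; [field|move=> t; have [] := hb t].
    - by apply: Uf_le => //; [field|move=> t; have [] := hb t].
    - apply: Uf_le => //; first by field.
      move=> t; have [_ _ _ _ h] := hb t; rewrite normrM normfV (ger0_norm (_ : 0 <= 6))//.
      by apply: le_trans h; rewrite ler_pdivrMr// ler_peMr//; lra.
  have O : Omega_bar x0 x1 (x, z) by split=> //=; case/andP: xI => /ltW -> /ltW ->.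
  have [q0 q1 q2 q3 q4] := BE.
  split; [apply: le_trans q0|apply: le_trans q1|apply: le_trans q2|apply: le_trans q3|apply: le_trans q4].
  - exact: hB0.
  - exact: hB1.
  - exact: hB2.
  - exact: hB3.
  - exact: hB4.
have CB : 0 <= C * B by exact: mulr_ge0.
clearbody B P; clear hB0 hB1 hB2 hB3 hB4 BE hb hg hg1 hg2.
have pb (u f w : R) : `|u| <= C * w -> `|f| <= B -> `|u * f| <= C * B * w.
  by move=> hu hf; rewrite normrM mulrAC ler_pM.
have poly (r : R) (n : nat) : 0 < r -> r <= P -> (n <= 3)%N -> (1 + r) ^+ n <= 8 * P ^+ 3.
  move=> r0 rP n3; rewrite (_ : 8 * P ^+ 3 = (2 * P) ^+ 3); last by ring.
  apply: (@le_trans _ _ ((2 * P) ^+ n)); last by apply: ler_weXn2l => //; lra.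
  by apply: lerXn2r; rewrite ?nnegrE; lra.
split=> x z xI zI.
  have [r [a [[a0 r0 rP] [[-> -> -> ->] [[u0 u1 u2 u3 _] [f0 f1 f2 f3 _]]]]]] := main x z xI zI.
  have Q (n m : nat) : (n <= 3)%N -> C * B * ((1 + r) ^+ n * (r ^+ m * a)) <= C * B * (8 * P ^+ 3) * (r ^+ m * a).
    move=> n3; rewrite -[leRHS]mulrA; apply: ler_wpM2l => //; apply: ler_wpM2r; last exact: poly.
    by apply: mulr_ge0; [apply: exprn_ge0|]; exact: ltW.
  have := And4 (Q 0%N 3%N isT) (Q 1%N 2%N isT) (Q 2%N 1%N isT) (Q 3%N 0%N isT).
  rewrite expr0 !mul1r !expr1 => -[Q0 Q1 Q2 Q3].
  split.
  - by apply: le_trans Q0; exact: pb.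
  - apply: le_trans Q1; apply: (le_trans (ler_normD _ _)).
    have := pb _ _ _ u1 f0; have := pb _ _ _ u0 f1; clear -CB; lra.
  - apply: le_trans Q2; apply: (le_trans (ler_normD _ _)).
    have := pb _ _ _ u0 f2; have := pb _ _ _ u1 f1; have := pb _ _ _ u2 f0.
    have := ler_normD (Uf (- (1/2)) g2 `|x - xc| z * F (x, z)) (2 * (Uf (- (1/6)) g1 `|x - xc| z * Defs.iterD [:: true] F (x, z))).
    rewrite [`|2 * _|]normrM (ger0_norm (_ : 0 <= 2))//; clear -CB; lra.
  - apply: le_trans Q3; apply: (le_trans (ler_normD _ _)).
    have := pb _ _ _ u0 f3; have := pb _ _ _ u1 f2; have := pb _ _ _ u2 f1; have := pb _ _ _ u3 f0.
    move: (Uf (- (5/6)) g3 `|x - xc| z * F (x, z)) (Uf (- (1/2)) g2 `|x - xc| z * Defs.iterD [:: true] F (x, z)) (Uf (- (1/6)) g1 `|x - xc| z * Defs.iterD [:: true; true] F (x, z)) => X Y Z.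
    have := ler_normD (X + 3 * Y) (3 * Z); have := ler_normD X (3 * Y).
    rewrite ![`|3 * _|]normrM (ger0_norm (_ : 0 <= 3))//; clear -CB; lra.
have [r [a [[a0 r0 rP] [[_ _ _ ->] [[u0 _ _ _ u4] [f0 _ _ _ f4]]]]]] := main x z xI zI.
have h1 := pb _ _ _ u4 f0; have h2 := pb _ _ _ u0 f4.
have : C * B * (1 + r) ^+ 3 * a <= C * B * (8 * P ^+ 3) * a.
  by apply: ler_wpM2r; [exact: ltW|apply: ler_wpM2l => //; exact: poly].
(* These are the terms missing between 1 + r^3 and (1 + r)^3. *)
have : 0 <= C * B * ((3 * r + 3 * r ^+ 2) * a).
  by apply: mulr_ge0 => //; apply: mulr_ge0; [|exact: ltW]; have := sqr_ge0 r; lra.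
lra.
Qed.

End SingularFunction.

(** * Reflection, measurability and weak derivatives *)

Section WeakDerivatives.
Context {R : realType}.
Notation mu := (@lebesgue_measure R).

(** At the right endpoint the profile is taken at -t. The bounds are even in t, so they survive the
    reflection. *)
Lemma profile_bounds_sign (e : R) (g g1 g2 g3 : R -> R) (C : R) : e ^+ 2 = 1 ->
  profile_bounds g g1 g2 g3 C ->
  profile_bounds (fun t => g (e * t)) (fun t => e * g1 (e * t)) (fun t => g2 (e * t))
    (fun t => e * g3 (e * t)) C.
Proof.
move=> e2 [C0 [hg [hg1 [hg2 [cg3 hb]]]]].
have ne : `|e| = 1 by apply/eqP; rewrite -sqrp_eq1 ?normr_ge0// -normrX e2 normr1.
have hl (t : R) : is_derive t (1 : R) (fun t => e * t) e.
  by apply: is_derive_eq; rewrite /GRing.scale /=; ring.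
have hc (h h1 : R -> R) (t : R) : (forall t : R, is_derive t (1 : R) h (h1 t)) ->
    is_derive t (1 : R) (fun t => h (e * t)) (e * h1 (e * t)).
  move=> hh; have := @is_derive1_comp _ h (fun t => e * t) t _ _ (hh _) (hl t); rewrite /comp => hc.
  by apply: (is_derive_eq hc); rewrite mulrC.
split=> //; split; first by move=> t; exact: hc.
split.
  move=> t; have k := hc _ _ t hg1; apply: is_derive_eq; rewrite /GRing.scale /=.
  by rewrite mulrA -expr2 e2 mul1r.
split; first by move=> t; exact: hc.
split.
  move=> t; apply: continuousM; first exact: cst_continuous.
  by apply: continuous_comp; [exact: is_derive_continuous (hl t)|exact: cg3].
move=> t; have := hb (e * t); rewrite !normrM ne !mul1r => -[h1 h2 h3 h4 h5]; split=> //.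
by rewrite (_ : 2 * t * (e * g1 (e * t)) = 2 * (e * t) * g1 (e * t)) //; ring.
Qed.

Lemma measurable_Uf (e xc : R) (g : R -> R) (D : set (R * R)) : measurable D -> continuous g ->
  measurable_fun D (fun p : R * R => Uf e g `|p.1 - xc| p.2).
Proof.
move=> mD cg; apply: (measurable_funS measurableT) => //.
have md : measurable_fun [set: R * R] (fun p : R * R => `|p.1 - xc|).
  by apply: measurable_fun_abs; apply: measurable_funB => //; exact: measurable_fst.
apply: measurable_funM; first exact: measurable_fun_powR.
have mg : measurable_fun [set: R] g by exact: continuous_measurable_fun.
apply: (measurableT_comp mg); apply: measurable_funM; first exact: measurable_snd.
exact: measurable_fun_powR.
Qed.

Lemma measurable_Vf (g g1 g2 g3 : R -> R) (C : R) (F : R * R -> R) (xc x0 x1 : R) :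
  profile_bounds g g1 g2 g3 C -> Cinf2 F ->
  [/\ jmeas x0 x1 (Vf0 g F xc), jmeas x0 x1 (Vf1 g g1 F xc) & jmeas x0 x1 (Vf2 g g1 g2 F xc)].
Proof.
move=> [_ [hg [hg1 [hg2 _]]]] hF.
have mO : measurable (Omega_open x0 x1) by apply: measurableX; exact: measurable_itv.
have mF s : measurable_fun (Omega_open x0 x1) (fun p : R * R => Defs.iterD s F (p.1, p.2)).
  have : measurable_fun (Omega_open x0 x1) (Defs.iterD s F).
    by apply: continuous_measurable_fun2 => //; exact: Cinf2_continuous.
  by apply: eq_measurable_fun => -[].
have c0 : continuous g by move=> t; exact: is_derive_continuous (hg t).
have c1 : continuous g1 by move=> t; exact: is_derive_continuous (hg1 t).
have c2 : continuous g2 by move=> t; exact: is_derive_continuous (hg2 t).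
have U0 := measurable_Uf (1/6) xc mO c0; have U1 := measurable_Uf (- (1/6)) xc mO c1.
have U2 := measurable_Uf (- (1/2)) xc mO c2.
have F0 := mF [::]; have F1 := mF [:: true]; have F2 := mF [:: true; true].
split.
- exact: measurable_funM U0 F0.
- exact: measurable_funD (measurable_funM U1 F0) (measurable_funM U0 F1).
- apply: measurable_funD (measurable_funM U0 F2).
  apply: measurable_funD; first exact: measurable_funM U2 F0.
  by apply: measurable_funM => //; exact: measurable_funM U1 F1.
Qed.

(** Integration by parts on [-1, 1]; the boundary terms vanish because a test function is zero at
    both ends. *)
Lemma weak_deriv_C1 (f g : R -> R) : (forall z : R, is_derive z (1 : R) f (g z)) ->
  continuous g -> weak_deriv (-1) 1 f g.
Proof.
move=> hf cg; have cf : continuous f by move=> t; exact: is_derive_continuous (hf t).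
have m11 : measurable (`](-1 : R), 1[%classic : set (measurableTypeR R)) by exact: measurable_itv.
have int (h : R -> R) : continuous h -> mu.-integrable `]-1, 1[ (EFin \o h).
  move=> ch; apply: (@integrableS _ _ _ mu `[(-1 : R), 1]%classic) => //.
    by move=> x /=; rewrite !in_itv /= => /andP[/ltW -> /ltW ->].
  by apply: continuous_compact_integrable; [exact: segment_compact|exact: continuous_subspaceT].
split; first exact: int.
split; first exact: int.
move=> phi [dphi [c' [d' [[cc [cd dd]] hphi]]]].
have dp (t : R) : is_derive t (1 : R) phi (derive1 phi t).
  by apply: DeriveDef; [exact: (dphi 0%N t)|rewrite derive1E].
have cp : continuous phi by move=> t; exact: is_derive_continuous (dp t).
have cdp : continuous (derive1 phi).
  by move=> t; apply/differentiable_continuous/derivable1_diffP; exact: (dphi 1%N t).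
have p1 : phi 1 = 0 by apply: hphi => /andP[_ h]; lra.
have pm1 : phi (-1) = 0 by apply: hphi => /andP[h _]; lra.
have lr (h dh : R -> R) : (forall t : R, is_derive t (1 : R) h (dh t)) -> derivable_oo_LRcontinuous h (-1) 1.
  move=> hh; split.
  - by move=> t _; case: (hh t).
  - by apply: cvg_at_right_filter; exact: is_derive_continuous (hh (-1)).
  - by apply: cvg_at_left_filter; exact: is_derive_continuous (hh 1).
have oc (h : R -> R) : continuous h -> \int[mu]_(t in `](-1 : R), 1[) h t = \int[mu]_(t in `[(-1 : R), 1]) h t.
  move=> ch; rewrite /Rintegral [in RHS]integral_itv_bndoo//.
  by apply/measurable_EFinP; apply: measurable_funTS; exact: continuous_measurable_fun.
rewrite /leb oc; last by move=> t; apply: continuousM; [exact: cf|exact: cdp].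
rewrite oc; last by move=> t; apply: continuousM; [exact: cg|exact: cp].
rewrite (@Rintegration_by_parts _ f phi g (derive1 phi)).
- by rewrite p1 pm1 !mulr0 subrr sub0r.
- lra.
- exact: continuous_subspaceT.
- exact: lr hf.
- by move=> t _; rewrite derive1E; case: (hf t).
- exact: continuous_subspaceT.
- exact: lr dp.
- by [].
Qed.

Lemma weak_deriv_ext (f f' g : R -> R) : (forall z, -1 < z < 1 -> f z = f' z) ->
  weak_deriv (-1) 1 f' g -> weak_deriv (-1) 1 f g.
Proof.
move=> ff [i1 [i2 h]].
have E z : z \in `](-1 : R), 1[%classic -> f' z = f z.
  by rewrite inE /= in_itv /= => zI; rewrite ff.
split; first by apply: eq_integrable i1 => // z zI; rewrite /= E.
split=> // phi hphi; rewrite -h//; apply: eq_Rintegral => z zI.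
by rewrite E.
Qed.

End WeakDerivatives.

(** * Sobolev regularity *)

Section SobolevRegularity.
Context {R : realType}.
Notation mu := (@lebesgue_measure R).

Lemma Vf0_hoelder (g g1 g2 g3 : R -> R) (C K : R) (F : R * R -> R) (x0 x1 xc th : R) :
  profile_bounds g g1 g2 g3 C -> Cinf2 F -> x0 < x1 -> xc = x0 \/ xc = x1 -> 0 <= K ->
  (forall x z : R, x0 < x < x1 -> -1 <= z <= 1 ->
    `|Vf0 g F xc x z| <= K * rho `|x - xc| z `^ (1/2)) ->
  (forall x z : R, x0 < x < x1 -> -1 <= z <= 1 ->
    `|Uf (- (5/6)) (fun t => (g t - 2 * t * g1 t) / 6) `|x - xc| z * F (x, z)|
     + `|Uf (1/6) g `|x - xc| z * Defs.iterD [:: false] F (x, z)| <= K * rho `|x - xc| z `^ (- (5/2))) ->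
  1/6 <= th <= 1 -> forall x y z : R, x0 < x < x1 -> x0 < y < x1 -> -1 <= z <= 1 ->
  `|x - xc| < `|y - xc| ->
  `|Vf0 g F xc x z - Vf0 g F xc y z| <=
    4 * K * (`|x - y| `^ th * rho `|x - xc| z `^ (- (3 * th - 1/2))).
Proof.
move=> [C0 [hg _]] hF x01 hxc K0 b0 bx hth x y z xI yI zI dxy.
have [e [e2 ne hd]] : exists e : R, [/\ e ^+ 2 = 1, `|e| = 1 & forall x, x0 < x < x1 -> `|x - xc| = e * (x - xc)].
  case: hxc => ->; [exists 1|exists (-1)]; rewrite ?normrN normr1; split=> //; try ring.
  - by move=> t /andP[? ?]; rewrite mul1r ger0_norm; lra.
  - by move=> t /andP[? ?]; rewrite mulN1r ler0_norm; lra.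
(* As [xc] is an endpoint, the distance to it is affine on the interval and [p] inverts it;
   [hoelder_d] then applies between the two distances. *)
pose p (d : R) : R := xc + e * d.
have pd t : x0 < t < x1 -> p `|t - xc| = t by move=> tI; rewrite /p hd// mulrA -expr2 e2; ring.
have dp (d : R) : 0 < d -> `|p d - xc| = d by move=> d0; rewrite /p addrC addKr normrM ne mul1r gtr0_norm.
have x'I (d : R) : `|x - xc| <= d <= `|y - xc| -> x0 < p d < x1.
  move=> /andP[]; rewrite !hd// /p; move: xI yI => /andP[x_0 x_1] /andP[y_0 y_1].
  have [->|->] : e = 1 \/ e = -1.
    by move/eqP: e2; rewrite -subr_eq0 subr_sqr_1 mulf_eq0 subr_eq0 addr_eq0 => /orP[] /eqP; [left|right].
  - by rewrite !mul1r => ? ?; apply/andP; split; lra.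
  - by rewrite !mulN1r => ? ?; apply/andP; split; lra.
have d0 : 0 < `|x - xc|.
  by rewrite normr_gt0 subr_eq0; case: hxc => ->; apply/eqP => eq; move: xI; rewrite eq ltxx ?andbF.
have xy : `|x - y| = `| `|x - xc| - `|y - xc| |.
  by rewrite !hd// -mulrBr normrM ne mul1r; congr `|_|; ring.
rewrite xy -[in Vf0 g F xc x z](pd x xI) -[in Vf0 g F xc y z](pd y yI).
pose f (d : R) := Uf (1/6) g d z * F (p d, z).
have fE (d : R) : 0 < d -> Vf0 g F xc (p d) z = f d by move=> dd; rewrite /Vf0 dp.
rewrite !fE//; last exact: lt_trans dxy.
apply: (@hoelder_d _ f (fun d => Uf (- (5/6)) (fun t => (g t - 2 * t * g1 t) / 6) d z * F (p d, z)
   + e * (Uf (1/6) g d z * Defs.iterD [:: false] F (p d, z)))) => //.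
- move=> d /andP[dl _]; have dd : 0 < d by exact: lt_le_trans dl.
  have u := @is_derive_Uf_d _ g g1 d z dd hg.
  have hl : is_derive d (1 : R) p e.
    by rewrite /p; apply: is_derive_eq; rewrite /GRing.scale /=; ring.
  have := @is_derive1_comp _ (fun x => F (x, z)) p d _ _ (is_derive_slice_x [::] (p d) z hF) hl; rewrite /comp => hc.
  by rewrite /f; apply: is_derive_eq; rewrite /GRing.scale /=; ring.
- move=> d dI; have dd : 0 < d by case/andP: dI => dl _; exact: lt_le_trans dl.
  split; first by rewrite -fE// -{2}(dp d dd); apply: b0 => //; exact: x'I.
  apply: (le_trans (ler_normD _ _)); rewrite [`|e * _|]normrM ne [X in _ + X <= _]mul1r.
  by have := bx (p d) z (x'I d dI) zI; rewrite dp.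
Qed.

Lemma sqr_powRN (r p : R) : 0 < r -> (r `^ (- p)) ^+ 2 = r `^ (- (2 * p)).
Proof. by move=> r0; rewrite -powR_mulrn ?powR_ge0// -powRrM; congr (_ `^ _); ring. Qed.

Lemma ler_sqr_norm (a b : R) : `|a| <= b -> a ^+ 2 <= b ^+ 2.
Proof.
by move=> ab; rewrite -[leLHS]real_normK ?num_real// lerXn2r ?nnegrE// (le_trans _ ab).
Qed.

(** The choice th > sigma makes the power of |z - w| integrable at the diagonal, and th < 1/2 makes
    (3 + 2 th)/4 < 1, so that the weights in z and in d are integrable too. The constant 128 is 8^2
    times the 2 of (A + B)^2 <= 2 (A^2 + B^2). *)
Lemma gagliardo_le (f df : R -> R) (d K sigma th : R) : 0 < d -> 0 <= K ->
  0 < sigma -> sigma < th < 1/2 ->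
  (forall z : R, is_derive z (1 : R) f (df z)) ->
  (forall z : R, -1 <= z <= 1 -> `|f z| <= K * rho d z `^ (- (3/2)) /\
     `|df z| <= K * rho d z `^ (- (5/2))) ->
  (gagliardo (-1) 1 sigma f <= (128 * K ^+ 2 * d `^ (- ((3 + 2 * th) / 4)) *
     (5 * pow_cst (-1) 1 ((3 + 2 * th) / 4) * pow_cst (-1) 1 (1 + 2 * sigma - 2 * th)))%:E)%E.
Proof.
move=> d0 K0 s0 /andP[sth th2] hf hb.
have e0 : 0 < d `^ (1/3) by exact: powR_gt0.
set q := (3 + 2 * th) / 4; set be := 1 + 2 * sigma - 2 * th.
have hq : 0 <= q < 1 by rewrite /q; apply/andP; split; lra.
have hbe : 0 <= be < 1 by rewrite /be; apply/andP; split; lra.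
rewrite /gagliardo /leb.
apply: (@double_integral_le _ (-1) 1 0 q be) => //.
- lra.
- by rewrite !mulr_ge0 ?sqr_ge0 ?powR_ge0.
- by move=> z w _ _; rewrite lee_fin divr_ge0 ?sqr_ge0 ?powR_ge0.
move=> z w zI wI z0 w0 zw; rewrite lee_fin !subr0.
have h0 : 0 < `|z - w| by rewrite normr_gt0 subr_eq0.
have zI' : -1 <= z <= 1 by case/andP: zI => /ltW -> /ltW ->.
have wI' : -1 <= w <= 1 by case/andP: wI => /ltW -> /ltW ->.
have := @hoelder_z _ f df (d `^ (1/3)) K th e0 K0 ltac:(lra) hf hb z w zI' wI' zw.
rewrite -!/(rho d _) => /ler_sqr_norm.
rewrite !exprMn -[in X in _ <= X -> _](powR_mulrn 2 (powR_ge0 `|z - w| th)) -powRrM.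
have zb := @rho_powRN_le _ d z (3 + 2 * th) d0 z0 ltac:(lra).
have wb := @rho_powRN_le _ d w (3 + 2 * th) d0 w0 ltac:(lra).
have rz := rho_gt0 z d0; have rw := rho_gt0 w d0.
have ez : (rho d z `^ (- (3/2 + th))) ^+ 2 = rho d z `^ (- (3 + 2 * th)).
  by rewrite sqr_powRN//; congr (_ `^ _); field.
have ew : (rho d w `^ (- (3/2 + th))) ^+ 2 = rho d w `^ (- (3 + 2 * th)).
  by rewrite sqr_powRN//; congr (_ `^ _); field.
rewrite -/q in zb wb.
set D := d `^ (- q) in zb wb *; set Z := `|z| `^ (- q) in zb *; set W := `|w| `^ (- q) in wb *.
have eh : `|z - w| `^ (th * 2%:R) / `|z - w| `^ (1 + 2 * sigma) = `|z - w| `^ (- be).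
  by rewrite -powRN -powRD ?(gt_eqF h0) ?implybT//; congr (_ `^ _); rewrite /be; ring.
rewrite -eh (mulrA (Z + W)) (mulrA _ _ (_^-1)) => h.
rewrite ler_wpM2r ?invr_ge0 ?powR_ge0//; apply: (le_trans h).
have H0 : 0 <= `|z - w| `^ (th * 2%:R) by exact: powR_ge0.
move: (`|z - w| `^ (th * 2%:R)) H0 => H H0.
rewrite -ez in zb; rewrite -ew in wb.
move: (rho d z `^ (- (3/2 + th))) (rho d w `^ (- (3/2 + th))) zb wb => A B zb wb.
have AB : (A + B) ^+ 2 <= 2 * ((Z + W) * D) by have := sqr_ge0 (A - B); nra.
have := ler_wpM2l (mulr_ge0 (sqr_ge0 (8 * K)) H0) AB; clear; nra.
Qed.

Lemma integral_four_powR_lt (a b c k0 k1 k2 k3 q : R) : a < b -> a <= c <= b ->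
  0 <= q < 1 -> 0 <= k0 -> 0 <= k1 -> 0 <= k2 -> 0 <= k3 ->
  (\int[mu]_(x in `]a, b[) (k0 + k1 * `|x - c| `^ (- (1/4)) + k2 * `|x - c| `^ (- (3/4)) + k3 * `|x - c| `^ (- q))%:E < +oo)%E.
Proof.
move=> ab hc hq h0 h1 h2 h3.
have E x : (k0 + k1 * `|x - c| `^ (- (1/4)) + k2 * `|x - c| `^ (- (3/4)) + k3 * `|x - c| `^ (- q))%:E =
   ((k0 * `|x - c| `^ (- 0) + k1 * `|x - c| `^ (- (1/4)))%:E + (k2 * `|x - c| `^ (- (3/4)) + k3 * `|x - c| `^ (- q))%:E)%E.
  by rewrite -EFinD oppr0 powRr0 mulr1 addrA.
under eq_integral do rewrite E.
have m2 p r k l : measurable_fun (`]a, b[%classic : set (measurableTypeR R)) (fun x : R => (k * `|x - c| `^ (- p) + l * `|x - c| `^ (- r))%:E).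
  by apply/measurable_EFinP; apply: measurable_funD; apply: measurable_funM => //; exact: measurable_abs_powR.
rewrite ge0_integralD//=; last 2 first.
- by move=> x _; rewrite lee_fin addr_ge0 ?mulr_ge0 ?powR_ge0.
- by move=> x _; rewrite lee_fin addr_ge0 ?mulr_ge0 ?powR_ge0.
apply: lte_add_pinfty.
- by apply: (le_lt_trans (integral_two_powR_le ab hc hc _ _ h0 h1)); [lra|lra|exact: ltry].
- by apply: (le_lt_trans (integral_two_powR_le ab hc hc _ hq h2 h3)); [lra|exact: ltry].
Qed.

Lemma Vf_regularity (g g1 g2 g3 : R -> R) (C : R) (F : R * R -> R) (x0 x1 xc sigma : R) (u : R -> R -> R) :
  profile_bounds g g1 g2 g3 C -> Cinf2 F -> x0 < x1 -> xc = x0 \/ xc = x1 ->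
  0 <= sigma < 1/2 ->
  (forall x z : R, x0 < x < x1 -> -1 < z < 1 -> u x z = Vf0 g F xc x z) ->
  H_s_L2 x0 x1 ((2 + sigma) / 3) u /\ L2_H2s x0 x1 sigma u.
Proof.
move=> hp hF x01 hxc /andP[s0 s12] hu.
have [K [K0 [hb hx]]] := Vf_bounds hp hF x01 hxc.
have xcI : x0 <= xc <= x1 by case: hxc => ->; rewrite lexx ?andbT ltW.
have d0 x : x0 < x < x1 -> 0 < `|x - xc|.
  by move=> xI; rewrite normr_gt0 subr_eq0; case: hxc => ->; apply/eqP => eq; move: xI; rewrite eq ltxx ?andbF.
have nxc x : x0 < x < x1 -> x != xc by move=> /d0; rewrite normr_gt0 subr_eq0.
have cl (z : R) : -1 < z < 1 -> -1 <= z <= 1 by move=> /andP[/ltW -> /ltW ->].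
have [m0 m1 m2] := measurable_Vf xc x0 x1 hp hF.
have mu_ : jmeas x0 x1 u.
  apply: eq_measurable_fun m0 => -[x z]; rewrite inE => -[/=]; rewrite !in_itv /= => xI zI.
  by rewrite hu.
pose P : R := 1 + (x1 - x0) `^ (1/3).
have P1 : 1 <= P by rewrite lerDl powR_ge0.
have rP (x z : R) : x0 < x < x1 -> -1 <= z <= 1 -> rho `|x - xc| z <= P.
  move=> /andP[xa xb] zI; rewrite /rho /P; apply: lerD; first by rewrite ler_norml.
  apply: ge0_ler_powR; rewrite ?nnegrE//; [lra|].
  by case: hxc => ->; [rewrite ger0_norm|rewrite ler0_norm]; lra.
have L0 x : x0 < x < x1 -> (L2sq (-1) 1 (u x) <= (K ^+ 2 * P * pow_cst (-1) 1 0)%:E)%E.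
  move=> xI; apply: L2sq_le; [lra|by rewrite mulr_ge0 ?sqr_ge0//; lra|].
  move=> z zI z0; rewrite hu// oppr0 powRr0 mulr1.
  have [h _ _ _] := hb x z xI (cl z zI); apply: (le_trans (ler_sqr_norm h)).
  rewrite exprMn ler_wpM2l ?sqr_ge0// -powR_mulrn ?powR_ge0// -powRrM.
  rewrite (_ : 1/2 * 2%:R = 1) ?powRr1; [|exact: ltW (rho_gt0 _ (d0 x xI))|by field].
  exact: rP (cl z zI).
split.
  split=> //; split.
    have k0 : 0 <= K ^+ 2 * P * pow_cst (-1) 1 0 by rewrite !mulr_ge0 ?sqr_ge0 ?pow_cst_ge0//; lra.
    apply: le_lt_trans (integral_four_powR_lt x01 xcI (q := 0) _ k0 (lexx 0) (lexx 0) (lexx 0)); last by rewrite lexx ltr01.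
    apply: le_integral_ae => //.
    - apply/measurable_EFinP; repeat (apply: measurable_funD => //); apply: measurable_funM => //; exact: measurable_abs_powR.
    - by move=> x _; apply: integral_ge0 => z _; rewrite lee_fin sqr_ge0.
    - by move=> x _; rewrite lee_fin !mul0r !addr0.
    - by apply: aeW => x; rewrite /= in_itv /= => xI; rewrite !mul0r !addr0; exact: L0.
  (* [th] is the midpoint of s and 5/6: th > s gives be < 1, and th < 5/6 gives q < 1. The gap s <
     5/6 is exactly sigma < 1/2. *)
  set s := (2 + sigma) / 3; pose th := (s + 5/6) / 2.
  pose q := (6 * th - 1) / 4; pose be := 1 + 2 * s - 2 * th.
  have hq : 0 <= q < 1 by rewrite /q /th /s; apply/andP; split; lra.
  have hbe : 0 <= be < 1 by rewrite /be /th /s; apply/andP; split; lra.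
  have hth : 1/6 <= th <= 1 by rewrite /th /s; apply/andP; split; lra.
  have c0 : 0 <= pow_cst (-1) 1 q :> R by apply: pow_cst_ge0; case/andP: hq.
  have k0 : 0 <= 16 * K ^+ 2 * pow_cst (-1) 1 q by apply: mulr_ge0 => //; apply: mulr_ge0 => //; exact: sqr_ge0.
  apply: le_lt_trans (ltry _).
  apply: (@double_integral_le _ x0 x1 xc q be (16 * K ^+ 2 * pow_cst (-1) 1 q)) => //.
    move=> x y _ _; apply: mule_ge0; last by rewrite lee_fin invr_ge0 powR_ge0.
    by apply: integral_ge0 => z _; rewrite lee_fin sqr_ge0.
  move=> x y xI yI _ _ xy.
  have h0 : 0 < `|x - y| by rewrite normr_gt0 subr_eq0.
  have hoel (x' y' z : R) : x0 < x' < x1 -> x0 < y' < x1 -> -1 < z < 1 -> z != 0 -> `|x' - xc| < `|y' - xc| ->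
      (u x' z - u y' z) ^+ 2 <= 16 * K ^+ 2 * (`|x' - y'| `^ (2 * th) *
        (`|x' - xc| `^ (- q) + `|y' - xc| `^ (- q))) * `|z| `^ (- q).
    move=> xI' yI' zI z0 dxy; rewrite !hu//.
    have b0 (x'' z' : R) : x0 < x'' < x1 -> -1 <= z' <= 1 -> `|Vf0 g F xc x'' z'| <= K * rho `|x'' - xc| z' `^ (1/2).
      by move=> h1 h2; have [] := hb x'' z' h1 h2.
    have := Vf0_hoelder hp hF x01 hxc K0 b0 hx hth xI' yI' (cl z zI) dxy.
    move=> /ler_sqr_norm h; apply: (le_trans h).
    have sq (A B : R) : (4 * K * (A * B)) ^+ 2 = 16 * K ^+ 2 * (A ^+ 2 * B ^+ 2) by clear; ring.
    have hA : (`|x' - y'| `^ th) ^+ 2 = `|x' - y'| `^ (2 * th).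
      by rewrite -powR_mulrn ?powR_ge0// -powRrM mulrC.
    rewrite sq hA (sqr_powRN _ (rho_gt0 z (d0 x' xI'))).
    have rb := @rho_powRN_le _ `|x' - xc| z (2 * (3 * th - 1/2)) (d0 x' xI') z0 ltac:(lra).
    have qe : 2 * (3 * th - 1/2) / 4 = q by rewrite /q; field.
    rewrite qe in rb.
    have y0 : 0 <= `|y' - xc| `^ (- q) by exact: powR_ge0.
    have zz : 0 <= `|z| `^ (- q) by exact: powR_ge0.
    have H0 : 0 <= `|x' - y'| `^ (2 * th) by exact: powR_ge0.
    have le1 : `|x' - xc| `^ (- q) <= `|x' - xc| `^ (- q) + `|y' - xc| `^ (- q) by rewrite lerDl.
    have := le_trans rb (ler_wpM2l zz le1).
    move: (rho _ _ `^ _) (`|x' - xc| `^ _) (`|y' - xc| `^ _) (`|z| `^ _) (`|x' - y'| `^ _) H0 => a b c e H H0 abc.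
    have := ler_wpM2l (mulr_ge0 (sqr_ge0 (4 * K)) H0) abc; clear; nra.
  have hL : (L2sq (-1) 1 (fun z => u x z - u y z)%R <= (16 * K ^+ 2 * (`|x - y| `^ (2 * th) *
        (`|x - xc| `^ (- q) + `|y - xc| `^ (- q))) * pow_cst (-1) 1 q)%:E)%E.
    apply: L2sq_le => //.
      by apply: mulr_ge0; [rewrite mulr_ge0 ?sqr_ge0|rewrite mulr_ge0 ?addr_ge0 ?powR_ge0].
    move=> z zI z0; case: (ltgtP `|x - xc| `|y - xc|) => [h|h|h]; first exact: hoel.
      by rewrite -sqrrN opprB distrC (addrC (`|x - xc| `^ _)); exact: hoel.
    (* Equal distances would force x = y, because the interval lies on one side of [xc]. *)
    exfalso; move/eqP: xy; apply; move: h.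
    case: hxc xI yI => -> /andP[? ?] /andP[? ?]; first by rewrite !ger0_norm; lra.
    by rewrite !ler0_norm; lra.
  have hr : 0 <= (`|x - y| `^ (1 + 2 * s))^-1 by rewrite invr_ge0 powR_ge0.
  have := lee_wpmul2r (x := ((`|x - y| `^ (1 + 2 * s))^-1)%:E) _ hL.
  rewrite lee_fin => /(_ hr) h; apply: (le_trans h); rewrite -EFinM lee_fin.
  have eh : `|x - y| `^ (2 * th) / `|x - y| `^ (1 + 2 * s) = `|x - y| `^ (- be).
    by rewrite -powRN -powRD ?(gt_eqF h0) ?implybT//; congr (_ `^ _); rewrite /be; ring.
  by rewrite -eh le_eqVlt; apply/orP; left; apply/eqP; clear; ring.
exists (Vf1 g g1 F xc), (Vf2 g g1 g2 F xc); do 3 (split=> //).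
split.
  (* The derivatives in z are classical for every x of the open interval, since it does not contain
     [xc]. *)
  apply: aeW => x; rewrite /= in_itv /= => xI.
  have D z := is_derive_Vf z hp hF (nxc x xI).
  split.
    apply: (@weak_deriv_ext _ _ (Vf0 g F xc x)); first by move=> z zI; exact: hu.
    by apply: weak_deriv_C1 => z; [have [] := D z|have [_ h _] := D z; exact: is_derive_continuous h].
  by apply: weak_deriv_C1 => z; [have [_ h _] := D z|have [_ _ h] := D z; exact: is_derive_continuous h].
(* Here and in [L2], the squares of rho^(-1/2) and rho^(-3/2) are the cases m = 1 and m = 3 of
   [rho_powRN_le], whence the exponents 1/4 and 3/4. *)
have L1 x : x0 < x < x1 -> (L2sq (-1) 1 (Vf1 g g1 F xc x) <= (K ^+ 2 * pow_cst (-1) 1 (1/4) * `|x - xc| `^ (- (1/4)))%:E)%E.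
  move=> xI; rewrite mulrAC; apply: L2sq_le; [lra|by rewrite mulr_ge0 ?sqr_ge0 ?powR_ge0|].
  move=> z zI z0; have [_ h _ _] := hb x z xI (cl z zI); apply: (le_trans (ler_sqr_norm h)).
  rewrite exprMn -[leRHS]mulrA (sqr_powRN _ (rho_gt0 z (d0 x xI))); apply: ler_wpM2l; first exact: sqr_ge0.
  rewrite [leRHS]mulrC.
  rewrite (_ : 2 * (1/2) = 1); last by field.
  by apply: rho_powRN_le => //; exact: d0.
have L2 x : x0 < x < x1 -> (L2sq (-1) 1 (Vf2 g g1 g2 F xc x) <= (K ^+ 2 * pow_cst (-1) 1 (3/4) * `|x - xc| `^ (- (3/4)))%:E)%E.
  move=> xI; rewrite mulrAC; apply: L2sq_le; [lra|by rewrite mulr_ge0 ?sqr_ge0 ?powR_ge0|].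
  move=> z zI z0; have [_ _ h _] := hb x z xI (cl z zI); apply: (le_trans (ler_sqr_norm h)).
  rewrite exprMn -[leRHS]mulrA (sqr_powRN _ (rho_gt0 z (d0 x xI))); apply: ler_wpM2l; first exact: sqr_ge0.
  rewrite [leRHS]mulrC.
  rewrite (_ : 2 * (3/2) = 3); last by field.
  by apply: rho_powRN_le => //; exact: d0.
(* The midpoint of the range that [gagliardo_le] allows. *)
pose th := (sigma + 1/2) / 2.
set q := (3 + 2 * th) / 4.
have hq : 0 <= q < 1 by rewrite /q /th; apply/andP; split; lra.
pose G := 128 * K ^+ 2 * (5 * pow_cst (-1) 1 q * pow_cst (-1) 1 (1 + 2 * sigma - 2 * th)).
have G0 : 0 <= G.
  have q0 : 0 <= pow_cst (-1) 1 q :> R by apply: pow_cst_ge0; case/andP: hq.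
  have b0 : 0 <= pow_cst (-1) 1 (1 + 2 * sigma - 2 * th) :> R by apply: pow_cst_ge0; rewrite /th; lra.
  by apply: mulr_ge0; apply: mulr_ge0 => //; [exact: sqr_ge0|apply: mulr_ge0].
have L3 x : x0 < x < x1 -> ((if sigma == 0%R then 0 else gagliardo (-1) 1 sigma (Vf2 g g1 g2 F xc x)) <= (G * `|x - xc| `^ (- q))%:E)%E.
  move=> xI; case: eqP => [_|/eqP sn]; first by rewrite lee_fin mulr_ge0 ?powR_ge0.
  have sp : 0 < sigma by rewrite lt_neqAle eq_sym sn.
  have -> : G * `|x - xc| `^ (- q) = 128 * K ^+ 2 * `|x - xc| `^ (- q) * (5 * pow_cst (-1) 1 q * pow_cst (-1) 1 (1 + 2 * sigma - 2 * th)).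
    by rewrite /G; ring.
  apply: (@gagliardo_le _ (Vf3 g g1 g2 g3 F xc x)) => //.
  - exact: d0.
  - by rewrite /th; apply/andP; split; lra.
  - by move=> z; have [] := is_derive_Vf z hp hF (nxc x xI).
  - by move=> z zI; have [_ _ ? ?] := hb x z xI zI.
have c0 q' : q' < 1 -> 0 <= pow_cst (-1) 1 q' :> R by exact: pow_cst_ge0.
have k0 : 0 <= K ^+ 2 * P * pow_cst (-1) 1 0 by rewrite !mulr_ge0 ?sqr_ge0 ?c0//; lra.
have k1 : 0 <= K ^+ 2 * pow_cst (-1) 1 (1/4) by apply: mulr_ge0; [exact: sqr_ge0|apply: c0; clear; lra].
have k2 : 0 <= K ^+ 2 * pow_cst (-1) 1 (3/4) by apply: mulr_ge0; [exact: sqr_ge0|apply: c0; clear; lra].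
apply: le_lt_trans (integral_four_powR_lt x01 xcI hq k0 k1 k2 G0).
apply: le_integral_ae => //.
- apply/measurable_EFinP; repeat (apply: measurable_funD => //); apply: measurable_funM => //; exact: measurable_abs_powR.
- move=> x _; have L20 (f : R -> R) : (0 <= L2sq (-1) 1 f)%E.
    by apply: integral_ge0 => z _; rewrite lee_fin sqr_ge0.
  apply: adde_ge0; first by apply: adde_ge0 => //; exact: adde_ge0.
  case: ifP => // _; apply: integral_ge0 => z _; apply: integral_ge0 => w _.
  by rewrite lee_fin divr_ge0 ?sqr_ge0 ?powR_ge0.
- move=> x _; rewrite lee_fin; apply: addr_ge0; last exact: mulr_ge0 (powR_ge0 _ _).
  apply: addr_ge0; last exact: mulr_ge0 (powR_ge0 _ _).
  by apply: addr_ge0; last exact: mulr_ge0 (powR_ge0 _ _).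
- apply: aeW => x; rewrite /= in_itv /= => xI; rewrite !EFinD.
  by apply: leeD; [apply: leeD; [apply: leeD; [exact: L0|exact: L1]|exact: L2]|exact: L3].
Qed.

End SobolevRegularity.

Theorem lemma2p19 (R : realType) (x0 x1 : R) (hx : x0 < x1)
  (i : bool) (chi : R -> R -> R) (Rbar : R)
  (hRbar : Rbar < Num.min 1 (x1 - x0) / 2)
  (hchi_smooth : Cinf_closed x0 x1 chi)
  (hchi_one : exists e : R, 0 < e /\
      forall p, Omega_bar x0 x1 p -> dist2 p (xi x0 x1 i, 0) < e -> chi p.1 p.2 = 1)
  (hchi_supp : forall p, supp_closed x0 x1 chi p -> dist2 p (xi x0 x1 i, 0) < Rbar)
  (sigma : R) (hsigma : 0 <= sigma < 1/2) :
  H_s_L2 x0 x1 ((2 + sigma) / 3) (u_sing x0 x1 i chi) /\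
  L2_H2s x0 x1 sigma (u_sing x0 x1 i chi).
Proof.
have [F [hF hFchi]] := hchi_smooth.
have [g [g1 [g2 [g3 [C [hp LE]]]]]] := @Lambda0_profile R.
have e2 : ((-1) ^+ i : R) ^+ 2 = 1 by rewrite sqrr_sign.
have hxc : xi x0 x1 i = x0 \/ xi x0 x1 i = x1 by rewrite /xi; case: (i); [right|left].
apply: (Vf_regularity (profile_bounds_sign e2 hp) hF hx hxc hsigma) => x z xI zI.
have d0 : 0 < `|x - xi x0 x1 i|.
  by rewrite normr_gt0 subr_eq0; case: hxc => ->; apply/eqP => eq; move: xI; rewrite eq ltxx ?andbF.
have Fchi : F (x, z) = chi x z.
  by apply: (hFchi (x, z)); case/andP: xI => /ltW ? /ltW ?; case/andP: zI => /ltW ? /ltW ?; split; apply/andP.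
rewrite /u_sing /Vf0 /Uf Fchi LE; congr (_ * _).
move: (`|x - xi x0 x1 i| : R) d0 => d d0; set e := (-1) ^+ i; rewrite -(mulrA e).
set t := e * (z * d `^ (- (1/3))).
have t1 : 0 < 1 + t ^+ 2 by rewrite ltr_wpDr ?sqr_ge0.
have DE : d `^ (2/3) * (d `^ (- (1/3))) ^+ 2 = 1.
  rewrite -(powR_mulrn 2 (powR_ge0 d _)) -powRrM -powRD ?(gt_eqF d0) ?implybT//.
  by rewrite (_ : 2/3 + - (1/3) * 2%:R = 0) ?powRr0//; field.
(* This is r^2 = d^(2/3) (1 + t^2), so r^(1/2) = d^(1/6) (1 + t^2)^(1/4), whose second factor
   cancels the weight in [Lambda0]. *)
have -> : z ^+ 2 + d `^ (2/3) = d `^ (2/3) * (1 + t ^+ 2).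
  rewrite /t; move: (d `^ (2/3)) (d `^ (- (1/3))) DE => D E DE.
  by rewrite !exprMn e2 mul1r mulrDr mulr1 (mulrCA D) DE mulr1 addrC.
have cancel : (1 + t ^+ 2) `^ (2^-1 * (1/2)) * (1 + t ^+ 2) `^ (- (1/4)) = 1.
  rewrite -powRD ?(gt_eqF t1) ?implybT// (_ : 2^-1 * (1/2) + - (1/4) = 0) ?powRr0//.
  by field.
rewrite -powR12_sqrt ?mulr_ge0 ?powR_ge0 ?(ltW t1)// -powRrM powRM ?powR_ge0 ?(ltW t1)//.
rewrite -mulrA (mulrA _ _ (g t)) cancel mul1r -powRrM.
by congr (_ `^ _ * _); field.
Qed.
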